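(* Let $I$ be an infinite index set, let $R$ be the irreducible locally finite root system of type $BC_I$, and let $\mathfrak q=(\mathfrak a,*,\mathcal C,f)$ be a coordinate quadruple of type $BC$ with associated algebra $\mathfrak b=\mathfrak b(\mathfrak q)$. Let $\mathcal K$ be a subspace of $\mathrm{HF}(\mathfrak b)$ satisfying the uniform property on $\mathfrak b$, and let $$\mathcal L=\mathcal L(\mathfrak q,\mathcal K)=(\mathcal G\otimes\mathcal A)\oplus(\mathcal S\otimes\mathcal B)\oplus(\mathcal V\otimes\mathcal C)\oplus\langle\mathfrak b,\mathfrak b\rangle,\qquad \langle\mathfrak b,\mathfrak b\rangle=\{\mathfrak b,\mathfrak b\}/\mathcal K,$$ be the corresponding $R$-graded Lie algebra. Let $\tau:\mathcal L\times\mathcal L\to E$ be a 2-cocycle with values in a vector space $E$, let $\tilde{\mathcal L}=\mathcal L\oplus E$ be the corresponding central extension (with bracket $[x+e,y+e']^{\sim}=[x,y]+\tau(x,y)$) and let $\pi:\tilde{\mathcal L}\to\mathcal L$ be the canonical projection. If $\tilde{\mathcal L}$ is perfect, then $\tilde{\mathcal L}$ is an $R$-graded Lie algebra with the same coordinate quadruple $(\mathfrak a,*,\mathcal C,f)$. Moreover, there is a subspace $\mathcal K_0$ of $\mathrm{HF}(\mathfrak b)$ satisfying the uniform property on $\mathfrak b$ such that $\tilde{\mathcal L}$ can be identified, as a Lie algebra, with $$\mathcal L(\mathfrak q,\mathcal K_0)=(\mathcal G\otimes\mathcal A)\oplus(\mathcal S\otimes\mathcal B)\oplus(\mathcal V\otimes\mathcal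 C)\oplus(\{\mathfrak b,\mathfrak b\}/\mathcal K_0),$$ whose Lie bracket is given by the bracket formulas of $\mathcal L(\mathfrak q,\mathcal K_0)$ listed in the context, with $\langle\beta,\beta'\rangle$ replaced by $\langle\beta,\beta'\rangle_c:=\{\beta,\beta'\}+\mathcal K_0$. Under this identification, $\pi$ is given by $\pi(x)=x$ for $x\in(\mathcal G\otimes\mathcal A)\oplus(\mathcal S\otimes\mathcal B)\oplus(\mathcal V\otimes\mathcal C)$ and $\pi(\langle\beta,\beta'\rangle_c)=\langle\beta,\beta'\rangle=\{\beta,\beta'\}+\mathcal K$ for $\beta,\beta'\in\mathfrak b$.
   Context: All vector spaces and algebras are over a fixed field $\mathbb F$ of characteristic zero. **Coordinate quadruples of type $BC$.** A coordinate quadruple of type $BC$ is $\mathfrak q=(\mathfrak a,*,\mathcal C,f)$ where $\mathfrak a$ is a unital associative algebra, $*$ is an involution of $\mathfrak a$ (an antiautomorphism with $*^2=\mathrm{id}$), $\mathcal C$ is a unital associative left $\mathfrak a$-module and $f:\mathcal C\times\mathcal C\to\mathfrak a$ is a skew-hermitian form: bilinear over $\mathbb F$, $f(\alpha c,c')=\alpha f(c,c')$ and $f(c,c')^*=-f(c',c)$. Let $\mathcal A,\mathcal B$ be the spaces of $*$-fixed and $*$-skew-fixed elements of $\mathfrak a$. On $\mathfrak b=\mathfrak b(\mathfrak q):=\mathfrak a\oplus\mathcal C$ put $(\alpha_1+c_1)\cdot(\alpha_2+c_2)=\alpha_1\alpha_2+f(c_1,c_2)+\alpha_1c_2+\alpha_2^*c_1$,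 $\beta\circ\beta'=\beta\cdot\beta'+\beta'\cdot\beta$, $[\beta,\beta']=\beta\cdot\beta'-\beta'\cdot\beta$. For $c,c'\in\mathcal C$ put $c\diamond c'=\frac12(f(c,c')-f(c',c))\in\mathcal A$ and $c\heartsuit c'=\frac12(f(c,c')+f(c',c))\in\mathcal B$. Fix an integer $\ell>3$. Define linear maps $d_{\beta,\beta'}:\mathfrak b\to\mathfrak b$ (derivations) by: for $\alpha,\alpha'\in\mathfrak a$, $d_{\alpha,\alpha'}(\beta)=\frac1{4\ell}[[\alpha,\alpha']+[\alpha^*,\alpha'^*],\beta]$ if $\beta\in\mathfrak a$ and $d_{\alpha,\alpha'}(\beta)=\frac1{4\ell}([\alpha,\alpha']+[\alpha^*,\alpha'^*])\cdot\beta$ if $\beta\in\mathcal C$; for $c,c'\in\mathcal C$, $d_{c,c'}(\beta)=-\frac1{2\ell}[c\heartsuit c',\beta]$ if $\beta\in\mathfrak a$ and $d_{c,c'}(\beta)=-\frac1{2\ell}(c\heartsuit c')\cdot\beta-\frac12(f(\beta,c')\cdot c+f(\beta,c)\cdot c')$ if $\beta\in\mathcal C$; $d_{\alpha,c}=d_{c,\alpha}=0$; $d_{\alpha+c,\alpha'+c'}=d_{\alpha,\alpha'}+d_{c,c'}$. Let $K\subseteq\mathfrak b\otimes\mathfrak b$ be the span of $\alpha\otimes c$, $c\otimes\alpha$, $a\otimes b$, $\alpha\otimes\alpha'+\alpha'\otimes\alpha$, $c\otimes c'-c'\otimes c$, $(\alpha\cdot\alpha')\otimes\alpha''+(\alpha''\cdot\alpha)\otimes\alpha'+(\alpha'\cdot\alpha'')\otimes\alpha$,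 $f(c,c')\otimes\alpha+(\alpha^*\cdot c')\otimes c-(\alpha\cdot c)\otimes c'$ ($\alpha,\alpha',\alpha''\in\mathfrak a$, $a\in\mathcal A$, $b\in\mathcal B$, $c,c'\in\mathcal C$). Put $\{\mathfrak b,\mathfrak b\}=(\mathfrak b\otimes\mathfrak b)/K$ and $\{\beta,\beta'\}=\beta\otimes\beta'+K$; it is a Lie algebra with $[\{\beta_1,\beta_2\},\{\beta_1',\beta_2'\}]=\{d_{\beta_1,\beta_2}(\beta_1'),\beta_2'\}+\{\beta_1',d_{\beta_1,\beta_2}(\beta_2')\}$. Put $\mathrm{HF}(\mathfrak b)=\{\sum_i\{\beta_i,\beta_i'\}\mid\sum_i d_{\beta_i,\beta_i'}=0\}$. For $\beta_r=a_r+b_r+c_r$ ($a_r\in\mathcal A$, $b_r\in\mathcal B$, $c_r\in\mathcal C$, $r=1,2$) put $\beta^*_{\beta_1,\beta_2}=[a_1,a_2]+[b_1,b_2]-c_1\heartsuit c_2$, $\beta_1^*=c_1$, $\beta_2^*=c_2$. A subspace $\mathcal K$ of $\mathrm{HF}(\mathfrak b)$ satisfies the *uniform property on $\mathfrak b$* if $\sum_i\{\beta_i,\beta_i'\}\in\mathcal K$ implies $\sum_i\beta^*_{\beta_i,\beta_i'}=0$. **Matrices.** Let $I$ be an infinite set, $J=I\uplus\bar I$, $\mathcal V$ a vector space with basis $\{v_j\mid j\in J\}$, $e_{j,k}v_i=\delta_{k,i}v_j$, $\mathfrak{gl}(J)=\mathrm{span}\{e_{j,k}\mid j,k\in J\}$.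 Let $(\cdot,\cdot)$ be the bilinear form on $\mathcal V$ with $(v_j,v_{\bar k})=-(v_{\bar k},v_j)=2\delta_{j,k}$, $(v_j,v_k)=(v_{\bar j},v_{\bar k})=0$ ($j,k\in I$). Put $\mathcal G=\mathfrak{sp}(I)=\{\phi\in\mathfrak{gl}(J)\mid(\phi v,w)=-(v,\phi w)\ \forall v,w\}$, $\mathcal S=\{\phi\in\mathfrak{gl}(J)\mid \mathrm{tr}\,\phi=0,\ (\phi v,w)=(v,\phi w)\ \forall v,w\}$ and $\mathcal H=\mathrm{span}\{e_{i,i}-e_{\bar i,\bar i}\mid i\in I\}$. Fix $I_0\subseteq I$ with $|I_0|=\ell$ and let $\mathfrak I_0$ be the endomorphism of $\mathcal V$ with $\mathfrak I_0v_j=v_j$ for $j\in I_0\cup\bar I_0$ and $\mathfrak I_0v_j=0$ otherwise. For $e,e'\in\mathcal G\cup\mathcal S\cup\{\mathfrak I_0\}$ put $[e,e']=ee'-e'e$ and $e\circ e'=ee'+e'e-\frac{\mathrm{tr}(ee')}{\ell}\mathfrak I_0$. For $u,v\in\mathcal V$ let $u\circ v\in\mathcal G$ and $[u,v]\in\mathcal S$ be $(u\circ v)(w)=\frac12((v,w)u+(u,w)v)$ and $[u,v](w)=\frac12((v,w)u-(u,w)v)+\frac{(u,v)}{2\ell}\mathfrak I_0w$. **The Lie algebra $\mathcal L(\mathfrak q,\mathcal K)$.** For a subspace $\mathcal K\subseteq\mathrm{HF}(\mathfrak b)$ with the uniform property, $\mathcal L(\mathfrak q,\mathcal K)=(\mathcal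 G\otimes\mathcal A)\oplus(\mathcal S\otimes\mathcal B)\oplus(\mathcal V\otimes\mathcal C)\oplus(\{\mathfrak b,\mathfrak b\}/\mathcal K)$ with, writing $\langle\beta,\beta'\rangle=\{\beta,\beta'\}+\mathcal K$, the (antisymmetric) bracket - $[x\otimes a,y\otimes a']=[x,y]\otimes\frac12(a\circ a')+(x\circ y)\otimes\frac12[a,a']+\mathrm{tr}(xy)\langle a,a'\rangle$, - $[x\otimes a,s\otimes b]=(x\circ s)\otimes\frac12[a,b]+[x,s]\otimes\frac12(a\circ b)$, - $[s\otimes b,t\otimes b']=[s,t]\otimes\frac12(b\circ b')+(s\circ t)\otimes\frac12[b,b']+\mathrm{tr}(st)\langle b,b'\rangle$, - $[x\otimes a,u\otimes c]=xu\otimes a\cdot c$, $\ [s\otimes b,u\otimes c]=su\otimes b\cdot c$, - $[u\otimes c,v\otimes c']=(u\circ v)\otimes(c\diamond c')+[u,v]\otimes(c\heartsuit c')+(u,v)\langle c,c'\rangle$, - $[\langle\beta_1,\beta_2\rangle,x\otimes a]=-\frac1{4\ell}((x\circ\mathfrak I_0)\otimes[a,\beta^*_{\beta_1,\beta_2}]+[x,\mathfrak I_0]\otimes(a\circ\beta^*_{\beta_1,\beta_2}))$, - $[\langle\beta_1,\beta_2\rangle,s\otimes b]=-\frac1{4\ell}([s,\mathfrak I_0]\otimes(b\circ\beta^*_{\beta_1,\beta_2})+(s\circ\mathfrak I_0)\otimes[b,\beta^*_{\beta_1,\beta_2}]+2\,\mathrm{tr}(s\mathfrak I_0)\langle b,\beta^*_{\beta_1,\beta_2}\rangle)$,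 - $[\langle\beta_1,\beta_2\rangle,v\otimes c]=\frac1{2\ell}\mathfrak I_0v\otimes(\beta^*_{\beta_1,\beta_2}\cdot c)-\frac12v\otimes(f(c,\beta_2^* )\cdot\beta_1^*+f(c,\beta_1^* )\cdot\beta_2^* )$, - $[\langle\beta_1,\beta_2\rangle,\langle\beta_1',\beta_2'\rangle]=\langle d_{\beta_1,\beta_2}(\beta_1'),\beta_2'\rangle+\langle\beta_1',d_{\beta_1,\beta_2}(\beta_2')\rangle$, for $x,y\in\mathcal G$, $s,t\in\mathcal S$, $u,v\in\mathcal V$, $a,a'\in\mathcal A$, $b,b'\in\mathcal B$, $c,c'\in\mathcal C$, $\beta_r,\beta_r'\in\mathfrak b$. $\mathcal G$ is identified with $\mathcal G\otimes1$. **Graded Lie algebras.** $R=\{0,\pm\epsilon_i,\pm2\epsilon_i,\pm\epsilon_i\pm\epsilon_j\mid i\ne j\in I\}$ is the root system of type $BC_I$. A Lie algebra $\mathcal M$ is $R$-graded with grading pair $(\mathfrak g,\mathfrak h)$ if $\mathfrak g$ is a locally finite split simple Lie subalgebra of $\mathcal M$ with splitting Cartan subalgebra $\mathfrak h$ and root system $R_{sdiv}=R\setminus\{\pm\epsilon_i\mid i\in I\}$ (type $C_I$), $\mathcal M=\bigoplus_{\alpha\in R}\mathcal M_\alpha$ is a weight space decomposition with respect to $\mathfrak h$ (adjoint action), and $\mathcal M_0=\sum_{\alpha\in R\setminus\{0\}}[\mathcal M_\alpha,\mathcal M_{-\alpha}]$. $\mathcal L(\mathfrak q,\mathcal K)$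 is $R$-graded with grading pair $(\mathcal G,\mathcal H)$. An $R$-graded Lie algebra has coordinate quadruple $\mathfrak q$ if it is isomorphic to $\mathcal L(\mathfrak q,\mathcal K')$ for some subspace $\mathcal K'$ of $\mathrm{HF}(\mathfrak b(\mathfrak q))$ with the uniform property. A 2-cocycle is an alternating bilinear map with $\tau([x,y],z)+\tau([y,z],x)+\tau([z,x],y)=0$. A Lie algebra is perfect if it equals its derived algebra. *)

(* Defs.v *)
From HB Require Import structures.
From mathcomp Require Import all_boot all_order all_algebra finmap.
From mathcomp Require Import boolp classical_sets functions cardinality fsbigop.
From mathcomp Require Import freeg.

Set Implicit Arguments.
Unset Strict Implicit.
Unset Printing Implicit Defensive.

Import GRing.Theory.
Local Open Scope classical_set_scope.
Local Open Scope quotient_scope.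
Local Open Scope ring_scope.

Section Span.
Variables (F : fieldType) (V : lmodType F).

Definition lspan (X : set V) : {pred V} := fun x =>
  `[< exists s : seq (F * V),
        {in s, forall p, X p.2} /\ x = \sum_(p <- s) p.1 *: p.2 >].

Lemma lspan_submod_closed (X : set V) : submod_closed (lspan X).
Proof.
split=> [|k x y /asboolP[s [sX ->]] /asboolP[t [tX ->]]]; apply/asboolP.
  by exists [::]; rewrite big_nil.
exists ([seq (k * p.1, p.2) | p <- s] ++ t); split.
  by move=> p; rewrite mem_cat => /orP[/mapP[r /sX rX ->]|/tX].
rewrite big_cat big_map scaler_sumr /=.
by congr (_ + _); apply: eq_bigr => p _; rewrite scalerA.
Qed.

HB.instance Definition _ X := GRing.isSubmodClosed.Build F V (lspan X)
  (lspan_submod_closed X).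

Lemma mem_lspan (X : set V) x : X x -> x \in lspan X.
Proof.
move=> Xx; apply/asboolP; exists [:: (1, x)].
by split=> [p|]; rewrite ?inE ?big_seq1 ?scale1r // => /eqP->.
Qed.

Lemma lspan_sub (X : set V) (K : submodClosed V) :
  (forall x, X x -> x \in K) -> {subset lspan X <= K}.
Proof.
move=> XK x /asboolP[s [sX ->]]; rewrite big_seq.
by apply: rpred_sum => p ps; apply/rpredZ/XK/sX.
Qed.

End Span.

Section SubQuotient.
Variables (F : fieldType) (V : lmodType F) (K : submodClosed V).

Record submod := Submod { submod_val : V; _ : submod_val \in K }.

HB.instance Definition _ := [isSub for submod_val].
HB.instance Definition _ := [Choice of submod by <:].
HB.instance Definition _ := [SubChoice_isSubLmodule of submod by <:].

(* Only used on elements of K; elsewhere the value is 0. *)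
Definition tosub (x : V) : submod := insubd 0 x.

Lemma tosubK (x : V) : x \in K -> val (tosub x) = x.
Proof. exact: insubdK. Qed.

Definition zsubmod : {pred V} := K.

Lemma zsubmod_closed : zmod_closed zsubmod.
Proof. exact: (submodClosedP K). Qed.

HB.instance Definition _ := GRing.isZmodClosed.Build V zsubmod zsubmod_closed.

Definition quotm : Type := Quotient.quot zsubmod.

HB.instance Definition _ := GRing.Zmodule.on quotm.
HB.instance Definition _ := EqQuotient.on quotm.

Definition qproj (x : V) : quotm := \pi_quotm x.

Lemma qprojB x y : qproj (x - y) = qproj x - qproj y.
Proof. by rewrite /qproj !piE. Qed.

Lemma qprojP x y : reflect (qproj x = qproj y) (x - y \in K).
Proof. by rewrite [_ \in _](Quotient.idealrBE zsubmod); apply: eqP. Qed.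

Lemma qprojD x y : qproj (x + y) = qproj x + qproj y.
Proof. by rewrite /qproj !piE. Qed.

Definition qscale (k : F) (x : quotm) : quotm := qproj (k *: repr x).

Lemma qprojZ k x : qproj (k *: x) = qscale k (qproj x).
Proof.
apply/qprojP; rewrite -scalerBr; apply/rpredZ/qprojP.
by rewrite /qproj reprK.
Qed.

Lemma qprojW (P : quotm -> Prop) : (forall x, P (qproj x)) -> forall x, P x.
Proof. by move=> Pq x; rewrite -[x]reprK; apply: Pq. Qed.

Lemma qscaleA k l x : qscale k (qscale l x) = qscale (k * l) x.
Proof. by elim/qprojW: x => x; rewrite -!qprojZ scalerA. Qed.

Lemma qscale1 : left_id 1 qscale.
Proof. by move=> x; elim/qprojW: x => x; rewrite -!qprojZ scale1r. Qed.

Lemma qscaleDr : right_distributive qscale +%R.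
Proof.
move=> k x y; elim/qprojW: x => x; elim/qprojW: y => y.
by rewrite -qprojD -!qprojZ scalerDr qprojD.
Qed.

Lemma qscaleDl x : {morph qscale^~ x : k l / k + l}.
Proof. by move=> k l; elim/qprojW: x => x; rewrite -!qprojZ scalerDl qprojD. Qed.

HB.instance Definition _ := GRing.Zmodule_isLmodule.Build F quotm
  qscaleA qscale1 qscaleDr qscaleDl.

Lemma qproj_linear : linear qproj.
Proof. by move=> k x y; rewrite qprojD qprojZ. Qed.

HB.instance Definition _ := GRing.isLinear.Build F V quotm _ qproj qproj_linear.

End SubQuotient.

Section Tensor.
Variables (F : fieldType) (U W : lmodType F).

Local Notation gens := {freeg (U * W)%type / F}.
Local Notation gen u w := (<< (u, w) >> : gens).

Inductive tensor_rel : set gens :=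
  | TensorDl u u' w : tensor_rel (gen (u + u') w - gen u w - gen u' w)
  | TensorDr u w w' : tensor_rel (gen u (w + w') - gen u w - gen u w')
  | TensorZl k u w : tensor_rel (gen (k *: u) w - k *: gen u w)
  | TensorZr k u w : tensor_rel (gen u (k *: w) - k *: gen u w).

Definition tensor : Type := quotm (lspan tensor_rel).

HB.instance Definition _ := GRing.Lmodule.on tensor.

Definition tens (u : U) (w : W) : tensor := qproj _ (gen u w).

Lemma tens_linearl w : linear (tens^~ w).
Proof.
move=> k u u'.
transitivity (qproj (lspan tensor_rel) (k *: gen u w + gen u' w)); last first.
  exact: qproj_linear.
apply/qprojP.
have E (a b c e : gens) : a - (c + e) = (a - b - e) + (b - c).
  by rewrite addrACA subrK opprD [- c + _]addrC.
rewrite (E _ (gen (k *: u) w)); apply: rpredD; apply: mem_lspan; first exact: (TensorDl (k *: u) u' w).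
exact: (TensorZl k u w).
Qed.

Lemma tens_linearr u : linear (tens u).
Proof.
move=> k w w'.
transitivity (qproj (lspan tensor_rel) (k *: gen u w + gen u w')); last first.
  exact: qproj_linear.
apply/qprojP.
have E (a b c e : gens) : a - (c + e) = (a - b - e) + (b - c).
  by rewrite addrACA subrK opprD [- c + _]addrC.
rewrite (E _ (gen u (k *: w))); apply: rpredD; apply: mem_lspan; first exact: (TensorDr u (k *: w) w').
exact: (TensorZr k u w).
Qed.

End Tensor.

Notation "u ⊗ w" := (tens u w) (at level 40, left associativity) : ring_scope.

Section Lie.
Variables (F : fieldType) (M : lmodType F) (br : M -> M -> M).

Definition lie_bracket : Prop :=
  [/\ forall y, linear (br^~ y), forall x, linear (br x),
      forall x, br x x = 0 &
      forall x y z, br (br x y) z + br (br y z) x + br (br z x) y = 0].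

Definition perfect : Prop :=
  forall x, x \in lspan [set z | exists u v, z = br u v].

Definition cocycle2 (E : lmodType F) (tau : M -> M -> E) : Prop :=
  [/\ forall y, linear (tau^~ y), forall x, linear (tau x),
      forall x, tau x x = 0 &
      forall x y z,
        tau (br x y) z + tau (br y z) x + tau (br z x) y = 0].

Definition ext_bracket (E : lmodType F) (tau : M -> M -> E) :
    M * E -> M * E -> M * E :=
  fun X Y => (br X.1 Y.1, tau X.1 Y.1).

Definition lie_iso (N : lmodType F) (brN : N -> N -> N) (phi : M -> N) : Prop :=
  [/\ linear phi, bijective phi & {morph phi : x y / br x y >-> brN x y}].

Definition subalgebra (S : submodClosed M) : Prop :=
  {in S &, forall x y, br x y \in S}.

Definition abelian (S : submodClosed M) : Prop :=
  {in S &, forall x y, br x y = 0}.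

Definition generated (s : seq M) : set M :=
  [set x | forall S : submodClosed M,
     subalgebra S -> {subset s <= S} -> x \in S].

Definition locally_finite (g : submodClosed M) : Prop :=
  forall s : seq M, {subset s <= g} ->
    exists t : seq M, forall x, generated s x -> x \in lspan [set` t].

Definition simple (g : submodClosed M) : Prop :=
  (exists x y, [/\ x \in g, y \in g & br x y != 0]) /\
  forall J : submodClosed M, {subset J <= g} ->
    {in g & J, forall x y, br x y \in J} ->
    {in J, forall x, x = 0} \/ {subset g <= J}.

Definition weight_space (h : submodClosed M) (lam : submod h -> F^o) : set M :=
  [set x | forall y : submod h, br (val y) x = lam y *: x].

Definition root_space (g h : submodClosed M) (lam : submod h -> F^o) : set M :=
  [set x | x \in g /\ weight_space lam x].

Definition splitting_cartan (g h : submodClosed M) : Prop :=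
  [/\ {subset h <= g}, abelian h,
      forall h' : submodClosed M, {subset h <= h'} -> {subset h' <= g} ->
        abelian h' -> {subset h' <= h} &
      {in g, forall x, x \in lspan
        [set z | exists lam : submod h -> F^o, linear lam /\
                   root_space g lam z]}].

Definition roots (g h : submodClosed M) : set (submod h -> F^o) :=
  [set lam | linear lam /\ exists x, x != 0 /\ root_space g lam x].

End Lie.

Arguments roots {F M} br g h.

Section RootGraded.
Variables (F : fieldType) (I : choiceType).

Definition rootlat := {freeg I / F}.
HB.instance Definition _ := GRing.Lmodule.on rootlat.

Definition eps (i : I) : rootlat := << i >>.

Definition short_roots : set rootlat :=
  [set a | exists (s : bool) i, a = (-1) ^+ s *: eps i].

(* 0 is counted as a root, here and in [BCsdiv] and [roots]. *)
Definition BC : set rootlat :=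
  [set a | [\/ a = 0,
     short_roots a,
     exists (s : bool) i, a = (-1) ^+ s *: (2%:R *: eps i) |
     exists (s t : bool) i j,
       i <> j /\ a = (-1) ^+ s *: eps i + (-1) ^+ t *: eps j]].

Definition BCsdiv : set rootlat := BC `\` short_roots.

Variables (M : lmodType F) (br : M -> M -> M).

Definition direct_sum (T : choiceType) (X : set T) (W : T -> set M) : Prop :=
  (forall x, x \in lspan [set z | exists a, X a /\ W a z]) /\
  (forall (s : seq T) (v : T -> M), uniq s ->
     {in s, forall a, X a /\ W a (v a)} ->
     \sum_(a <- s) v a = 0 -> {in s, forall a, v a = 0}).

(* The injective linear map [wt] realizes the root system inside the dual of
   [h]; it identifies [BCsdiv] with the set of roots of [g] relative to [h]. *)
Definition grading_pair (g h : submodClosed M) : Prop :=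
  [/\ subalgebra br g, locally_finite br g, simple br g,
      splitting_cartan br g h &
      exists wt : rootlat -> submod h -> F^o,
        [/\ (forall a, linear (wt a)) /\ linear wt, injective wt,
            roots br g h = wt @` BCsdiv,
            direct_sum BC (fun a => weight_space br (wt a)) &
            weight_space br (wt 0) =
              [set` lspan [set z | exists a y y',
                [/\ BC a /\ a <> 0, weight_space br (wt a) y,
                    weight_space br (wt (- a)) y' & z = br y y']]]]].

Definition BC_graded : Prop :=
  lie_bracket br /\ exists g h : submodClosed M, grading_pair g h.

End RootGraded.

(* [cact] is the action of the algebra; unital and bilinear over [F], it
   restricts on the scalars [k%:A] to the scaling of [cmod]. *)
Record BCquadruple (F : fieldType) := BCQuadruple {
  calg : algType F;
  cstar : calg -> calg;
  cmod : lmodType F;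
  cact : calg -> cmod -> cmod;
  cform : cmod -> cmod -> calg;
  cstar_linear : linear cstar;
  cstarM : forall x y, cstar (x * y) = cstar y * cstar x;
  cstarK : involutive cstar;
  cact_linearl : forall c, linear (cact^~ c);
  cact_linearr : forall x, linear (cact x);
  cact1 : forall c, cact 1 c = c;
  cactM : forall x y c, cact (x * y) c = cact x (cact y c);
  cform_linearl : forall c', linear (cform^~ c');
  cform_linearr : forall c, linear (cform c);
  cform_act : forall x c c', cform (cact x c) c' = x * cform c c';
  cform_skew : forall c c', cstar (cform c c') = - cform c' c
}.

Definition comm (R : pzRingType) (x y : R) := x * y - y * x.
Definition acomm (R : pzRingType) (x y : R) := x * y + y * x.

Section Quadruple.
Variables (F : fieldType) (q : BCquadruple F).

Local Notation alg := (calg q).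
Local Notation C := (cmod q).
Local Notation star := (@cstar F q).
Local Notation act := (@cact F q).
Local Notation f := (@cform F q).
Local Notation half := (2%:R^-1 : F).

Definition star_fixed : {pred alg} := fun x => star x == x.
Definition star_skew : {pred alg} := fun x => star x == - x.

Lemma cstar0 : star 0 = 0.
Proof. by have := @cstar_linear F q (-1) 0 0; rewrite !scaleN1r !addNr. Qed.

Lemma star_fixed_submod_closed : submod_closed star_fixed.
Proof.
have st := @cstar_linear F q.
split=> [|k x y /eqP sx /eqP sy]; apply/eqP; last by rewrite st sx sy.
exact: cstar0.
Qed.

Lemma star_skew_submod_closed : submod_closed star_skew.
Proof.
have st := @cstar_linear F q.
split=> [|k x y /eqP sx /eqP sy]; apply/eqP.
  by rewrite cstar0 oppr0.
by rewrite st sx sy scalerN opprD.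
Qed.

HB.instance Definition _ :=
  GRing.isSubmodClosed.Build F alg star_fixed star_fixed_submod_closed.
HB.instance Definition _ :=
  GRing.isSubmodClosed.Build F alg star_skew star_skew_submod_closed.

Definition bb : Type := (alg * C)%type.
HB.instance Definition _ := GRing.Lmodule.on bb.

Definition of_alg (x : alg) : bb := (x, 0).
Definition of_mod (c : C) : bb := (0, c).

(* The components in 𝒜 and ℬ; the component in 𝒞 is [x.2]. *)
Definition symp (x : bb) : alg := half *: (x.1 + star x.1).
Definition skewp (x : bb) : alg := half *: (x.1 - star x.1).

Definition diamond (c c' : C) : alg := half *: (f c c' - f c' c).
Definition heart (c c' : C) : alg := half *: (f c c' + f c' c).

Definition bmul (x y : bb) : bb :=
  (x.1 * y.1 + f x.2 y.2, act x.1 y.2 + act (star y.1) x.2).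
Definition bcomm (x y : bb) : bb := bmul x y - bmul y x.

Section Derivations.
Variable l : nat.

Definition bder_alg (x x' : alg) (b : bb) : bb :=
  let w := comm x x' + comm (star x) (star x') in
  (4 * l)%:R^-1 *: (bcomm (of_alg w) (of_alg b.1)
                    + bmul (of_alg w) (of_mod b.2)).

Definition bder_mod (c c' : C) (b : bb) : bb :=
  - ((2 * l)%:R^-1 *: (bcomm (of_alg (heart c c')) (of_alg b.1)
                       + bmul (of_alg (heart c c')) (of_mod b.2)))
  - half *: (bmul (of_alg (f b.2 c')) (of_mod c)
             + bmul (of_alg (f b.2 c)) (of_mod c')).

Definition bder (x y : bb) (b : bb) : bb :=
  bder_alg x.1 y.1 b + bder_mod x.2 y.2 b.

Inductive brace_rel : set (tensor bb bb) :=
  | BraceAlgMod x c : brace_rel (of_alg x ⊗ of_mod c)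
  | BraceModAlg x c : brace_rel (of_mod c ⊗ of_alg x)
  | BraceSymmSkew a b : a \in star_fixed -> b \in star_skew ->
      brace_rel (of_alg a ⊗ of_alg b)
  | BraceAlg x x' :
      brace_rel (of_alg x ⊗ of_alg x' + of_alg x' ⊗ of_alg x)
  | BraceMod c c' :
      brace_rel (of_mod c ⊗ of_mod c' - of_mod c' ⊗ of_mod c)
  | BraceCyclic x x' x'' :
      brace_rel (of_alg (x * x') ⊗ of_alg x''
                 + of_alg (x'' * x) ⊗ of_alg x'
                 + of_alg (x' * x'') ⊗ of_alg x)
  | BraceForm x c c' :
      brace_rel (of_alg (f c c') ⊗ of_alg x
                 + of_mod (act (star x) c') ⊗ of_mod c
                 - of_mod (act x c) ⊗ of_mod c').

(* {𝔟, 𝔟} *)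
Definition braces : Type := quotm (lspan brace_rel).
HB.instance Definition _ := GRing.Lmodule.on braces.

Definition brace (x y : bb) : braces := qproj _ (x ⊗ y).

Definition HF : set braces :=
  [set z | exists s : seq (bb * bb),
     z = \sum_(p <- s) brace p.1 p.2 /\
     forall b, \sum_(p <- s) bder p.1 p.2 b = 0].

(* β*_{x,y} *)
Definition bstar (x y : bb) : alg :=
  comm (symp x) (symp y) + comm (skewp x) (skewp y) - heart x.2 y.2.

Definition uniform_property (K : submodClosed braces) : Prop :=
  (forall z, z \in K -> HF z) /\
  (forall s : seq (bb * bb), \sum_(p <- s) brace p.1 p.2 \in K ->
     \sum_(p <- s) bstar p.1 p.2 = 0).

End Derivations.

Lemma cstarZD k x y : star (k *: x + y) = k *: star x + star y.
Proof. exact: cstar_linear. Qed.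

Lemma cstarD x y : star (x + y) = star x + star y.
Proof. by rewrite -{1}[x]scale1r cstarZD scale1r. Qed.

Lemma cstarZ k x : star (k *: x) = k *: star x.
Proof. by rewrite -[k *: x]addr0 cstarZD cstar0 addr0. Qed.

Lemma cstarN x : star (- x) = - star x.
Proof. by rewrite -scaleN1r cstarZ scaleN1r. Qed.

Lemma acomm_fixed a a' : a \in star_fixed -> a' \in star_fixed ->
  acomm a a' \in star_fixed.
Proof.
move=> /eqP sa /eqP sa'; apply/eqP.
by rewrite cstarD !cstarM sa sa' addrC.
Qed.

Lemma comm_fixed a a' : a \in star_fixed -> a' \in star_fixed ->
  comm a a' \in star_skew.
Proof.
move=> /eqP sa /eqP sa'; apply/eqP.
by rewrite cstarD cstarN !cstarM sa sa' opprB.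
Qed.

Lemma comm_fixed_skew a b : a \in star_fixed -> b \in star_skew ->
  comm a b \in star_fixed.
Proof.
move=> /eqP sa /eqP sb; apply/eqP.
by rewrite cstarD cstarN !cstarM sa sb mulrN mulNr opprK addrC.
Qed.

Lemma acomm_fixed_skew a b : a \in star_fixed -> b \in star_skew ->
  acomm a b \in star_skew.
Proof.
move=> /eqP sa /eqP sb; apply/eqP.
by rewrite cstarD !cstarM sa sb mulrN mulNr -opprD addrC.
Qed.

Lemma acomm_skew b b' : b \in star_skew -> b' \in star_skew ->
  acomm b b' \in star_fixed.
Proof.
move=> /eqP sb /eqP sb'; apply/eqP.
by rewrite cstarD !cstarM sb sb' !mulrNN addrC.
Qed.

Lemma comm_skew b b' : b \in star_skew -> b' \in star_skew ->
  comm b b' \in star_skew.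
Proof.
move=> /eqP sb /eqP sb'; apply/eqP.
by rewrite cstarD cstarN !cstarM sb sb' !mulrNN opprB.
Qed.

Lemma diamond_fixed c c' : diamond c c' \in star_fixed.
Proof.
apply/eqP; rewrite cstarZ cstarD cstarN !cform_skew opprK addrC.
by rewrite /diamond.
Qed.

Lemma heart_skew c c' : heart c c' \in star_skew.
Proof.
by apply/eqP; rewrite cstarZ cstarD !cform_skew -opprD scalerN addrC.
Qed.

Lemma bstar_skew x y : bstar x y \in star_skew.
Proof.
apply: rpredB (heart_skew _ _); apply: rpredD; apply/eqP;
  rewrite cstarD cstarN !cstarM !cstarZ !cstarD ?cstarN !cstarK.
  by rewrite opprB ![star _ + _]addrC.
by rewrite -[star x.1 - _]opprB -[star y.1 - _]opprB !scalerN !mulrNN opprB.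
Qed.

End Quadruple.

Arguments star_fixed {F q} x.
Arguments star_skew {F q} x.

Section Matrices.
Variables (F : fieldType) (I : choiceType) (I0 : {fset I}).

(* J = I ⊎ Ī, with ī the element [inr i]. *)
Local Notation J := (I + I)%type.

Definition vsp : Type := {freeg J / F}.
HB.instance Definition _ := GRing.Lmodule.on vsp.

Local Notation v := (fun j : J => (<< j >> : vsp)).
Local Notation half := (2%:R^-1 : F).
Local Notation End := (vsp -> vsp).

Definition form_basis (j k : J) : F :=
  match j, k with
  | inl i, inr i' => (2 * (i == i'))%:R
  | inr i, inl i' => - (2 * (i == i'))%:R
  | _, _ => 0
  end.

Definition vform (u w : vsp) : F :=
  \sum_(j <- dom u) \sum_(k <- dom w)
    coeff j u * coeff k w * form_basis j k.

Definition ejk (j k : J) : End := fun w => coeff k w *: v j.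

Definition gl : {pred End} := lspan [set phi | exists j k, phi = ejk j k].

Definition tr (phi : End) : F := \sum_(j \in [set: J]) coeff j (phi (v j)).

Definition spG : {pred End} := fun phi =>
  `[< phi \in gl /\ forall u w, vform (phi u) w = - vform u (phi w) >].

Definition spS : {pred End} := fun phi =>
  `[< [/\ phi \in gl, tr phi = 0 &
          forall u w, vform (phi u) w = vform u (phi w)] >].

(* The idempotent of the indices in I0 ⊎ Ī0, as a finite sum. *)
Definition idI0 : End :=
  \sum_(i <- I0) (ejk (inl i) (inl i) + ejk (inr i) (inr i)).

Definition ell : nat := #|` I0|.

Definition mcomm (e e' : End) : End := (e \o e') - (e' \o e).

Definition mcirc (e e' : End) : End :=
  (e \o e') + (e' \o e) - (tr (e \o e') / ell%:R) *: idI0.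

Definition vcirc (u w : vsp) : End :=
  fun z => half *: (vform w z *: u + vform u z *: w).

Definition vcomm (u w : vsp) : End :=
  fun z => half *: (vform w z *: u - vform u z *: w)
           + (vform u w / (2 * ell)%:R) *: idI0 z.

Definition bar (j : J) : J :=
  match j with inl i => inr i | inr i => inl i end.

Lemma barK : involutive bar. Proof. by case. Qed.

Definition sgnj (j : J) : F := if j is inl _ then 2%:R else - 2%:R.

Lemma form_basisE j k : form_basis j k = sgnj j * (k == bar j)%:R.
Proof.
have eqi (T : eqType) (x y : T) : (inl x == inl y :> T + T) = (x == y) by [].
have eqr (T : eqType) (x y : T) : (inr x == inr y :> T + T) = (x == y) by [].
case: j k => i [] i' /=; rewrite ?mulr0 //.
  by rewrite eqr natrM eq_sym.
by rewrite eqi natrM eq_sym mulNr.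
Qed.

Lemma vsumE (w : vsp) : w = \sum_(j <- dom w) coeff j w *: v j.
Proof.
rewrite -[LHS]freeg_sumE; apply: eq_bigr => j _.
apply/eqP/freeg_eqP => k; rewrite coeffZ !coeffU.
by rewrite mul1r.
Qed.

Lemma vsumE' (s : seq J) (w : vsp) : uniq s ->
  (forall j, j \notin s -> coeff j w = 0) ->
  w = \sum_(j <- s) coeff j w *: v j.
Proof.
move=> us sw; apply/eqP/freeg_eqP => k; rewrite raddf_sum /=.
under eq_bigr do rewrite coeffZ coeffU mul1r.
have [ks|/sw kw] := boolP (k \in s).
  rewrite (bigD1_seq k) //= eqxx mulr1 big1 ?addr0 // => j /negbTE->.
  by rewrite mulr0.
rewrite kw big1 // => j _; case: eqP => [->|_]; last by rewrite mulr0.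
by rewrite kw mul0r.
Qed.

Lemma vform_sumr j (w : vsp) :
  \sum_(k <- dom w) coeff k w * form_basis j k = sgnj j * coeff (bar j) w.
Proof.
under eq_bigr do rewrite form_basisE mulrCA.
rewrite -mulr_sumr; congr (_ * _).
have [jw|jw] := boolP (bar j \in dom w).
  rewrite (bigD1_seq (bar j)) ?uniq_dom //= eqxx mulr1 big1 ?addr0 // => k.
  by move=> /negbTE->; rewrite mulr0.
rewrite coeff_outdom // big_seq big1 // => k kw.
by case: eqP kw => [->|_ _]; rewrite ?(negbTE jw) // mulr0.
Qed.

Lemma vformE (u w : vsp) :
  vform u w = \sum_(j <- dom u) coeff j u * (sgnj j * coeff (bar j) w).
Proof.
apply: eq_bigr => j _; rewrite -vform_sumr mulr_sumr.
by apply: eq_bigr => k _; rewrite mulrA.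
Qed.

Lemma vform_linearr u : linear (vform u : vsp -> F^o).
Proof.
move=> k w w'; rewrite !vformE -[X in _ = X]/(k * _ + _) mulr_sumr -big_split /=.
by apply: eq_bigr => j _; rewrite coeffD coeffZ !mulrDr !(mulrCA k).
Qed.

Lemma vform_skew u w : vform u w = - vform w u.
Proof.
rewrite /vform exchange_big -sumrN; apply: eq_bigr => k _.
rewrite -sumrN; apply: eq_bigr => j _.
rewrite (mulrC (coeff _ w)) -mulrN; congr (_ * _).
by case: j k => i [] i' /=; rewrite ?oppr0 ?opprK // eq_sym.
Qed.

Lemma vform_linearl w : linear (vform^~ w : vsp -> F^o).
Proof.
move=> k u u'; rewrite /= vform_skew vform_linearr.
by rewrite (vform_skew w u) (vform_skew w u') scalerN -opprD opprK.
Qed.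

Lemma vform_basis j k : vform (v j) (v k) = form_basis j k.
Proof. by rewrite /vform !domU1 !big_seq1 !coeffU !eqxx !mulr1 mul1r. Qed.

Lemma vform_barr j (u : vsp) : vform u (v (bar j)) = sgnj j * coeff j u.
Proof.
rewrite vform_skew vformE domU1 big_seq1 coeffU eqxx mulr1 mul1r barK -mulNr.
by case: j => i /=; rewrite ?opprK.
Qed.

Lemma idI0E (j : J) :
  idI0 (v j) = if (match j with inl i => i | inr i => i end) \in I0
              then v j else 0.
Proof.
have eqi (T : eqType) (x y : T) : (inl x == inl y :> T + T) = (x == y) by [].
have eqr (T : eqType) (x y : T) : (inr x == inr y :> T + T) = (x == y) by [].
rewrite /idI0 fct_sumE.
set i := (X in X \in I0).
transitivity (\sum_(i' <- I0) (i' == i)%:R *: v j).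
  apply: eq_bigr => i' _; rewrite /i /ejk; case: j {i} => i /=.
    rewrite -[LHS]/(coeff (inl i') (v (inl i)) *: v (inl i') +
                    coeff (inr i') (v (inl i)) *: v (inr i')).
    rewrite !coeffU !mul1r eqi scale0r addr0 eq_sym.
    by case: eqP => [->|]; rewrite // !scale0r.
  rewrite -[LHS]/(coeff (inl i') (v (inr i)) *: v (inl i') +
                  coeff (inr i') (v (inr i)) *: v (inr i')).
  rewrite !coeffU !mul1r eqr scale0r add0r eq_sym.
  by case: eqP => [->|]; rewrite // !scale0r.
rewrite -scaler_suml; case: ifPn => iI0; last first.
  rewrite big_seq big1 ?scale0r // => i' i'I0.
  by case: eqP i'I0 => [->|//]; rewrite (negbTE iI0).
rewrite (bigD1_seq i) //= eqxx big1 ?addr0 ?scale1r // => i' /negbTE->.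
by [].
Qed.

Definition finitary (s : seq J) (phi : End) : Prop :=
  [/\ linear phi, uniq s, forall k, k \notin s -> phi (v k) = 0 &
      forall w k, k \notin s -> coeff k (phi w) = 0].

Lemma gl_finitary phi : phi \in gl -> exists s, finitary s phi.
Proof.
case/asboolP=> s [sX ->]; elim: s sX => [|p s IH] sX.
  exists [::]; rewrite big_nil; split=> // [k x y|w k _].
    by rewrite -[LHS]/0 -[RHS]/(k *: 0 + 0) scaler0 addr0.
  by rewrite -[X in coeff k X]/0 coeff0.
have [|t [tl tu t0 t1]] := IH; first by move=> r rs; apply: sX; rewrite inE rs orbT.
have [j [k pE]] := sX p (mem_head _ _).
set phi' := \sum_(_ <- _) _ in tl t0 t1.
exists (undup [:: j, k & t]); split; first 1 last.
- exact: undup_uniq.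
- move=> k'; rewrite mem_undup !inE !negb_or => /and3P[_ kk' k't].
  rewrite big_cons -[LHS]/(p.1 *: (p.2 (v k')) + phi' (v k')) t0 // pE addr0.
  by rewrite /ejk coeffU mul1r (negbTE kk') scale0r scaler0.
- move=> w k'; rewrite mem_undup !inE !negb_or => /and3P[jk' _ k't].
  rewrite big_cons -[X in coeff _ X]/(p.1 *: (p.2 w) + phi' w).
  rewrite coeffD t1 // coeffZ pE /ejk coeffZ coeffU mul1r.
  by rewrite eq_sym (negbTE jk') !mulr0 addr0.
- move=> c x y; rewrite big_cons.
  rewrite -[LHS]/(p.1 *: (p.2 (c *: x + y)) + phi' (c *: x + y)).
  rewrite -[RHS]/(c *: (p.1 *: p.2 x + phi' x) + (p.1 *: p.2 y + phi' y)).
  rewrite tl pE /ejk coeffD coeffZ scalerDl !scalerDr !scalerA.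
  by rewrite addrACA !mulrA (mulrC c).
Qed.

Lemma finitaryW s t phi : uniq t -> {subset s <= t} -> finitary s phi ->
  finitary t phi.
Proof.
move=> ut st [lphi us s0 s1]; split=> // [k kt|w k kt].
  by apply: s0; apply: contra kt; apply: st.
by apply: s1; apply: contra kt; apply: st.
Qed.

Lemma finitary2 phi psi : phi \in gl -> psi \in gl ->
  exists s, finitary s phi /\ finitary s psi.
Proof.
move=> /gl_finitary[s sphi] /gl_finitary[t tpsi].
exists (undup (s ++ t)); split.
  apply: finitaryW sphi; first exact: undup_uniq.
  by move=> k ks; rewrite mem_undup mem_cat ks.
apply: finitaryW tpsi; first exact: undup_uniq.
by move=> k ks; rewrite mem_undup mem_cat ks orbT.
Qed.

Lemma gl_linear phi : phi \in gl -> linear phi.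
Proof. by case/gl_finitary => s []. Qed.

Lemma ejk_gl j k : ejk j k \in gl.
Proof. by apply: mem_lspan; exists j, k. Qed.

Lemma gl_comp phi psi : phi \in gl -> psi \in gl -> phi \o psi \in gl.
Proof.
move=> /gl_linear lphi /asboolP[s [sX ->]].
have lphi0 : phi 0 = 0 by have := lphi (-1) 0 0; rewrite !scaleN1r !addNr.
elim: s sX => [|p s IH] sX.
  rewrite big_nil (_ : _ \o _ = 0) ?rpred0 //.
  by apply/funext => w; rewrite -[RHS]/(0 : vsp) -lphi0.
have [j [k pE]] := sX p (mem_head _ _).
rewrite big_cons pE.
have -> : phi \o (p.1 *: ejk j k + \sum_(p <- s) p.1 *: p.2) =
  p.1 *: \sum_(l <- dom (phi (v j))) coeff l (phi (v j)) *: ejk l k +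
  (phi \o (\sum_(p <- s) p.1 *: p.2)).
  apply/funext => w.
  rewrite -[LHS]/(phi (p.1 *: ejk j k w + (\sum_(p <- s) p.1 *: p.2) w)) lphi.
  rewrite -[RHS]/(p.1 *: (\sum_(l <- _) _) w + phi ((\sum_(p <- s) _) w)).
  congr (_ *: _ + _); rewrite fct_sumE.
  rewrite -[ejk j k w]addr0 lphi lphi0 addr0 [in LHS](vsumE (phi (v j))).
  rewrite scaler_sumr; apply: eq_bigr => l _.
  by rewrite !scalerA mulrC -scalerA.
apply: rpredD; last by apply: IH => r rs; apply: sX; rewrite inE rs orbT.
by apply/rpredZ/rpred_sum => l _; apply/rpredZ/ejk_gl.
Qed.

Lemma idI0_gl : idI0 \in gl.
Proof. by apply: rpred_sum => i _; apply: rpredD; exact: ejk_gl. Qed.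

Lemma rank1_gl (u w : vsp) : (fun z => vform w z *: u) \in gl.
Proof.
have -> : (fun z => vform w z *: u) =
  \sum_(j <- dom w) \sum_(k <- dom u)
    (coeff j w * sgnj j * coeff k u) *: ejk k (bar j).
  apply/funext => z; rewrite fct_sumE vformE scaler_suml.
  apply: eq_bigr => j _; rewrite fct_sumE [in LHS](vsumE u) scaler_sumr.
  apply: eq_bigr => k _; rewrite -[RHS]/(_ *: (_ *: _)) !scalerA.
  by rewrite -!mulrA (mulrC (coeff k u)).
by apply: rpred_sum => j _; apply: rpred_sum => k _; apply/rpredZ/ejk_gl.
Qed.

Lemma trE (s : seq J) phi : uniq s ->
  (forall j, j \notin s -> coeff j (phi (v j)) = 0) ->
  tr phi = \sum_(j <- s) coeff j (phi (v j)).
Proof.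
move=> us s0; rewrite /tr -(fsbig_widen [set` s]) //; last first.
  by move=> j [_ /= /negP/s0].
by rewrite -fsbig_seq.
Qed.

Lemma tr_linear k phi psi : phi \in gl -> psi \in gl ->
  tr (k *: phi + psi) = k * tr phi + tr psi.
Proof.
move=> gphi gpsi; have [s [[lphi us a0 a1] [lpsi _ b0 b1]]] := finitary2 gphi gpsi.
have p0 j : j \notin s -> coeff j ((k *: phi + psi) (v j)) = 0.
  move=> js; rewrite -[X in coeff j X]/(k *: phi (v j) + psi (v j)).
  by rewrite coeffD coeffZ a1 // b1 // mulr0 addr0.
rewrite (trE us p0) (trE us (fun j => a1 (v j) j)) (trE us (fun j => b1 (v j) j)).
rewrite mulr_sumr -big_split /=; apply: eq_bigr => j _.
by rewrite -[X in coeff j X]/(k *: phi (v j) + psi (v j)) coeffD coeffZ.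
Qed.

Lemma tr_compC phi psi : phi \in gl -> psi \in gl ->
  tr (phi \o psi) = tr (psi \o phi).
Proof.
move=> gphi gpsi; have [s [[lphi us a0 a1] [lpsi _ b0 b1]]] := finitary2 gphi gpsi.
have compE f g : linear f -> (forall w k, k \notin s -> coeff k (g w) = 0) ->
    forall j, coeff j (f (g (v j))) =
              \sum_(k <- s) coeff k (g (v j)) * coeff j (f (v k)).
  move=> lf g1 j; rewrite [in LHS](vsumE' us (g1 _)).
  elim: (s) => [|k t IH]; last by rewrite !big_cons lf coeffD coeffZ IH.
  have := lf (-1) 0 0; rewrite !scaleN1r !addNr => f0.
  by rewrite !big_nil f0 coeff0.
rewrite (trE (phi := phi \o psi) us (fun j => a1 _ j)).
rewrite (trE (phi := psi \o phi) us (fun j => b1 _ j)) /=.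
rewrite (eq_bigr _ (fun j _ => compE phi psi lphi b1 j)) exchange_big /=.
apply: eq_bigr => j _; rewrite (compE psi phi) //.
by apply: eq_bigr => k _; rewrite mulrC.
Qed.

Lemma tr_adj phi psi : phi \in gl -> psi \in gl -> (2%:R != 0 :> F) ->
  (forall u w, vform (phi u) w = vform u (psi w)) -> tr phi = tr psi.
Proof.
move=> gphi gpsi F2 adj.
have [s [[lphi us a0 a1] [lpsi _ b0 b1]]] := finitary2 gphi gpsi.
have ibar : injective bar := inv_inj barK.
pose t := undup (s ++ map bar s).
have ut : uniq t by apply: undup_uniq.
have tbar j : (bar j \in t) = (j \in t).
  have mb k : (k \in map bar s) = (bar k \in s).
    by rewrite -{1}[k]barK (mem_map ibar).
  by rewrite !mem_undup !mem_cat !mb barK orbC.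
have st j : j \notin t -> j \notin s by rewrite mem_undup mem_cat negb_or => /andP[].
have sgnN j : sgnj (bar j) = - sgnj j by case: j => i /=; rewrite ?opprK.
have sgn0 j : sgnj j != 0 by case: j => i /=; rewrite ?oppr_eq0.
have cE j : coeff j (phi (v j)) = coeff (bar j) (psi (v (bar j))).
  apply: (mulfI (sgn0 j)); rewrite -vform_barr adj vform_skew.
  by rewrite -[X in vform _ (v X)]barK vform_barr sgnN mulNr opprK.
rewrite (trE (phi := phi) ut (fun j jt => a1 (v j) j (st j jt))).
rewrite (trE (phi := psi) ut (fun j jt => b1 (v j) j (st j jt))).
rewrite (eq_bigr _ (fun j _ => cE j)) -(big_map bar predT
  (fun j => coeff j (psi (v j)))) /=.
apply: perm_big; apply: uniq_perm => // [|j]; first by rewrite map_inj_uniq.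
by rewrite -{1}[j]barK (mem_map ibar) tbar.
Qed.

Definition adjs (b : bool) (phi : End) : Prop :=
  forall u w, vform (phi u) w = (-1) ^+ b * vform u (phi w).

Lemma spGP phi : reflect (phi \in gl /\ adjs true phi) (phi \in spG).
Proof.
by apply: (iffP (asboolP _)) => -[gphi adj]; split=> // u w;
  rewrite adj expr1 mulN1r.
Qed.

Lemma spSP phi :
  reflect [/\ phi \in gl, tr phi = 0 & adjs false phi] (phi \in spS).
Proof.
by apply: (iffP (asboolP _)) => -[gphi tphi adj]; split=> // u w;
  rewrite adj mul1r.
Qed.

Lemma vformDl u u' w : vform (u + u') w = vform u w + vform u' w.
Proof. by rewrite -{1}[u]scale1r vform_linearl scale1r. Qed.

Lemma vformDr u w w' : vform u (w + w') = vform u w + vform u w'.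
Proof. by rewrite -{1}[w]scale1r vform_linearr scale1r. Qed.

Lemma vform0l w : vform 0 w = 0.
Proof. by rewrite /vform dom0 big_nil. Qed.

Lemma vform0r u : vform u 0 = 0.
Proof. by rewrite vform_skew vform0l oppr0. Qed.

Lemma vformZl k u w : vform (k *: u) w = k * vform u w.
Proof. by rewrite -[k *: u]addr0 vform_linearl vform0l addr0. Qed.

Lemma vformZr k u w : vform u (k *: w) = k * vform u w.
Proof. by rewrite -[k *: w]addr0 vform_linearr vform0r addr0. Qed.

Lemma adjs_lin b k phi psi : adjs b phi -> adjs b psi ->
  adjs b (k *: phi + psi).
Proof.
move=> aphi apsi u w.
rewrite -[(_ + _) u]/(k *: phi u + psi u) -[(_ + _) w]/(k *: phi w + psi w).
by rewrite vformDl vformDr vformZl vformZr aphi apsi mulrDr mulrCA.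
Qed.

Lemma adjs0 b : adjs b 0.
Proof. by move=> u w; rewrite vform0l vform0r mulr0. Qed.

Lemma tr0 : tr 0 = 0.
Proof. by rewrite /tr fsbig1 // => j _; rewrite coeff0. Qed.

Lemma spG_submod_closed : submod_closed spG.
Proof.
split=> [|k x y /spGP[gx ax] /spGP[gy ay]]; apply/spGP; split.
- exact: rpred0.
- exact: adjs0.
- by apply: rpredD => //; apply: rpredZ.
- exact: adjs_lin.
Qed.

Lemma spS_submod_closed : submod_closed spS.
Proof.
split=> [|k x y /spSP[gx tx ax] /spSP[gy ty ay]]; apply/spSP; split.
- exact: rpred0.
- exact: tr0.
- exact: adjs0.
- by apply: rpredD => //; apply: rpredZ.
- by rewrite tr_linear // tx ty mulr0 addr0.
- exact: adjs_lin.
Qed.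

HB.instance Definition _ :=
  GRing.isSubmodClosed.Build F End spG spG_submod_closed.
HB.instance Definition _ :=
  GRing.isSubmodClosed.Build F End spS spS_submod_closed.

Lemma adjs_comp b b' e e' : adjs b e -> adjs b' e' ->
  forall u w, vform (e (e' u)) w = (-1) ^+ (b (+) b') * vform u (e' (e w)).
Proof. by move=> ae ae' u w; rewrite ae ae' mulrA signr_addb. Qed.

Lemma adjs_idI0 : adjs false idI0.
Proof.
have eqi (T : eqType) (x y : T) : (inl x == inl y :> T + T) = (x == y) by [].
have eqr (T : eqType) (x y : T) : (inr x == inr y :> T + T) = (x == y) by [].
rewrite /idI0; apply: big_ind => [|x y ax ay|i _]; first exact: adjs0.
  by rewrite -[x]scale1r; apply: adjs_lin.
have cbar (u : vsp) j : vform u (v j) = sgnj (bar j) * coeff (bar j) u.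
  by rewrite -vform_barr barK.
move=> u w; rewrite mul1r.
have e1 (z z' : vsp) j : vform (coeff j z *: v j) z' =
    - (sgnj (bar j) * (coeff j z * coeff (bar j) z')).
  rewrite vformZl vform_skew cbar mulrN; congr (- _).
  by rewrite !mulrA (mulrC (coeff j z)).
have e2 (z z' : vsp) j : vform z (coeff j z' *: v j) =
    sgnj (bar j) * (coeff (bar j) z * coeff j z').
  by rewrite vformZr cbar mulrC mulrA.
rewrite -[(_ + _) u]/(coeff (inl i) u *: v (inl i) + coeff (inr i) u *: v (inr i)).
rewrite -[(_ + _) w]/(coeff (inl i) w *: v (inl i) + coeff (inr i) w *: v (inr i)).
by rewrite vformDl vformDr !e1 !e2 /= !mulNr !opprK addrC.
Qed.

Hypothesis F0 : [pchar F] =i pred0.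

Let nat0 n : (n%:R == 0 :> F) = (n == 0%N).
Proof. by move/pcharf0P: F0. Qed.

Let F2 : 2%:R != 0 :> F. Proof. by rewrite nat0. Qed.

Lemma tr_anti phi : phi \in gl -> adjs true phi -> tr phi = 0.
Proof.
move=> gphi aphi; have gN : - phi \in gl by rewrite rpredN.
have trN : tr (- phi) = - tr phi.
  rewrite -[- phi]addr0 -scaleN1r tr_linear ?rpred0 //.
  by rewrite tr0 addr0 mulN1r.
have := tr_adj gphi gN F2; rewrite trN => /(_ _)/wrap[u w|/eqP].
  rewrite aphi expr1 mulN1r -[(- phi) w]/(- phi w).
  by rewrite -scaleN1r vformZr mulN1r.
by rewrite -subr_eq0 opprK -mulr2n -mulr_natl mulf_eq0 (negbTE F2) => /eqP.
Qed.

Lemma tr_idI0 : tr idI0 = (2 * ell)%:R.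
Proof.
have tr1 j : tr (ejk j j) = 1.
  rewrite (@trE [:: j]) ?big_seq1 // => [|k].
    by rewrite /ejk coeffZ !coeffU eqxx !mulr1.
  by rewrite inE /ejk coeffZ !coeffU => /negbTE kj; rewrite kj !mulr0 mul0r.
rewrite /idI0 /ell; elim: (enum_fset I0) => [|i s IH].
  by rewrite !big_nil muln0 tr0.
have ge : \sum_(i <- s) (ejk (inl i) (inl i) + ejk (inr i) (inr i)) \in gl.
  by apply: rpred_sum => k _; apply: rpredD; exact: ejk_gl.
have trD phi psi : phi \in gl -> psi \in gl -> tr (phi + psi) = tr phi + tr psi.
  by move=> gphi gpsi; rewrite -{1}[phi]scale1r tr_linear // mul1r.
rewrite big_cons trD //; last by apply: rpredD; exact: ejk_gl.
by rewrite trD ?ejk_gl // !tr1 IH mulnS natrD.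
Qed.

Lemma mcommP b b' e e' : e \in gl -> e' \in gl -> adjs b e -> adjs b' e' ->
  [/\ mcomm e e' \in gl, tr (mcomm e e') = 0 & adjs (~~ (b (+) b')) (mcomm e e')].
Proof.
move=> ge ge' ae ae'.
have gc := gl_comp ge ge'; have gc' := gl_comp ge' ge.
have -> : mcomm e e' = -1 *: (e' \o e) + (e \o e').
  by rewrite /mcomm addrC scaleN1r.
split.
- by apply: rpredD gc; apply: rpredZ gc'.
- by rewrite (tr_linear _ gc' gc) (tr_compC ge' ge) mulN1r addNr.
move=> u w.
rewrite -[(_ + _) u]/(-1 *: e' (e u) + e (e' u)).
rewrite -[(_ + _) w]/(-1 *: e' (e w) + e (e' w)).
rewrite vformDl vformDr !vformZl !vformZr (adjs_comp ae ae') (adjs_comp ae' ae).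
rewrite addbC; case: (b (+) b') => /=;
  by rewrite ?expr1 ?expr0 !(mulN1r, mul1r) ?opprD ?opprK addrC.
Qed.

Hypothesis ell_gt0 : (0 < ell)%N.

Lemma mcircP b b' e e' : e \in gl -> e' \in gl -> adjs b e -> adjs b' e' ->
  [/\ mcirc e e' \in gl, tr (mcirc e e') = 0 & adjs (b (+) b') (mcirc e e')].
Proof.
move=> ge ge' ae ae'.
have gc := gl_comp ge ge'; have gc' := gl_comp ge' ge.
have gs : (e \o e') + (e' \o e) \in gl by apply: rpredD.
have as_ : adjs (b (+) b') ((e \o e') + (e' \o e)).
  move=> u w; rewrite -[(_ + _) u]/(e (e' u) + e' (e u)).
  rewrite -[(_ + _) w]/(e (e' w) + e' (e w)).
  rewrite vformDl vformDr (adjs_comp ae ae') (adjs_comp ae' ae).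
  by rewrite (addbC b') -mulrDr addrC.
have ts : tr ((e \o e') + (e' \o e)) = 2%:R * tr (e \o e').
  have := tr_linear 1 gc gc'; rewrite scale1r mul1r (tr_compC ge' ge) => ->.
  by rewrite mulr_natl mulr2n.
rewrite /mcirc addrC -scaleNr; split.
- by apply: rpredD; rewrite ?rpredZ ?idI0_gl.
- rewrite (tr_linear _ idI0_gl gs) ts tr_idI0 natrM mulNr [2%:R * ell%:R]mulrC.
  by rewrite mulrA mulfVK ?nat0 -?lt0n // mulrC addNr.
case bb': (b (+) b') as_ => as_; last by apply: adjs_lin => //; apply: adjs_idI0.
have : 2%:R * tr (e \o e') = 0 by rewrite -ts; apply: tr_anti.
move/eqP; rewrite mulf_eq0 (negbTE F2) => /eqP->.
by rewrite mul0r oppr0 scale0r add0r.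
Qed.

Lemma mcomm_spGG x y : x \in spG -> y \in spG -> mcomm x y \in spG.
Proof.
by move=> /spGP[gx ax] /spGP[gy ay];
  have [] := mcommP gx gy ax ay; move=> *; apply/spGP.
Qed.

Lemma mcirc_spGG x y : x \in spG -> y \in spG -> mcirc x y \in spS.
Proof.
by move=> /spGP[gx ax] /spGP[gy ay];
  have [] := mcircP gx gy ax ay; move=> *; apply/spSP.
Qed.

Lemma mcomm_spGS x s : x \in spG -> s \in spS -> mcomm x s \in spS.
Proof.
by move=> /spGP[gx ax] /spSP[gs _ as_];
  have [] := mcommP gx gs ax as_; move=> *; apply/spSP.
Qed.

Lemma mcirc_spGS x s : x \in spG -> s \in spS -> mcirc x s \in spG.
Proof.
by move=> /spGP[gx ax] /spSP[gs _ as_];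
  have [] := mcircP gx gs ax as_; move=> *; apply/spGP.
Qed.

Lemma mcomm_spSS s t : s \in spS -> t \in spS -> mcomm s t \in spG.
Proof.
by move=> /spSP[gs _ as_] /spSP[gt _ at_];
  have [] := mcommP gs gt as_ at_; move=> *; apply/spGP.
Qed.

Lemma mcirc_spSS s t : s \in spS -> t \in spS -> mcirc s t \in spS.
Proof.
by move=> /spSP[gs _ as_] /spSP[gt _ at_];
  have [] := mcircP gs gt as_ at_; move=> *; apply/spSP.
Qed.

Lemma mcomm_spG_idI0 x : x \in spG -> mcomm x idI0 \in spS.
Proof.
by move=> /spGP[gx ax];
  have [] := mcommP gx idI0_gl ax adjs_idI0; move=> *; apply/spSP.
Qed.

Lemma mcirc_spG_idI0 x : x \in spG -> mcirc x idI0 \in spG.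
Proof.
by move=> /spGP[gx ax];
  have [] := mcircP gx idI0_gl ax adjs_idI0; move=> *; apply/spGP.
Qed.

Lemma mcomm_spS_idI0 s : s \in spS -> mcomm s idI0 \in spG.
Proof.
by move=> /spSP[gs _ as_];
  have [] := mcommP gs idI0_gl as_ adjs_idI0; move=> *; apply/spGP.
Qed.

Lemma mcirc_spS_idI0 s : s \in spS -> mcirc s idI0 \in spS.
Proof.
by move=> /spSP[gs _ as_];
  have [] := mcircP gs idI0_gl as_ adjs_idI0; move=> *; apply/spSP.
Qed.

Local Notation rank1 u w := (fun z => vform w z *: u).

Lemma tr_rank1 u w : tr (rank1 u w) = vform w u.
Proof.
rewrite (trE (uniq_dom u)) => [|j ju]; last by rewrite coeffZ coeff_outdom ?mulr0.
rewrite [in RHS](vsumE u).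
have vform_sum (s : seq J) : vform w (\sum_(j <- s) coeff j u *: v j) =
    \sum_(j <- s) vform w (v j) * coeff j u.
  elim: s => [|j s IH]; first by rewrite !big_nil vform0r.
  by rewrite !big_cons vform_linearr IH mulrC.
by rewrite vform_sum; apply: eq_bigr => j _; rewrite coeffZ.
Qed.

Lemma vcirc_spG u w : vcirc u w \in spG.
Proof.
apply/spGP; split.
  have -> : vcirc u w = half *: (rank1 u w + rank1 w u) by [].
  by apply: rpredZ; apply: rpredD; exact: rank1_gl.
move=> a b; rewrite /vcirc vformZl vformZr vformDl vformDr !vformZl !vformZr.
rewrite (vform_skew a u) (vform_skew a w) !mulrN -opprD mulrN expr1 mulN1r opprK.
by congr (_ * _); rewrite addrC mulrC [X in _ + X]mulrC.
Qed.

Lemma vcomm_spS u w : vcomm u w \in spS.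
Proof.
have E : vcomm u w = half *: (-1 *: rank1 w u + rank1 u w) +
                     (vform u w / (2 * ell)%:R) *: idI0.
  apply/funext => z; rewrite /vcomm.
  rewrite -[RHS]/(half *: (-1 *: (vform u z *: w) + vform w z *: u) + _ *: idI0 z).
  by rewrite scaleN1r [- _ + _]addrC.
have g1 : -1 *: rank1 w u + rank1 u w \in gl.
  by apply: rpredD (rank1_gl _ _); apply: rpredZ (rank1_gl _ _).
have g2 : half *: (-1 *: rank1 w u + rank1 u w) \in gl by apply: rpredZ g1.
have g3 : (vform u w / (2 * ell)%:R) *: idI0 \in gl by apply: rpredZ idI0_gl.
apply/spSP; split; first by rewrite E; apply: rpredD.
  rewrite E addrC (tr_linear _ idI0_gl g2) -[half *: _]addr0.
  rewrite (tr_linear _ g1 (rpred0 _)) tr0 addr0.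
  rewrite (tr_linear _ (rank1_gl _ _) (rank1_gl _ _)).
  rewrite !tr_rank1 tr_idI0 mulfVK ?nat0 ?muln_eq0 -?lt0n //.
  rewrite (vform_skew w u) mulN1r -opprD -mulr2n.
  rewrite -[vform u w *+ 2]mulr_natl mulrN mulKf //.
  by rewrite addrN.
rewrite E addrC; apply: adjs_lin; first exact: adjs_idI0.
move=> a b; rewrite mul1r.
rewrite -[(half *: _) a]/(half *: (-1 *: (vform u a *: w) + vform w a *: u)).
rewrite -[(half *: _) b]/(half *: (-1 *: (vform u b *: w) + vform w b *: u)).
rewrite vformZl vformZr vformDl vformDr !vformZl !vformZr.
rewrite (vform_skew a u) (vform_skew a w) !mulN1r !mulrN opprK.
rewrite addrC; congr (_ * (_ + _)); first by rewrite mulrC.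
by rewrite mulrC.
Qed.

End Matrices.

Arguments spG {F I} phi.
Arguments spS {F I} phi.

Section LieAlgebraL.
Variables (F : fieldType) (I : choiceType) (I0 : {fset I}).
Variables (q : BCquadruple F) (K : submodClosed (braces q)).

Local Notation G := (submod (@spG F I)).
Local Notation S := (submod (@spS F I)).
Local Notation A := (submod (@star_fixed F q)).
Local Notation B := (submod (@star_skew F q)).
Local Notation V := (vsp F I).
Local Notation C := (cmod q).
Local Notation act := (@cact F q).
Local Notation f := (@cform F q).
Local Notation l := (ell I0).
Local Notation id0 := (@idI0 F I I0).
Local Notation half := (2%:R^-1 : F).

Definition lieL : Type :=
  (tensor G A * tensor S B * tensor V C * quotm K)%type.
HB.instance Definition _ := GRing.Lmodule.on lieL.

(* The generators x ⊗ a, s ⊗ b, u ⊗ c and ⟨β, β'⟩ of ℒ(𝔮, 𝒦), to be used with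
   x ∈ 𝒢, a ∈ 𝒜, s ∈ 𝒮, b ∈ ℬ only. The casts of the formulas below are
   legitimate by the lemmas mcomm_spGG, ..., bstar_skew above. *)
Definition inGA (x : V -> V) (a : calg q) : lieL :=
  (tosub (@spG F I) x ⊗ tosub (@star_fixed F q) a, 0, 0, 0).
Definition inSB (s : V -> V) (b : calg q) : lieL :=
  (0, tosub (@spS F I) s ⊗ tosub (@star_skew F q) b, 0, 0).
Definition inVC (u : V) (c : C) : lieL := (0, 0, u ⊗ c, 0).
Definition angle (x y : bb q) : lieL := (0, 0, 0, qproj K (brace x y)).

(* ℒ(𝔮, 𝒦) as a Lie algebra is [lieL] with a bracket [br] such that
   [lieL_bracket br]; as the generators span [lieL], there is at most one. *)
Record lieL_bracket (br : lieL -> lieL -> lieL) : Prop := LieLBracket {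
  lieL_lie : lie_bracket br;
  lieL_GA_GA : forall x y a a',
    x \in spG -> y \in spG -> a \in star_fixed -> a' \in star_fixed ->
    br (inGA x a) (inGA y a') =
      inGA (mcomm x y) (half *: acomm a a')
      + inSB (mcirc I0 x y) (half *: comm a a')
      + tr (x \o y) *: angle (of_alg a) (of_alg a');
  lieL_GA_SB : forall x s a b,
    x \in spG -> s \in spS -> a \in star_fixed -> b \in star_skew ->
    br (inGA x a) (inSB s b) =
      inGA (mcirc I0 x s) (half *: comm a b)
      + inSB (mcomm x s) (half *: acomm a b);
  lieL_SB_SB : forall s t b b',
    s \in spS -> t \in spS -> b \in star_skew -> b' \in star_skew ->
    br (inSB s b) (inSB t b') =
      inGA (mcomm s t) (half *: acomm b b')
      + inSB (mcirc I0 s t) (half *: comm b b')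
      + tr (s \o t) *: angle (of_alg b) (of_alg b');
  lieL_GA_VC : forall x a u c,
    x \in spG -> a \in star_fixed ->
    br (inGA x a) (inVC u c) = inVC (x u) (act a c);
  lieL_SB_VC : forall s b u c,
    s \in spS -> b \in star_skew ->
    br (inSB s b) (inVC u c) = inVC (s u) (act b c);
  lieL_VC_VC : forall u w c c',
    br (inVC u c) (inVC w c') =
      inGA (vcirc u w) (diamond c c')
      + inSB (vcomm I0 u w) (heart c c')
      + vform u w *: angle (of_mod c) (of_mod c');
  lieL_angle_GA : forall b1 b2 x a,
    x \in spG -> a \in star_fixed ->
    br (angle b1 b2) (inGA x a) =
      - ((4 * l)%:R^-1 *:
         (inGA (mcirc I0 x id0) (comm a (bstar b1 b2))
          + inSB (mcomm x id0) (acomm a (bstar b1 b2))));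
  lieL_angle_SB : forall b1 b2 s b,
    s \in spS -> b \in star_skew ->
    br (angle b1 b2) (inSB s b) =
      - ((4 * l)%:R^-1 *:
         (inGA (mcomm s id0) (acomm b (bstar b1 b2))
          + inSB (mcirc I0 s id0) (comm b (bstar b1 b2))
          + (2%:R * tr (s \o id0)) *:
              angle (of_alg b) (of_alg (bstar b1 b2))));
  lieL_angle_VC : forall b1 b2 u c,
    br (angle b1 b2) (inVC u c) =
      (2 * l)%:R^-1 *: inVC (id0 u) (act (bstar b1 b2) c)
      - half *: inVC u (act (f c b2.2) b1.2 + act (f c b1.2) b2.2);
  lieL_angle_angle : forall b1 b2 b1' b2',
    br (angle b1 b2) (angle b1' b2') =
      angle (bder l b1 b2 b1') b2' + angle b1' (bder l b1 b2 b2')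
}.

End LieAlgebraL.

Definition has_coordinate_quadruple (F : fieldType) (I : choiceType)
    (I0 : {fset I}) (q : BCquadruple F) (M : lmodType F) (br : M -> M -> M) :
    Prop :=
  BC_graded I br /\
  exists (K : submodClosed (braces q)) (brK : lieL I K -> lieL I K -> lieL I K)
         (phi : lieL I K -> M),
    [/\ uniform_property (ell I0) K, lieL_bracket I0 brK &
        lie_iso brK br phi].

(* Main.v *)
(** Every element x ⊗ a of 𝒢 ⊗ 𝒜 or 𝒮 ⊗ ℬ has finite support, so for an index k
    outside the support it is a sum of brackets of some P ⊗ 1 in 𝒢 ⊗ 1, with P
    mapping v_k into the support, and elements involving v_k. Replacing these
    brackets by τ gives a linear θ : ℒ → E that does not depend on k and
    satisfies τ(g, z) = θ([g, z]) for g in 𝒢 ⊗ 1. Subtracting the coboundary of θ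
    we may assume that τ vanishes on 𝒢 ⊗ 1; then it is 𝒢-invariant, and the usual
    contraction of indices yields a bilinear map κ on 𝔟 with
    τ(x ⊗ α, y ⊗ α') = tr(xy) κ(α, α') and τ(u ⊗ c, v ⊗ c') = (u, v) κ(c, c').
    The cocycle identity at distinct indices says that κ satisfies the relations
    defining {𝔟, 𝔟}, hence κ factors through some g : {𝔟, 𝔟} → E. The extension
    therefore obeys the bracket formulas of ℒ(𝔮, 𝒦₀) with 𝒦₀ = 𝒦 ∩ ker g, where
    ⟨β, β'⟩ is (⟨β, β'⟩, κ(β, β')); these elements span it because it is perfect.
    The uniform property of 𝒦₀ is inherited from 𝒦. *)
Require Import Defs.
From HB Require Import structures.
From mathcomp Require Import all_boot all_order all_algebra finmap.
From mathcomp Require Import boolp classical_sets functions cardinality fsbigop.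
From mathcomp Require Import freeg ring.

Set Implicit Arguments.
Unset Strict Implicit.
Unset Printing Implicit Defensive.

Import GRing.Theory.
Local Open Scope classical_set_scope.
Local Open Scope ring_scope.

(** * Linear combinations and the symplectic space *)

(** The value of θ on ⟨𝔟, 𝔟⟩ is free, since brackets with 𝒢 ⊗ 1 have no component there; it is taken
    to be 0, so that the E-component of ⟨β, β'⟩ is κ alone. The obstacle is that ⟨𝔟, 𝔟⟩ does not
    commute with 𝒢 ⊗ 1, because [idI0] enters its action. Invariance therefore does not determine τ
    there. Fresh indices are chosen outside I0, where [idI0] vanishes, and the cocycle identity is
    applied once more. 𝒢 ⊗ 𝒜 and 𝒮 ⊗ ℬ are treated together by a Boolean parity, with spanning
    matrices [Qf d u w] that contain no [idI0] when u and w are orthogonal. Adding both parities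
    gives elements [genQ u w α] with α in all of 𝔞; their brackets multiply coordinates like
    matrices over 𝔞, and at distinct indices the relations for κ can be read off. Freeness aside,
    only the list of bracket formulas matters, so the work is done in an abstract module carrying
    that list. The extension satisfies the same list, and grading and transport are derived from the
    list. *)

Section LinearExpressions.
Variable F : fieldType.

(** [ring] and [field] act on scalars only; reified linear combinations split an identity in a
    module into one scalar identity per atom. *)
Inductive lexp :=
  | LVar of nat | LZero | LAdd of lexp & lexp | LOpp of lexp | LScale of F & lexp.

Fixpoint leval (V : lmodType F) (env : seq V) e : V :=
  match e with
  | LVar i => nth 0 env i
  | LZero => 0
  | LAdd e1 e2 => leval env e1 + leval env e2
  | LOpp e1 => - leval env e1
  | LScale k e1 => k *: leval env e1
  end.

(** [eqn] instead of [==] lets [cbn] evaluate the comparison of atom numbers. *)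
Fixpoint lcoef e (i : nat) : F :=
  match e with
  | LVar j => if eqn i j then 1 else 0
  | LZero => 0
  | LAdd e1 e2 => lcoef e1 i + lcoef e2 i
  | LOpp e1 => - lcoef e1 i
  | LScale k e1 => k * lcoef e1 i
  end.

Fixpoint eq_lcoef n e1 e2 : Prop :=
  if n is m.+1 then lcoef e1 m = lcoef e2 m /\ eq_lcoef m e1 e2 else True.

Lemma leval_coef (V : lmodType F) (env : seq V) e :
  leval env e = \sum_(i < size env) lcoef e i *: nth 0 env i.
Proof.
elim: e => [j||e1 IH1 e2 IH2|e IH|k e IH] /=.
- case: (ltnP j (size env)) => js; last first.
    rewrite nth_default // big1 // => i _.
    by case: eqnP => [ij|_]; rewrite ?scale0r //; have := ltn_ord i; rewrite ij ltnNge js.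
  rewrite (bigD1 (Ordinal js)) //= (introT eqnP erefl) scale1r big1 ?addr0 //.
  move=> i /eqP ij; case: eqnP => [e|_]; last by rewrite scale0r.
  by case: ij; apply: val_inj.
- by rewrite big1 // => i _; rewrite scale0r.
- by rewrite IH1 IH2 -big_split; apply: eq_bigr => i _; rewrite scalerDl.
- by rewrite IH -sumrN; apply: eq_bigr => i _; rewrite scaleNr.
- by rewrite IH scaler_sumr; apply: eq_bigr => i _; rewrite scalerA.
Qed.

Lemma lexp_eq (V : lmodType F) (env : seq V) e1 e2 :
  eq_lcoef (size env) e1 e2 -> leval env e1 = leval env e2.
Proof.
move=> ee; rewrite !leval_coef; apply: eq_bigr => -[i /= it] _; congr (_ *: _).
elim: (size env) it ee => // n IH; rewrite ltnS leq_eqVlt => /orP[/eqP->|/IH ein].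
  by case.
by case=> _ /ein.
Qed.
End LinearExpressions.
Arguments LVar {F}. Arguments LZero {F}.

Ltac atom_index x env :=
  lazymatch env with
  | ?y :: ?env' =>
      match constr:(tt) with
      | _ => let _ := match constr:(tt) with _ => unify x y end in constr:(0%N)
      | _ => let i := atom_index x env' in constr:(S i)
      end
  end.

Ltac add_atom x env :=
  let rec mem l :=
    lazymatch l with
    | nil => constr:(x :: env)
    | ?y :: ?l' =>
        match constr:(tt) with
        | _ => let _ := match constr:(tt) with _ => unify x y end in env
        | _ => mem l'
        end
    end in mem env.

Ltac atoms e env :=
  lazymatch e with
  | (?a + ?b)%R => let env' := atoms a env in atoms b env'
  | (- ?a)%R => atoms a env
  | (_ *: ?a)%R => atoms a env
  | 0%R => env
  | _ => add_atom e env
  end.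

Ltac reify F e env :=
  lazymatch e with
  | (?a + ?b)%R => let a' := reify F a env in let b' := reify F b env in
      constr:(@LAdd F a' b')
  | (- ?a)%R => let a' := reify F a env in constr:(@LOpp F a')
  | (?k *: ?a)%R => let a' := reify F a env in constr:(@LScale F k a')
  | 0%R => constr:(@LZero F)
  | _ => let i := atom_index e env in constr:(@LVar F i)
  end.

(* Reduces an identity between linear combinations to that of coefficients. *)
Ltac lmod F V :=
  lazymatch goal with
  | |- ?a = ?b =>
    let env := atoms a (@nil (GRing.Lmodule.sort V)) in
    let env := atoms b env in
    let a' := reify F a env in let b' := reify F b env in
    apply: (@lexp_eq F V env a' b');
    cbn [eq_lcoef lcoef eqn size]; repeat split
  end.
Lemma scaler_cancel (F : fieldType) (V : lmodType F) (k : F) (u w : V) :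
  k != 0 -> k *: u = k *: w -> u = w.
Proof.
by move=> k0 /(congr1 ( *:%R k^-1)); rewrite !scalerA mulVf // !scale1r.
Qed.

Section PropLinear.
Variables (F : fieldType) (U W : lmodType F) (f : U -> W).
Hypothesis lf : linear f.

Lemma lin0 : f 0 = 0.
Proof. by have := lf (-1) 0 0; rewrite !scaleN1r !addNr. Qed.

Lemma linD x y : f (x + y) = f x + f y.
Proof. by rewrite -[x]scale1r lf !scale1r. Qed.

Lemma linZ k x : f (k *: x) = k *: f x.
Proof. by rewrite -[k *: x]addr0 lf lin0 addr0. Qed.

Lemma linN x : f (- x) = - f x.
Proof. by rewrite -!scaleN1r linZ. Qed.

Lemma linB x y : f (x - y) = f x - f y.
Proof. by rewrite linD linN. Qed.

Lemma lin_sum (T : Type) (s : seq T) (g : T -> U) :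
  f (\sum_(i <- s) g i) = \sum_(i <- s) f (g i).
Proof. by elim: s => [|i s IH]; rewrite ?big_nil ?lin0 // !big_cons linD IH. Qed.
End PropLinear.

(** * Supports and contraction with the symplectic form *)

Section Omega.
Variables (F : fieldType) (I : choiceType).
Local Notation J := (I + I)%type.
Local Notation V := (vsp F I).
Local Notation half := (2%:R^-1 : F).

Definition bv (j : J) : V := << j >>.
Definition idx (j : J) : I := match j with inl i | inr i => i end.

Lemma coeff_bv j k : coeff k (bv j) = (j == k)%:R :> F.
Proof. by rewrite /bv coeffU mul1r. Qed.

Lemma vspP (u w : V) : (forall j, coeff j u = coeff j w) -> u = w.
Proof. by move=> e; apply/eqP/freeg_eqP. Qed.

Lemma vform_bvr j (u : V) : vform u (bv (bar j)) = sgnj F j * coeff j u.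
Proof. exact: vform_barr. Qed.

Lemma vform_bvl j (u : V) : vform (bv (bar j)) u = - (sgnj F j * coeff j u).
Proof. by rewrite vform_skew vform_bvr. Qed.

Lemma idx_bar j : idx (bar j) = idx j. Proof. by case: j. Qed.

Lemma vform_bv (j k : J) : vform (bv j) (bv k) = form_basis F j k.
Proof. exact: vform_basis. Qed.

Lemma vform_bv0 (j k : J) : idx j != idx k -> vform (bv j) (bv k) = 0.
Proof. by rewrite vform_bv; case: j k => i [] k //= /negbTE->; rewrite muln0 ?oppr0. Qed.

Definition vsupp (t : seq I) (u : V) := forall j, idx j \notin t -> coeff j u = 0.

Definition msupp (t : seq I) (x : V -> V) :=
  (forall j, idx j \notin t -> x (bv j) = 0) /\ forall u, vsupp t (x u).

Lemma vsupp_vform t u k : vsupp t u -> idx k \notin t -> vform u (bv k) = 0.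
Proof.
by move=> tu kt; rewrite -[k]barK vform_bvr tu ?mulr0 // idx_bar.
Qed.

Lemma vsupp_vforml t u k : vsupp t u -> idx k \notin t -> vform (bv k) u = 0.
Proof. by move=> tu kt; rewrite vform_skew (vsupp_vform tu) ?oppr0. Qed.

Lemma vsuppW t t' u : {subset t <= t'} -> vsupp t u -> vsupp t' u.
Proof. by move=> tt' tu j jt'; apply: tu; apply: contra jt'; apply: tt'. Qed.

Lemma msuppW t t' x : {subset t <= t'} -> msupp t x -> msupp t' x.
Proof.
move=> tt' [x0 x1]; split=> [j jt'|u]; last exact: vsuppW (x1 u).
by apply: x0; apply: contra jt'; apply: tt'.
Qed.

Lemma vsupp_bv t j : idx j \in t -> vsupp t (bv j).
Proof.
move=> jt k kt; rewrite coeff_bv; case: eqP => // jk.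
by rewrite -jk jt in kt.
Qed.

Lemma vsupp_lin t k u w : vsupp t u -> vsupp t w -> vsupp t (k *: u + w).
Proof. by move=> tu tw j jt; rewrite coeffD coeffZ tu // tw // mulr0 addr0. Qed.

Lemma vsupp0 t : vsupp t 0.
Proof. by move=> j _; rewrite coeff0. Qed.

Lemma vsupp_dom (u : V) : vsupp (undup [seq idx j | j <- dom u]) u.
Proof.
move=> j jt; apply: coeff_outdom; apply: contra jt => ju.
by rewrite mem_undup map_f.
Qed.

Lemma msupp_gl x : x \in @gl F I -> exists2 t, uniq t & msupp t x.
Proof.
move=> /gl_finitary[s [_ _ x0 x1]].
have st j : idx j \notin undup (map idx s) -> j \notin s.
  by apply: contra => js; rewrite mem_undup map_f.
exists (undup (map idx s)); first exact: undup_uniq.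
by split=> [j /st /x0//|u j /st /x1].
Qed.

Section Sum.
Variable W : lmodType F.
Implicit Types (B : V -> V -> W) (t : seq I).

(** Contraction of B with the 𝒢-invariant tensor Σ (v_i ⊗ v_ī - v_ī ⊗ v_i), truncated to the finite
    set t. It replaces sums over matrix units and makes traces and invariance basis-free. *)
Definition omega t B : W :=
  \sum_(i <- t) (B (bv (inl i)) (bv (inr i)) - B (bv (inr i)) (bv (inl i))).

Lemma eq_omega t B B' :
  (forall j, idx j \in t -> B (bv j) (bv (bar j)) = B' (bv j) (bv (bar j))) ->
  omega t B = omega t B'.
Proof.
move=> eB; rewrite /omega !big_seq; apply: eq_bigr => i it.
by rewrite (eB (inl i)) // (eB (inr i)).
Qed.

Lemma omegaZD t k B B' :
  omega t (fun u w => k *: B u w + B' u w) = k *: omega t B + omega t B'.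
Proof.
rewrite /omega scaler_sumr -big_split; apply: eq_bigr => i _ /=.
by rewrite scalerBr opprD addrACA.
Qed.

Lemma omega0 t : omega t (fun _ _ => 0) = 0.
Proof. by rewrite /omega big1 // => i _; rewrite subrr. Qed.

Lemma omegaZ t k B : omega t (fun u w => k *: B u w) = k *: omega t B.
Proof.
by rewrite /omega scaler_sumr; apply: eq_bigr => i _ /=; rewrite scalerBr.
Qed.

Lemma omegaD t B B' :
  omega t (fun u w => B u w + B' u w) = omega t B + omega t B'.
Proof.
by rewrite /omega -big_split; apply: eq_bigr => i _ /=; rewrite opprD addrACA.
Qed.

Lemma omegaN t B : omega t (fun u w => - B u w) = - omega t B.
Proof.
by rewrite /omega -sumrN; apply: eq_bigr => i _ /=; rewrite opprB opprK addrC.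
Qed.

Lemma omega_swap t B : omega t (fun u w => B w u) = - omega t B.
Proof. by rewrite /omega -sumrN; apply: eq_bigr => i _ /=; rewrite opprB. Qed.

Lemma omega_widen t t' B : uniq t -> uniq t' -> {subset t <= t'} ->
  (forall j, idx j \notin t -> B (bv j) (bv (bar j)) = 0) ->
  omega t' B = omega t B.
Proof.
move=> ut ut' tt' B0; rewrite /omega [LHS](bigID (mem t)) /= addrC big1 ?add0r.
  rewrite -big_filter; apply: perm_big; apply: uniq_perm => //.
    exact: filter_uniq.
  move=> i; rewrite mem_filter /=; apply/andP/idP => [[]//|it].
  by split=> //; apply: tt'.
by move=> i it; rewrite (B0 (inl i)) // (B0 (inr i)) // subrr.
Qed.

(** Expansion of u in dual bases; the factor 2 is (v_i, v_ī). *)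
Lemma omega_vform t (f : V -> W) u : linear f -> uniq t -> vsupp t u ->
  omega t (fun v w => vform v u *: f w) = 2%:R *: f u.
Proof.
move=> lf ut tu.
have uE : u = \sum_(j <- map inl t ++ map inr t) coeff j u *: bv j.
  apply: vsumE' => [|j].
    rewrite cat_uniq (map_inj_uniq (@inl_inj _ _)) (map_inj_uniq (@inr_inj _ _)).
    rewrite ut andbT /=; apply/hasPn => _ /mapP[i it ->] /=.
    by apply/mapP => -[].
  rewrite mem_cat negb_or => /andP[jl jr]; apply: tu; case: j jl jr => i jl jr.
    by apply: contra jl => /(map_f inl).
  by apply: contra jr => /(map_f inr).
rewrite [in RHS]uE (lin_sum lf) big_cat !big_map /= -big_split scaler_sumr; apply: eq_bigr.
move=> i _; rewrite (vform_bvl (inr i)) (vform_bvl (inl i)) /=.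
by rewrite !(linZ lf) mulNr opprK -scaleNr opprK scalerDr !scalerA addrC.
Qed.

Lemma omega_vform' t (f : V -> W) u : linear f -> uniq t -> vsupp t u ->
  omega t (fun v w => vform w u *: f v) = - 2%:R *: f u.
Proof.
by move=> lf ut tu; rewrite (omega_swap t (fun v w => vform v u *: f w))
  omega_vform // scaleNr.
Qed.

End Sum.

Lemma lin_omega (W W' : lmodType F) t (f : W' -> W) (B : V -> V -> W') :
  linear f -> f (omega t B) = omega t (fun u w => f (B u w)).
Proof.
move=> lf; rewrite /omega (lin_sum lf); apply: eq_bigr => i _.
by rewrite (linB lf).
Qed.

Lemma omega_exchange (W : lmodType F) t t' (B : V -> V -> V -> V -> W) :
  omega t (fun u w => omega t' (fun u' w' => B u w u' w')) =
  omega t' (fun u' w' => omega t (fun u w => B u w u' w')).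
Proof.
rewrite /omega; under eq_bigr do rewrite -sumrB.
rewrite exchange_big; apply: eq_bigr => i _ /=.
rewrite -sumrB; apply: eq_bigr => k _.
by rewrite !opprB addrACA [in RHS]addrACA; congr (_ + _); rewrite addrC.
Qed.

Hypothesis F0 : [pchar F] =i pred0.

Lemma F2 : 2%:R != 0 :> F. Proof. by rewrite ((pcharf0P F).1 F0). Qed.

(* Both sides are expanded in a second copy of the dual bases; the adjointness
   of [g] then moves it across. *)
Lemma omega_inv (W : lmodType F) t (B : V -> V -> W) g : uniq t ->
  (forall w, linear (B^~ w)) -> (forall u, linear (B u)) ->
  g \in @spG F I -> msupp t g ->
  omega t (fun u w => B (g u) w) = - omega t (fun u w => B u (g w)).
Proof.
move=> ut Bl Br /spGP[_ ag] [_ tg].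
apply: (@scaler_cancel _ _ (- 2%:R)); first by rewrite oppr_eq0 F2.
rewrite -omegaZ; transitivity (omega t (fun u w => omega t (fun u' w' =>
    vform w' (g u) *: B u' w))).
  by apply: eq_omega => j _; rewrite (omega_vform' (f := B^~ (bv (bar j)))).
rewrite omega_exchange scalerN scaleNr opprK -omegaZ; apply: eq_omega => j _.
rewrite -[RHS](omega_vform (f := B (bv j)) (Br _) ut (tg _)).
apply: eq_omega => k _; congr (_ *: _).
by rewrite vform_skew ag expr1 mulN1r opprK.
Qed.
End Omega.

(** * The matrices of 𝒢 and 𝒮 *)

Section Qf.
Variables (F : fieldType) (I : choiceType) (I0 : {fset I}).
Hypothesis F0 : [pchar F] =i pred0.
Hypothesis ell_gt0 : (0 < ell I0)%N.
Local Notation J := (I + I)%type.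
Local Notation V := (vsp F I).
Local Notation half := (2%:R^-1 : F).
Implicit Types (d : bool) (u w z : V) (x y : V -> V).

Lemma natF n : (n%:R == 0 :> F) = (n == 0%N).
Proof. exact: (pcharf0P F).1 F0 n. Qed.

Lemma ellF0 : (ell I0)%:R != 0 :> F.
Proof. by rewrite natF -lt0n. Qed.

Ltac fld := field; rewrite ?F2 ?ellF0.

(** Parity convention: [false] stands for 𝒢 and 𝒜, [true] for 𝒮 and ℬ. On matrices [mcomm] adds
    parities and [mcirc] adds and flips them; on coordinates [acomm] adds and [comm] flips, so that
    the formulas match up. *)
Definition spd d : {pred V -> V} := if d then @spS F I else @spG F I.

(* Locked so that the linearity lemmas do not rewrite inside it. *)
Definition Qf d u w : V -> V := locked (if d then vcomm I0 u w else vcirc u w).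

Lemma QfF u w : Qf false u w = vcirc u w. Proof. by rewrite /Qf -lock. Qed.

Lemma QfD d u w z : Qf d u w z =
  half *: (vform w z *: u + (-1) ^+ d *: (vform u z *: w))
  + (d%:R * vform u w / (2 * ell I0)%:R) *: idI0 I0 z.
Proof.
rewrite /Qf -lock; case: d; rewrite /vcomm /vcirc.
  by rewrite expr1 scaleN1r mul1r.
by rewrite expr0 scale1r mul0r mul0r scale0r addr0.
Qed.

(** Orthogonality removes the trace correction, which is why most computations below are restricted
    to orthogonal pairs. *)
Lemma QfE d u w z : vform u w = 0 ->
  Qf d u w z = half *: (vform w z *: u + (-1) ^+ d *: (vform u z *: w)).
Proof. by move=> uw; rewrite QfD uw mulr0 mul0r scale0r addr0. Qed.

Lemma Qf_spd d u w : Qf d u w \in spd d.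
Proof.
by rewrite /Qf -lock; case: d; [apply: vcomm_spS | apply: vcirc_spG].
Qed.

Lemma spd_lin d k x y : x \in spd d -> y \in spd d -> k *: x + y \in spd d.
Proof. by case: d => xd yd; apply: rpredD => //; apply: rpredZ. Qed.

Lemma spd0 d : 0 \in spd d. Proof. by case: d; apply: rpred0. Qed.

Lemma spdZ d k x : x \in spd d -> k *: x \in spd d.
Proof. by case: d => xd; apply: rpredZ. Qed.

Lemma spdD d x y : x \in spd d -> y \in spd d -> x + y \in spd d.
Proof. by case: d => xd yd; apply: rpredD. Qed.

Lemma spd_omega d t (B : V -> V -> V -> V) :
  (forall j, idx j \in t -> B (bv F j) (bv F (bar j)) \in spd d) ->
  omega t B \in spd d.
Proof.
move=> Bd; rewrite /omega big_seq; case: d Bd => Bd; apply: rpred_sum => i it;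
  by apply: rpredB; [apply: (Bd (inl i)) | apply: (Bd (inr i))].
Qed.

Lemma spd_gl d x : x \in spd d -> x \in @gl F I.
Proof. by case: d => [/spSP[]|/spGP[]]. Qed.

Lemma spd_linear d x : x \in spd d -> linear x.
Proof. by move/spd_gl/gl_linear. Qed.

Lemma spd_adjs d x : x \in spd d -> adjs (~~ d) x.
Proof. by case: d => [/spSP[]|/spGP[]]. Qed.

Lemma spd_tr d x : x \in spd d -> tr x = 0.
Proof.
case: d => [/spSP[]//|xG]; apply: tr_anti => //; first exact: (@spd_gl false).
exact: (@spd_adjs false).
Qed.

Lemma spd_adj d x u w : x \in spd d ->
  vform (x u) w = - ((-1) ^+ d * vform u (x w)).
Proof.
by move/spd_adjs => ->; case: d; rewrite ?expr0 ?expr1 ?mulN1r ?mul1r ?opprK.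
Qed.

Lemma spd_supp d x : x \in spd d -> exists2 t, uniq t & msupp t x.
Proof. by move/spd_gl/msupp_gl. Qed.

Lemma Qf_linl d w k u u' : Qf d (k *: u + u') w = k *: Qf d u w + Qf d u' w.
Proof.
apply/funext => z; apply: vspP => j.
rewrite -[(_ + _) z]/(k *: (Qf d u w z) + Qf d u' w z) !QfD.
rewrite !(coeffD, coeffZ) !vformDl !vformZl.
by fld.
Qed.

Lemma Qf_swap d u w : Qf d w u = (-1) ^+ d *: Qf d u w.
Proof.
apply/funext => z; apply: vspP => j.
rewrite -[RHS]/(coeff j ((-1) ^+ d *: Qf d u w z)) !QfD.
rewrite !(coeffD, coeffZ) (vform_skew w u).
by case: d; rewrite /= ?expr0 ?expr1; fld.
Qed.

Lemma Qf_linr d u k w w' : Qf d u (k *: w + w') = k *: Qf d u w + Qf d u w'.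
Proof.
rewrite Qf_swap Qf_linl scalerDr scalerA mulrC -scalerA.
by rewrite -!Qf_swap.
Qed.

Lemma mcomm_Qf d x u w : x \in @spG F I -> vform u w = 0 ->
  mcomm x (Qf d u w) = Qf d (x u) w + Qf d u (x w).
Proof.
move=> xG uw; have lx := @spd_linear false x xG.
have ax a b : vform (x a) b = - vform a (x b).
  by rewrite (@spd_adj false x a b xG) mul1r.
apply/funext => z; apply: vspP => j.
rewrite -[mcomm _ _ z]/(x (Qf d u w z) - Qf d u w (x z)).
rewrite -[(_ + _) z]/(Qf d (x u) w z + Qf d u (x w) z) !(QfE _ _ uw) !QfD.
rewrite ax !(linZ lx, linD lx) !(coeffN, coeffD, coeffZ) !ax.
by fld.
Qed.

(** Only the slot of u is affected, since v is killed by x. Adjointness is assumed instead of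
    membership in [spd d] because x may also be [idI0], whose trace is not 0. *)
Lemma mcomm_vcirc_kill d x u v : linear x -> adjs (~~ d) x -> x v = 0 ->
  mcomm (vcirc u v) x = - Qf d (x u) v.
Proof.
move=> lx ax xv.
have xuv : vform (x u) v = 0 by rewrite ax xv vform0r mulr0.
apply/funext => z; apply: vspP => j.
rewrite -[mcomm _ _ z]/(vcirc u v (x z) - x (vcirc u v z)).
rewrite -[(- _) z]/(- Qf d (x u) v z) (QfE _ _ xuv) /vcirc.
rewrite !(linZ lx, linD lx) xv !(coeffN, coeffD, coeffZ) coeff0 ax.
have -> : vform v (x z) = 0.
  by rewrite vform_skew ax xv; rewrite vform_skew vform0l !(oppr0, mulr0).
by case: d {ax} => /=; rewrite ?expr0 ?expr1; fld.
Qed.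

Lemma mcomm_anti x y : mcomm x y = - mcomm y x.
Proof. by rewrite /mcomm opprB. Qed.

(** Both summands of [Qf d (x u) w] contract to the same multiple of x, the second one by
    adjointness. The [idI0] corrections add up to a multiple of the trace, which is the second
    conclusion and will also remove unwanted terms later. *)
Lemma spd_decomp d t x : x \in spd d -> uniq t -> msupp t x ->
  x = (- half) *: omega t (fun u w => Qf d (x u) w) /\
  omega t (fun u w => vform (x u) w : F^o) = 0.
Proof.
move=> xd ut [x0 x1]; have lx := spd_linear xd.
have tr0 : omega t (fun u w => vform (x u) w : F^o) = 0.
  have := spd_tr xd; rewrite (@trE _ _ (map inl t ++ map inr t)).
  - rewrite big_cat /= !big_map -big_split /= => t0.
    rewrite -[RHS](mulr0 2%:R) -t0 mulr_sumr /omega; apply: eq_bigr => i _.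
    rewrite (vform_bvr (inl i)) (vform_bvr (inr i)) /= mulNr opprK.
    by rewrite -mulrDr.
  - rewrite cat_uniq (map_inj_uniq (@inl_inj _ _)) (map_inj_uniq (@inr_inj _ _)).
    by rewrite ut andbT /=; apply/hasPn => _ /mapP[i it ->] /=; apply/mapP => -[].
  - move=> j; rewrite mem_cat negb_or => /andP[jl jr]; rewrite x0 ?coeff0 //.
    case: j jl jr => i jl jr; first by apply: contra jl => /(map_f inl).
    by apply: contra jr => /(map_f inr).
split=> //; apply/funext => z.
have -> : ((- half) *: omega t (fun u w => Qf d (x u) w)) z =
    (- half) *: omega t (fun u w => Qf d (x u) w z).
  rewrite -[LHS]/((- half) *: (omega t (fun u w => Qf d (x u) w) z)).
  by rewrite /omega fct_sumE.
(* The part of z over t: x sees nothing else, and the dual basis expansion needs support in t. *)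
pose z' : V := \sum_(j <- dom z | idx j \in t) coeff j z *: bv F j.
have cz' k : coeff k z' = (idx k \in t)%:R * coeff k z.
  rewrite raddf_sum /= (eq_bigr (fun j => coeff j z * (j == k)%:R)); last first.
    by move=> j _; rewrite coeffZ coeff_bv.
  have [kz|kz] := boolP (k \in dom z); last first.
    rewrite (coeff_outdom kz) mulr0 big_seq_cond big1 // => j /andP[jz _].
    by case: eqP jz => [->|]; rewrite ?(negbTE kz) ?mulr0.
  rewrite big_mkcond (bigD1_seq k) ?uniq_dom //= eqxx mulr1 big1 ?addr0.
    by case: ifP; rewrite ?mul1r ?mul0r.
  by move=> j /negbTE->; rewrite mulr0 if_same.
have tz' : vsupp t z' by move=> k /negbTE kt; rewrite cz' kt mul0r.
have xz : x z = x z'.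
  apply/eqP; rewrite -subr_eq0 -(linB lx) (vsumE (z - z')) (lin_sum lx) big1 //.
  move=> j _; rewrite (linZ lx) coeffB cz'; case: (boolP (idx j \in t)) => jt.
    by rewrite mul1r subrr scale0r.
  by rewrite x0 // scaler0.
apply: (@scaler_cancel _ _ (- 2%:R)); first by rewrite oppr_eq0 F2.
rewrite scalerA mulrNN mulfV ?F2 // scale1r.
rewrite (eq_omega (B' := fun u w => half *: ((vform w z *: x u
   + (-1) ^+ d *: (vform (x u) z *: w)) )
   + (d%:R / (2 * ell I0)%:R * vform (x u) w) *: idI0 I0 z)); last first.
  by move=> j _; rewrite QfD [X in _ + X *: _]mulrAC.
rewrite omegaD omegaZ omegaD omegaZ.
have -> : omega t (fun u w => (d%:R / (2 * ell I0)%:R * vform (x u) w) *: idI0 I0 z) = 0.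
  have lf : linear (fun k : F^o => (d%:R / (2 * ell I0)%:R * k) *: idI0 I0 z).
    by move=> k a b; rewrite scalerA -scalerDl mulrDr mulrCA mulrA.
  by rewrite -(lin_omega _ _ lf) tr0 mulr0 scale0r.
have -> : omega t (fun u w => vform w z *: x u) = - 2%:R *: x z.
  rewrite xz -(omega_vform' lx ut tz').
  apply: eq_omega => j jt; congr (_ *: _); rewrite !vform_bvl cz' jt.
  by rewrite mul1r.
have -> : omega t (fun u w => vform (x u) z *: w) = (-1) ^+ d *: (- 2%:R *: x z).
  rewrite -[X in _ *: (- _ *: X)]/(id (x z)).
  have lid : linear (id : V -> V) by [].
  rewrite scaleNr -(omega_vform lid ut (x1 z)) -omegaN -omegaZ.
  apply: eq_omega => j _; rewrite (spd_adj _ _ xd).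
  by rewrite scaleNr -scalerA scalerN.
rewrite (scalerA ((-1) ^+ d) ((-1) ^+ d)) -expr2 sqrr_sign scale1r addr0.
rewrite -mulr2n -scaler_nat !scalerA; congr (_ *: _).
by fld.
Qed.

Lemma comp_Qf d d' u w u' w' z : vform u w = 0 -> vform u' w' = 0 ->
  Qf d u w (Qf d' u' w' z) = (half * half) *: (
    vform w u' *: (vform w' z *: u)
    + (-1) ^+ d' *: (vform w w' *: (vform u' z *: u))
    + (-1) ^+ d *: (vform u u' *: (vform w' z *: w))
    + (-1) ^+ d *: ((-1) ^+ d' *: (vform u w' *: (vform u' z *: w)))).
Proof.
move=> uw uw'; rewrite !QfE //; apply: vspP => j.
rewrite !(vformDr, vformZr, coeffD, coeffZ).
by fld.
Qed.

Lemma mcomm_QfQf d d' u w u' w' : vform u w = 0 -> vform u' w' = 0 ->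
  mcomm (Qf d u w) (Qf d' u' w') = half *: (
    vform w u' *: Qf (d (+) d') u w'
    + (-1) ^+ d' *: (vform w w' *: Qf (d (+) d') u u')
    + (-1) ^+ d *: (vform u u' *: Qf (d (+) d') w w')
    + (-1) ^+ (d (+) d') *: (vform u w' *: Qf (d (+) d') w u')).
Proof.
move=> uw uw'; apply/funext => z; apply: vspP => j.
rewrite -[mcomm _ _ z]/(Qf d u w (Qf d' u' w' z) - Qf d' u' w' (Qf d u w z)).
rewrite !comp_Qf //.
rewrite -[(half *: (_ + _ + _ + _)) z]/(half *: (
    vform w u' *: Qf (d (+) d') u w' z
    + (-1) ^+ d' *: (vform w w' *: Qf (d (+) d') u u' z)
    + (-1) ^+ d *: (vform u u' *: Qf (d (+) d') w w' z)
    + (-1) ^+ (d (+) d') *: (vform u w' *: Qf (d (+) d') w u' z))).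
rewrite !QfD !(coeffD, coeffZ, coeffN).
rewrite (vform_skew u' w) (vform_skew u' u) (vform_skew w' w) (vform_skew w' u).
by case: d; case: d'; rewrite /= ?expr0 ?expr1; fld.
Qed.

Lemma tr_Qfr d u w y : vform u w = 0 -> y \in @gl F I -> tr (Qf d u w \o y)
  = half * (vform w (y u) + (-1) ^+ d * vform u (y w)).
Proof.
move=> uw gy; have ly := gl_linear gy.
rewrite tr_compC ?(spd_gl (Qf_spd _ _ _)) //.
have -> : y \o Qf d u w = half *: (1 *: (fun z => vform w z *: y u)
    + ((-1) ^+ d *: (fun z => vform u z *: y w) + 0)) + 0.
  apply/funext => z; rewrite -[LHS]/(y (Qf d u w z)) QfE // !(linZ ly, linD ly).
  rewrite -[RHS]/(half *: (1 *: (vform w z *: y u) +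
    ((-1) ^+ d *: (vform u z *: y w) + 0)) + 0).
  by rewrite !addr0 scale1r.
have g0 : 0 \in @gl F I by apply: rpred0.
have g1 : (-1) ^+ d *: (fun z => vform u z *: y w) + 0 \in @gl F I.
  by apply: rpredD g0; apply: rpredZ (rank1_gl _ _).
have g2 : 1 *: (fun z => vform w z *: y u)
    + ((-1) ^+ d *: (fun z => vform u z *: y w) + 0) \in @gl F I.
  by apply: rpredD g1; apply: rpredZ (rank1_gl _ _).
rewrite tr_linear // tr_linear //; last exact: rank1_gl.
by rewrite tr_linear ?rank1_gl // !tr_rank1 tr0 !addr0 mul1r.
Qed.

Lemma tr_QfQf d d' u w u' w' : vform u w = 0 -> vform u' w' = 0 ->
  tr (Qf d u w \o Qf d' u' w') = - (d == d')%:R * half *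
    (vform w u' * vform u w' + (-1) ^+ d * (vform w w' * vform u u')).
Proof.
move=> uw uw'; rewrite tr_Qfr ?(spd_gl (Qf_spd _ _ _)) // !QfE //.
rewrite !(vformDr, vformZr).
rewrite (vform_skew u' w) (vform_skew u' u) (vform_skew w' w) (vform_skew w' u).
by case: d; case: d'; rewrite /= ?expr0 ?expr1; fld.
Qed.

(** The pairs on the right need not be orthogonal: their [idI0] corrections are exactly what the
    trace term of [mcirc] contributes. *)
Lemma mcirc_QfQf d d' u w u' w' : vform u w = 0 -> vform u' w' = 0 ->
  mcirc I0 (Qf d u w) (Qf d' u' w') = half *: (
    vform w u' *: Qf (~~ (d (+) d')) u w'
    + (-1) ^+ d' *: (vform w w' *: Qf (~~ (d (+) d')) u u')
    + (-1) ^+ d *: (vform u u' *: Qf (~~ (d (+) d')) w w')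
    + (-1) ^+ (d (+) d') *: (vform u w' *: Qf (~~ (d (+) d')) w u')).
Proof.
move=> uw uw'; apply/funext => z; apply: vspP => j.
rewrite -[mcirc _ _ _ z]/(Qf d u w (Qf d' u' w' z) + Qf d' u' w' (Qf d u w z)
   - (tr (Qf d u w \o Qf d' u' w') / (ell I0)%:R) *: idI0 I0 z).
rewrite !comp_Qf // tr_QfQf //.
rewrite -[(half *: (_ + _ + _ + _)) z]/(half *: (
    vform w u' *: Qf (~~ (d (+) d')) u w' z
    + (-1) ^+ d' *: (vform w w' *: Qf (~~ (d (+) d')) u u' z)
    + (-1) ^+ d *: (vform u u' *: Qf (~~ (d (+) d')) w w' z)
    + (-1) ^+ (d (+) d') *: (vform u w' *: Qf (~~ (d (+) d')) w u' z))).
rewrite !QfD !(coeffD, coeffZ, coeffN).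
rewrite (vform_skew u' w) (vform_skew u' u) (vform_skew w' w) (vform_skew w' u).
by case: d; case: d'; rewrite /= ?expr0 ?expr1; fld.
Qed.

Lemma idI0_linear : linear (@idI0 F I I0).
Proof. exact/gl_linear/idI0_gl. Qed.

Lemma idI0_bv0 j : idx j \notin I0 -> idI0 I0 (bv F j) = 0.
Proof. by rewrite /bv idI0E /idx => /negbTE->. Qed.

Hypothesis Iinf : infinite_set [set: I].

(** The infinity of I enters here: finitely many vectors involve finitely many indices. *)
Lemma fresh (s : seq V) (t : seq I) : exists i,
  [/\ i \notin t, i \notin I0 & forall u, u \in s ->
     forall j, idx j = i -> vform u (bv F j) = 0 /\ vform (bv F j) u = 0].
Proof.
pose X := [set` (t ++ I0) ++ flatten [seq map (@idx I) (dom u) | u <- s]].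
have [i iX] : exists i, ~ X i.
  apply: contrapT => /forallNP nX; apply: Iinf; apply: (sub_finite_set (B := X)).
    by move=> i _; apply: contrapT => /nX.
  exact: finite_seq.
move: iX; rewrite /X /= !mem_cat => /negP; rewrite !negb_or.
move=> /andP[/andP[it iI0] /flattenP iu]; exists i; split=> // u us j ji.
suff uj : vform u (bv F j) = 0 by split=> //; rewrite vform_skew uj oppr0.
rewrite -[j]barK vform_bvr coeff_outdom ?mulr0 //.
apply: contra_notN iu => ju; exists (map (@idx I) (dom u)); first exact: map_f.
by apply/mapP; exists (bar j); rewrite // idx_bar ji.
Qed.
End Qf.

(** * The coordinate algebra *)

Section Braces.
Variables (F : fieldType) (q : BCquadruple F).
Hypothesis F0 : [pchar F] =i pred0.
Local Notation alg := (calg q).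
Local Notation star := (@cstar F q).
Local Notation act := (@cact F q).
Local Notation f := (@cform F q).
Local Notation half := (2%:R^-1 : F).

Definition std (d : bool) : {pred alg} := if d then star_skew else star_fixed.

Definition cpart (d : bool) (x : alg) : alg := half *: (x + (-1) ^+ d *: star x).

Implicit Type d : bool.

Lemma star_std d x : x \in std d -> star x = (-1) ^+ d *: x.
Proof. by case: d => /eqP ->; rewrite ?expr1 ?scaleN1r ?expr0 ?scale1r. Qed.

Lemma stdP d x : star x = (-1) ^+ d *: x -> x \in std d.
Proof. by case: d => sx; apply/eqP; rewrite sx ?scaleN1r ?scale1r. Qed.

Lemma std_lin d k x y : x \in std d -> y \in std d -> k *: x + y \in std d.
Proof. by case: d => xd yd; apply: rpredD => //; apply: rpredZ. Qed.

Lemma std0 d : 0 \in std d. Proof. by case: d; apply: rpred0. Qed.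

Lemma star1 : star 1 = 1.
Proof.
by have := cstarM (star 1) 1; rewrite !mulr1 !cstarK mulr1 => <-.
Qed.

Lemma std1 : (1 : alg) \in std false.
Proof. by apply: stdP; rewrite star1 scale1r. Qed.

Lemma cpart_std d x : cpart d x \in std d.
Proof.
apply: stdP; rewrite cstarZ cstarD cstarZ cstarK scalerA mulrC -scalerA.
by congr (_ *: _); rewrite scalerDr scalerA -expr2 sqrr_sign scale1r addrC.
Qed.

Lemma cpart_lin d k x y : cpart d (k *: x + y) = k *: cpart d x + cpart d y.
Proof.
rewrite /cpart cstarD cstarZ [in RHS]scalerA [k * _]mulrC -scalerA -scalerDr.
congr (_ *: _); rewrite !scalerDr addrACA; congr (_ + (_ + _)).
by rewrite !scalerA mulrC.
Qed.

Lemma half2 (V : lmodType F) (x : V) : half *: (x + x) = x.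
Proof. by rewrite -mulr2n -scaler_nat scalerA mulVf ?F2 // scale1r. Qed.

Lemma cpart_sum x : cpart false x + cpart true x = x.
Proof.
rewrite /cpart expr0 expr1 scale1r scaleN1r -scalerDr addrACA subrr addr0.
exact: half2.
Qed.

Lemma cpart_diff x : cpart false x - cpart true x = star x.
Proof.
rewrite /cpart expr0 expr1 scale1r scaleN1r -scalerBr opprD addrACA subrr.
by rewrite add0r opprK half2.
Qed.

Lemma cpart_id d x : x \in std d -> cpart d x = x.
Proof.
by move=> /star_std sx; rewrite /cpart sx scalerA -expr2 sqrr_sign scale1r half2.
Qed.

Lemma cpart_other d x : x \in std (~~ d) -> cpart d x = 0.
Proof.
move=> /star_std sx; rewrite /cpart sx scalerA.
by case: d {sx} => /=; rewrite ?mulN1r ?mulr1 ?mul1r ?scaleN1r subrr scaler0.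
Qed.

Lemma brace_linl y : linear (fun x => @brace F q x y).
Proof.
by move=> k x x'; rewrite /brace tens_linearl linearP.
Qed.

Lemma brace_linr x : linear (@brace F q x).
Proof. by move=> k y y'; rewrite /brace tens_linearr linearP. Qed.

Lemma of_alg_lin : linear (@of_alg F q).
Proof.
move=> k x y; rewrite /of_alg -[RHS]/(k *: x + y, k *: 0 + 0).
by rewrite scaler0 addr0.
Qed.

Lemma of_mod_lin : linear (@of_mod F q).
Proof.
move=> k x y; rewrite /of_mod -[RHS]/(k *: 0 + 0, k *: x + y).
by rewrite scaler0 addr0.
Qed.

Lemma bb_split (b : bb q) : b = of_alg b.1 + of_mod b.2.
Proof. by case: b => x c; rewrite -[RHS]/(x + 0, 0 + c) addr0 add0r. Qed.

Section Relations.
(* The relations defining {𝔟, 𝔟}, for an arbitrary bilinear map. *)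
Variables (W : lmodType F) (kap : bb q -> bb q -> W).

Record brace_like : Prop := BraceLike {
  bl_linl : forall y, linear (kap^~ y);
  bl_linr : forall x, linear (kap x);
  bl_am : forall x c, kap (of_alg x) (of_mod c) = 0;
  bl_ma : forall x c, kap (of_mod c) (of_alg x) = 0;
  bl_ss : forall a b, a \in star_fixed -> b \in star_skew ->
    kap (of_alg a) (of_alg b) = 0;
  bl_anti : forall x y, kap (of_alg x) (of_alg y) = - kap (of_alg y) (of_alg x);
  bl_sym : forall c c', kap (of_mod c) (of_mod c') = kap (of_mod c') (of_mod c);
  bl_cyc : forall x y z, kap (of_alg (x * y)) (of_alg z) +
    kap (of_alg (z * x)) (of_alg y) + kap (of_alg (y * z)) (of_alg x) = 0;
  bl_form : forall x c c', kap (of_alg (f c c')) (of_alg x) +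
    kap (of_mod (act (star x) c')) (of_mod c) =
    kap (of_mod (act x c)) (of_mod c') }.
End Relations.

Lemma brace_rel0 z : @brace_rel F q z -> qproj (lspan (@brace_rel F q)) z = 0.
Proof.
move=> rz; rewrite -(linear0 (qproj (lspan (@brace_rel F q)))).
by apply/qprojP; rewrite subr0; apply: mem_lspan.
Qed.

Lemma brace_brace_like : brace_like (@brace F q).
Proof.
split.
- exact: brace_linl.
- exact: brace_linr.
- by move=> x c; apply: brace_rel0; apply: BraceAlgMod.
- by move=> x c; apply: brace_rel0; apply: BraceModAlg.
- by move=> a b aA bB; apply: brace_rel0; apply: BraceSymmSkew.
- move=> x y; apply/eqP; rewrite -addr_eq0 -linearD; apply/eqP.
  by apply: brace_rel0; apply: BraceAlg.
- move=> c c'; apply/eqP; rewrite -subr_eq0 -linearB; apply/eqP.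
  by apply: brace_rel0; apply: BraceMod.
- move=> x y z; rewrite /brace; do 2 rewrite -qprojD; apply: brace_rel0.
  exact: (BraceCyclic x y z).
move=> x c c'; apply/eqP; rewrite -subr_eq0 /brace -qprojD -qprojB; apply/eqP.
by apply: brace_rel0; apply: BraceForm.
Qed.

Section BraceLike.
Variables (W : lmodType F) (kap : bb q -> bb q -> W).
Hypothesis kP : brace_like kap.

Lemma bl_algl y : linear (fun x => kap (of_alg x) y).
Proof. by move=> k x x'; rewrite of_alg_lin (bl_linl kP). Qed.
Lemma bl_algr x : linear (fun y => kap x (of_alg y)).
Proof. by move=> k y y'; rewrite of_alg_lin (bl_linr kP). Qed.
Lemma bl_modl y : linear (fun x => kap (of_mod x) y).
Proof. by move=> k x x'; rewrite of_mod_lin (bl_linl kP). Qed.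
Lemma bl_modr x : linear (fun y => kap x (of_mod y)).
Proof. by move=> k y y'; rewrite of_mod_lin (bl_linr kP). Qed.

Lemma bl_1r x : kap (of_alg x) (of_alg 1) = 0.
Proof.
have := bl_cyc kP x 1 1; rewrite mulr1 !mul1r.
by rewrite [X in _ + _ + X](bl_anti kP) addrK.
Qed.

Lemma bl_1l x : kap (of_alg 1) (of_alg x) = 0.
Proof. by rewrite (bl_anti kP) bl_1r oppr0. Qed.

Lemma bl_split x y :
  kap x y = kap (of_alg x.1) (of_alg y.1) + kap (of_mod x.2) (of_mod y.2).
Proof.
rewrite {1}[x]bb_split {1}[y]bb_split (linD (bl_linl kP _)).
rewrite !(linD (bl_linr kP _)) (bl_am kP) (bl_ma kP) addr0 add0r.
by [].
Qed.

Lemma bl_skew x b : b \in star_skew ->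
  kap (of_alg (cpart true x)) (of_alg b) = kap (of_alg x) (of_alg b).
Proof.
move=> bB; rewrite -[x in RHS]cpart_sum (linD (bl_algl _)).
by rewrite (bl_ss kP (cpart_std false x)) // add0r.
Qed.

Variable l : nat.
Hypothesis l0 : (0 < l)%N.

(** The part of the derivation [bder] on 𝒞 that is not multiplication by a multiple of [bstar]. *)
Definition delta (x y : bb q) (c : cmod q) : cmod q :=
  - (half *: (act (f c y.2) x.2 + act (f c x.2) y.2)).

Lemma bmul_alg (x y : alg) : bmul (of_alg x : bb q) (of_alg y) = of_alg (x * y).
Proof.
rewrite /bmul /of_alg /= (lin0 (@cform_linearl F q 0)) addr0.
by rewrite !(lin0 (@cact_linearr F q _)) addr0.
Qed.

Lemma bmul_algmod (x : alg) (c : cmod q) : bmul (of_alg x) (of_mod c) = of_mod (act x c).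
Proof.
rewrite /bmul /of_alg /of_mod /= (lin0 (@cform_linearl F q c)) mulr0 addr0.
by rewrite !(lin0 (@cact_linearr F q _)) addr0.
Qed.

(** Commutators of 𝒜 with ℬ lie in 𝒜, so that [bstar] keeps precisely the skew part of the full
    commutator. *)
Lemma bstarE (x y : bb q) : bstar x y = cpart true (comm x.1 y.1) - heart x.2 y.2.
Proof.
rewrite /bstar; congr (_ - _); rewrite /symp /skewp.
have cl y' : linear (fun x' : alg => comm x' y').
  by move=> k u v; rewrite /comm mulrDl mulrDr -scalerAl -scalerAr scalerBr addrACA opprD.
have cr x' : linear (comm x' : alg -> alg).
  by move=> k u v; rewrite /comm mulrDl mulrDr -scalerAl -scalerAr scalerBr addrACA opprD.
rewrite !(linZ (cl _)) !(linZ (cr _)) !(linD (cl _)) !(linD (cr _)).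
rewrite !(linN (cl _)) !(linN (cr _)) /cpart expr1 scaleN1r opprK.
have -> : star (comm x.1 y.1) = - comm (star x.1) (star y.1).
  by rewrite cstarD cstarN !cstarM /comm opprB.
by rewrite opprK; lmod F (calg q); field; rewrite F2.
Qed.

(** The sum of a commutator and the commutator of the starred elements is twice its skew part, which
    turns 1/4ℓ into 1/2ℓ and lets both kinds of derivation be governed by [bstar]. *)
Lemma bderE (x y b : bb q) : bder l x y b =
  of_alg ((2 * l)%:R^-1 *: comm (bstar x y) b.1) +
  of_mod ((2 * l)%:R^-1 *: act (bstar x y) b.2 + delta x y b.2).
Proof.
have l2 : (l%:R != 0 :> F) by rewrite ((pcharf0P F).1 F0) -lt0n.
have wE : comm x.1 y.1 + comm (star x.1) (star y.1) = 2%:R *: cpart true (comm x.1 y.1).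
  rewrite /cpart expr1 scaleN1r scalerA mulfV ?F2 // scale1r; congr (_ + _).
  by rewrite cstarD cstarN !cstarM /comm opprB.
rewrite /bder /bder_alg /bder_mod wE /bcomm !bmul_alg !bmul_algmod /delta bstarE.
move: (cpart true _) (heart _ _) => w h.
have e (a : alg) (c : cmod q) : of_alg a + of_mod c = (a, c) :> bb q.
  by rewrite /of_alg /of_mod -[LHS]/(a + 0, 0 + c) addr0 add0r.
rewrite -!(linD of_mod_lin) -!(linB of_alg_lin) !e.
rewrite -[LHS]/((_ *: _ + (- (_ *: _) - _ *: 0)), (_ *: _ + (- (_ *: _) - _ *: _))).
congr (_, _); rewrite /=.
  rewrite scaler0 subr0 /comm !(mulrDl, mulrDr) !(mulrN, mulNr) -!scalerAl -!scalerAr.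
  by lmod F (calg q); rewrite ?natrM; field; rewrite ?l2 ?F2 ?((pcharf0P F).1 F0) ?andbT.
rewrite !(linD (@cact_linearl F q _), linN (@cact_linearl F q _), linZ (@cact_linearl F q _)).
by lmod F (cmod q); rewrite ?natrM; field; rewrite ?l2 ?F2 ?((pcharf0P F).1 F0) ?andbT.
Qed.

(** By the cyclic and the form relation, the terms in which [bstar b1 b2] acts collapse to a single
    pairing with it. This normal form is what the cocycle is later compared with. *)
Lemma kap_bder (b1 b2 b1' b2' : bb q) :
  kap (bder l b1 b2 b1') b2' + kap b1' (bder l b1 b2 b2') =
  kap (of_mod (delta b1 b2 b1'.2)) (of_mod b2'.2) +
  kap (of_mod b1'.2) (of_mod (delta b1 b2 b2'.2)) -
  (2 * l)%:R^-1 *: kap (of_alg (bstar b1' b2')) (of_alg (bstar b1 b2)).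
Proof.
rewrite !bderE; move: (bstar_skew b1 b2); move: (bstar b1 b2) => D DB.
rewrite (bl_split _ b2') (bl_split b1') /= !addr0 !add0r.
rewrite [bstar b1' b2']bstarE (linB (bl_algl _)) bl_skew //.
set x := b1'.1; set y := b2'.1; set c := b1'.2; set c' := b2'.2.
have -> : kap (of_alg (heart c c')) (of_alg D) =
   kap (of_mod (act D c)) (of_mod c') + kap (of_mod c) (of_mod (act D c')).
  have -> : heart c c' = cpart true (f c c').
    by rewrite /heart /cpart expr1 scaleN1r cform_skew opprK.
  rewrite bl_skew // -(bl_form kP) -[X in _ = _ + X](bl_sym kP).
  move/eqP: DB => ->.
  by rewrite (linN (@cact_linearl F q _)) (linN (bl_modl _)) addrNK.
rewrite !(linD (bl_modl _), linD (bl_modr _)).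
rewrite !(linZ (bl_algl _), linZ (bl_algr _), linZ (bl_modl _), linZ (bl_modr _)).
rewrite /comm !(linB (bl_algl _), linB (bl_algr _)).
have e1 := bl_cyc kP x y D; have e2 := bl_cyc kP y x D.
have -> : kap (of_alg (x * y)) (of_alg D) =
    - (kap (of_alg (D * x)) (of_alg y) + kap (of_alg (y * D)) (of_alg x)).
  by apply/eqP; rewrite -addr_eq0 addrA e1.
have -> : kap (of_alg (y * x)) (of_alg D) =
    - (kap (of_alg (D * y)) (of_alg x) + kap (of_alg (x * D)) (of_alg y)).
  by apply/eqP; rewrite -addr_eq0 addrA e2.
rewrite (bl_anti kP x) (bl_anti kP x (y * D)).
by lmod F W; ring.
Qed.
End BraceLike.
End Braces.

(** * The bracket formulas *)

Section StarParts.
Variables (F : fieldType) (q : BCquadruple F).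
Local Notation alg := (calg q).
Local Notation star := (@cstar F q).
Local Notation half := (2%:R^-1 : F).
Implicit Type d : bool.

Lemma half_std d a : a \in std d -> half *: a \in @std F q d.
Proof. by move=> ad; rewrite -[half *: a]addr0; apply: std_lin (std0 _ _). Qed.

Lemma comm_std d d' a a' : a \in std d -> a' \in std d' ->
  comm a a' \in @std F q (~~ (d (+) d')).
Proof.
move=> ad ad'; apply: stdP; rewrite cstarD cstarN !cstarM.
rewrite (star_std ad) (star_std ad') -!scalerAl -!scalerAr !scalerA.
rewrite /comm mulrC -!scalerBr -opprB scalerN -scaleNr.
by case: d {ad}; case: d' {ad'}; rewrite /= ?expr0 ?expr1 ?mulN1r ?mul1r ?opprK.
Qed.

Lemma acomm_std d d' a a' : a \in std d -> a' \in std d' ->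
  acomm a a' \in @std F q (d (+) d').
Proof.
move=> ad ad'; apply: stdP; rewrite cstarD !cstarM.
rewrite (star_std ad) (star_std ad') -!scalerAl -!scalerAr !scalerA.
rewrite /acomm mulrC -!scalerDr addrC.
by rewrite signr_addb mulrC.
Qed.

End StarParts.

Section MatrixParts.
Variables (F : fieldType) (I : choiceType) (I0 : {fset I}).
Hypothesis F0 : [pchar F] =i pred0.
Hypothesis ell_gt0 : (0 < ell I0)%N.
Local Notation V := (vsp F I).
Implicit Type d : bool.

Lemma mcirc_sym (x y : V -> V) : x \in @gl F I -> y \in @gl F I -> mcirc I0 x y = mcirc I0 y x.
Proof. by move=> xg yg; rewrite /mcirc tr_compC // [y \o x + _]addrC. Qed.

Lemma mcomm_spd d d' (x y : V -> V) : x \in spd d -> y \in spd d' ->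
  mcomm x y \in spd (d (+) d').
Proof.
case: d; case: d' => xd yd; [exact: mcomm_spSS| |exact: mcomm_spGS|exact: mcomm_spGG].
by rewrite mcomm_anti -scaleN1r; apply: spdZ; apply: mcomm_spGS.
Qed.

Lemma mcirc_spd d d' (x y : V -> V) : x \in spd d -> y \in spd d' ->
  mcirc I0 x y \in spd (~~ (d (+) d')).
Proof.
case: d; case: d' => xd yd; [exact: mcirc_spSS| |exact: mcirc_spGS|exact: mcirc_spGG].
by rewrite mcirc_sym ?(spd_gl xd) ?(spd_gl yd) //; apply: mcirc_spGS.
Qed.

End MatrixParts.

Section Presentation.
Variables (F : fieldType) (I : choiceType) (I0 : {fset I}) (q : BCquadruple F).
Local Notation alg := (calg q).
Local Notation V := (vsp F I).
Local Notation half := (2%:R^-1 : F).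

(* The bracket formulas of ℒ(𝔮, 𝒦) in a module M whose structure stays
   abstract, so that matching never unfolds tensors and quotients; gen false x a
   is x ⊗ a in 𝒢 ⊗ 𝒜, and gen true s b is s ⊗ b in 𝒮 ⊗ ℬ. *)
Record presented (M : lmodType F) (br : M -> M -> M)
    (gen : bool -> (V -> V) -> alg -> M) (VC : V -> cmod q -> M)
    (ang : bb q -> bb q -> M) : Prop := Presented {
  pr_lie : lie_bracket br;
  pr_genl : forall d k x y a, x \in spd d -> y \in spd d ->
    gen d (k *: x + y) a = k *: gen d x a + gen d y a;
  pr_genr : forall d x k a b, a \in std d -> b \in std d ->
    gen d x (k *: a + b) = k *: gen d x a + gen d x b;
  pr_VCl : forall c, linear (fun u => VC u c);
  pr_VCr : forall u, linear (VC u);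
  pr_ang : brace_like ang;
  pr_ind : forall P : M -> Prop,
    P 0 -> (forall k x y, P x -> P y -> P (k *: x + y)) ->
    (forall d x a, x \in spd d -> a \in std d -> P (gen d x a)) ->
    (forall u c, P (VC u c)) -> (forall b b', P (ang b b')) ->
    forall z, P z;
  pr_gen : forall d d' x y a a', x \in spd d -> y \in spd d' ->
      a \in std d -> a' \in std d' ->
    br (gen d x a) (gen d' y a') =
      gen (d (+) d') (mcomm x y) (half *: acomm a a')
      + gen (~~ (d (+) d')) (mcirc I0 x y) (half *: comm a a')
      + ((d == d')%:R * tr (x \o y)) *: ang (of_alg a) (of_alg a');
  pr_genVC : forall d x a u c, x \in spd d -> a \in std d ->
    br (gen d x a) (VC u c) = VC (x u) (cact a c);
  pr_VCVC : forall u w c c',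
    br (VC u c) (VC w c') =
      gen false (Qf I0 false u w) (cpart false (cform c c'))
      + gen true (Qf I0 true u w) (cpart true (cform c c'))
      + vform u w *: ang (of_mod c) (of_mod c');
  pr_ang_gen : forall b1 b2 d x a, x \in spd d -> a \in std d ->
    br (ang b1 b2) (gen d x a) = - ((4 * ell I0)%:R^-1 *:
      (gen d (mcirc I0 x (idI0 I0)) (comm a (bstar b1 b2))
       + gen (~~ d) (mcomm x (idI0 I0)) (acomm a (bstar b1 b2))
       + (d%:R * (2%:R * tr (x \o idI0 I0))) *:
           ang (of_alg a) (of_alg (bstar b1 b2))));
  pr_ang_VC : forall b1 b2 u c,
    br (ang b1 b2) (VC u c) =
      (2 * ell I0)%:R^-1 *: VC (idI0 I0 u) (cact (bstar b1 b2) c)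
      + VC u (delta b1 b2 c);
  pr_ang_ang : forall b1 b2 b1' b2',
    br (ang b1 b2) (ang b1' b2') =
      ang (bder (ell I0) b1 b2 b1') b2' + ang b1' (bder (ell I0) b1 b2 b2')
}.
End Presentation.

Section Generators.
Variables (F : fieldType) (I : choiceType) (I0 : {fset I}) (q : BCquadruple F).
Hypothesis F0 : [pchar F] =i pred0.
Hypothesis ell_gt0 : (0 < ell I0)%N.
Variable K : submodClosed (braces q).
Local Notation alg := (calg q).
Local Notation V := (vsp F I).
Local Notation L := (lieL I K).
Local Notation star := (@cstar F q).
Local Notation act := (@cact F q).
Local Notation f := (@cform F q).
Local Notation half := (2%:R^-1 : F).
Implicit Types (d : bool) (u w : V).

Local Notation TG := (tensor (submod (@spG F I)) (submod (@star_fixed F q))).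
Local Notation TS := (tensor (submod (@spS F I)) (submod (@star_skew F q))).
Local Notation TV := (tensor (vsp F I) (cmod q)).

Definition in1 (x : TG) : L := (x, 0, 0, 0).
Definition in2 (x : TS) : L := (0, x, 0, 0).
Definition in3 (x : TV) : L := (0, 0, x, 0).
Definition in4 (x : quotm K) : L := (0, 0, 0, x).

Lemma in1_lin : linear in1.
Proof.
move=> k x y; rewrite -[RHS]/(k *: x + y, k *: 0 + 0, k *: 0 + 0, k *: 0 + 0).
by rewrite !scaler0 !addr0.
Qed.

Lemma in2_lin : linear in2.
Proof.
move=> k x y; rewrite -[RHS]/(k *: 0 + 0, k *: x + y, k *: 0 + 0, k *: 0 + 0).
by rewrite !scaler0 !addr0.
Qed.

Lemma in3_lin : linear in3.
Proof.
move=> k x y; rewrite -[RHS]/(k *: 0 + 0, k *: 0 + 0, k *: x + y, k *: 0 + 0).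
by rewrite !scaler0 !addr0.
Qed.

Lemma in4_lin : linear in4.
Proof.
move=> k x y; rewrite -[RHS]/(k *: 0 + 0, k *: 0 + 0, k *: 0 + 0, k *: x + y).
by rewrite !scaler0 !addr0.
Qed.

Lemma in_sum x s (w : TV) z : (x, s, w, z) = in1 x + (in2 s + (in3 w + in4 z)).
Proof.
rewrite -[RHS]/(x + (0 + (0 + 0)), 0 + (s + (0 + 0)), 0 + (0 + (w + 0)),
  0 + (0 + (0 + z))).
by rewrite !(add0r, addr0).
Qed.

Lemma tosub_lin (U : lmodType F) (S : submodClosed U) k x y :
  x \in S -> y \in S -> tosub S (k *: x + y) = k *: tosub S x + tosub S y.
Proof.
move=> xS yS; apply: val_inj; rewrite tosubK ?rpredD ?rpredZ //.
by rewrite linearP /= !tosubK.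
Qed.

Lemma tosub_val (U : lmodType F) (S : submodClosed U) (z : submod S) :
  tosub S (val z) = z.
Proof. by apply: val_inj; rewrite tosubK //; apply: valP. Qed.

Definition gen d (x : V -> V) (a : alg) : L := if d then inSB K x a else inGA K x a.

Arguments gen : simpl never.

Lemma gen_linl d k x y a : x \in spd d -> y \in spd d ->
  gen d (k *: x + y) a = k *: gen d x a + gen d y a.
Proof.
case: d => xd yd; rewrite /gen ?/inSB ?/inGA tosub_lin // tens_linearl.
  exact: in2_lin.
exact: in1_lin.
Qed.

Lemma gen_linr d x k a b : a \in std d -> b \in std d ->
  gen d x (k *: a + b) = k *: gen d x a + gen d x b.
Proof.
case: d => ad bd; rewrite /gen ?/inSB ?/inGA tosub_lin // tens_linearr.
  exact: in2_lin.
exact: in1_lin.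
Qed.

Lemma inVC_linl c : linear (fun u : V => inVC K u c).
Proof. by move=> k u w; rewrite /inVC tens_linearl; apply: in3_lin. Qed.

Lemma inVC_linr u : linear (inVC K u).
Proof. by move=> k c c'; rewrite /inVC tens_linearr; apply: in3_lin. Qed.

Lemma angle_brace_like : brace_like (@angle F I q K).
Proof.
pose j (z : braces q) : L := in4 (qproj K z).
have jl : linear j by move=> k x y; rewrite /j linearP; apply: in4_lin.
have bP := brace_brace_like q.
have e x y : angle I K x y = j (brace x y) by [].
split=> *; rewrite ?e -?(linN jl) -?(linD jl).
- by move=> k u w; rewrite !e (bl_linl bP) jl.
- by move=> k u w; rewrite !e (bl_linr bP) jl.
- by rewrite (bl_am bP) (lin0 jl).
- by rewrite (bl_ma bP) (lin0 jl).
- by rewrite (bl_ss bP) // (lin0 jl).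
- by rewrite (bl_anti bP).
- by rewrite (bl_sym bP).
- by rewrite (bl_cyc bP) (lin0 jl).
- by rewrite (bl_form bP).
Qed.

(** The predicate lives on the target of j, so that one predicate on ℒ serves all its summands. *)
Lemma tensor_ind (U W M : lmodType F) (P : M -> Prop) (j : tensor U W -> M) :
  P 0 -> (forall k x y, P x -> P y -> P (k *: x + y)) -> linear j ->
  (forall (a : U) (b : W), P (j (a ⊗ b))) -> forall t, P (j t).
Proof.
move=> P0 Plin jl Pj t; elim/qprojW: t => t; rewrite -(freeg_sumE t) linear_sum (lin_sum jl).
elim: (dom t) => [|[u w'] s IH]; rewrite ?big_nil // big_cons.
rewrite (_ : << _ *g _ >> = coeff (u, w') t *: << (u, w') >>).
  by rewrite linearZ (linZ jl); apply: Plin => //; apply: Pj.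
by apply/eqP/freeg_eqP => k; rewrite coeffZ !coeffU mul1r.
Qed.

Lemma lieL_ind (P : L -> Prop) :
  P 0 -> (forall k x y, P x -> P y -> P (k *: x + y)) ->
  (forall d x a, x \in spd d -> a \in std d -> P (gen d x a)) ->
  (forall u c, P (inVC K u c)) -> (forall b b', P (angle I K b b')) ->
  forall z, P z.
Proof.
move=> P0 Plin Pg PV Pa [[[x s] w] z].
have PD (a b : L) : P a -> P b -> P (a + b) by rewrite -{2}[a]scale1r; apply: Plin.
have S1 : P (in1 x).
  apply: (tensor_ind (j := in1)) P0 Plin in1_lin _ x => u a.
  by have := Pg false (val u) (val a) (valP u) (valP a); rewrite /gen /inGA !tosub_val.
have S2 : P (in2 s).
  apply: (tensor_ind (j := in2)) P0 Plin in2_lin _ s => u a.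
  by have := Pg true (val u) (val a) (valP u) (valP a); rewrite /gen /inSB !tosub_val.
have S3 : P (in3 w).
  by apply: (tensor_ind (j := in3)) P0 Plin in3_lin _ w => u a; apply: PV.
have S4 : P (in4 z).
  elim/qprojW: z => z; elim/qprojW: z => z.
  apply: (tensor_ind (j := fun z => in4 (qproj K (qproj _ z)))) P0 Plin _ _ z => [k u v|u a].
    by rewrite !linearP; apply: in4_lin.
  exact: Pa.
by rewrite in_sum; apply: (PD _ _ S1 (PD _ _ S2 (PD _ _ S3 S4))).
Qed.

Let gen0l d a : gen d 0 a = 0.
Proof.
have := @gen_linl d (-1) 0 0 a (spd0 _ _ _) (spd0 _ _ _).
by rewrite !scaleN1r !addNr.
Qed.

Let genNl d x a : x \in spd d -> gen d (- x) a = - gen d x a.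
Proof.
by move=> xd; rewrite -scaleN1r -[-1 *: x]addr0 gen_linl ?spd0 // gen0l addr0 scaleN1r.
Qed.

Let gen0r d x : gen d x 0 = 0.
Proof.
have := @gen_linr d x (-1) 0 0 (std0 _ _) (std0 _ _).
by rewrite !scaleN1r !addNr.
Qed.

Let genZr d x k a : a \in std d -> gen d x (k *: a) = k *: gen d x a.
Proof. by move=> ad; rewrite -[k *: a]addr0 gen_linr ?std0 // gen0r addr0. Qed.

Section Bracket.
Variable br : L -> L -> L.
Hypothesis brP : lieL_bracket I0 br.

Let brl y : linear (br^~ y). Proof. by have [h _ _ _] := lieL_lie brP. Qed.
Let brr x : linear (br x). Proof. by have [_ h _ _] := lieL_lie brP. Qed.

Let br_anti x y : br x y = - br y x.
Proof.
have [_ _ alt _] := lieL_lie brP.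
have := alt (x + y); rewrite (linD (brl _)) !(linD (brr _)) !alt add0r addr0.
by move/eqP; rewrite addr_eq0 => /eqP.
Qed.

Lemma br_gen d d' (x y : V -> V) a a' : x \in spd d -> y \in spd d' ->
    a \in std d -> a' \in std d' ->
  br (gen d x a) (gen d' y a') =
    gen (d (+) d') (mcomm x y) (half *: acomm a a')
    + gen (~~ (d (+) d')) (mcirc I0 x y) (half *: comm a a')
    + ((d == d')%:R * tr (x \o y)) *: angle I K (of_alg a) (of_alg a').
Proof.
move=> xd yd ad ad'; have xg := spd_gl xd; have yg := spd_gl yd.
case: d d' xd yd ad ad' => [] [] xd yd ad ad' /=; rewrite ?mul1r ?mul0r ?scale0r ?addr0.
- exact: (lieL_SB_SB brP).
(* This order is not among the given formulas; under exchange [mcomm] and [comm] change sign while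
   [mcirc] and [acomm] do not. *)
- rewrite br_anti (lieL_GA_SB brP) // opprD addrC.
  rewrite (mcomm_anti x) (mcirc_sym I0 xg yg). rewrite genNl ?mcomm_spGS //.
  have -> : acomm a' a = acomm a a' by rewrite /acomm addrC.
  congr (- _ + _); have -> : comm a a' = - 1 *: comm a' a by rewrite scaleN1r /comm opprB.
  rewrite scalerA mulrC -scalerA genZr ?scaleN1r //.
  by apply: half_std; apply: (comm_fixed_skew ad' ad).
- by rewrite (lieL_GA_SB brP) // addrC.
- exact: (lieL_GA_GA brP).
Qed.

Lemma br_genVC d x a u c : x \in spd d -> a \in std d ->
  br (gen d x a) (inVC K u c) = inVC K (x u) (act a c).
Proof. by case: d => xd ad; [apply: (lieL_SB_VC brP)|apply: (lieL_GA_VC brP)]. Qed.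

Lemma lieL_presented : presented I0 br gen (inVC K) (angle I K).
Proof.
split.
- exact: lieL_lie brP.
- by move=> *; apply: gen_linl.
- by move=> *; apply: gen_linr.
- exact: inVC_linl.
- exact: inVC_linr.
- exact: angle_brace_like.
- exact: lieL_ind.
- exact: br_gen.
- exact: br_genVC.
- move=> u w c c'; rewrite (lieL_VC_VC brP) QfF.
  rewrite (_ : Qf I0 true u w = vcomm I0 u w); last by rewrite /Qf -lock.
  by rewrite /cpart expr0 expr1 scale1r scaleN1r cform_skew opprK.
- move=> b1 b2 d x a; case: d => xd ad.
    apply: (etrans (lieL_angle_SB brP b1 b2 xd ad)); rewrite mul1r.
    congr (- (_ *: (_ + _))); exact: addrC.
  apply: (etrans (lieL_angle_GA brP b1 b2 xd ad)); rewrite mul0r scale0r.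
  congr (- (_ *: _)); exact: esym (addr0 _).
- move=> b1 b2 u c; apply: (etrans (lieL_angle_VC brP b1 b2 u c)); rewrite /delta.
  have e := linN (inVC_linr u) (half *: (act (f c b2.2) b1.2 + act (f c b1.2) b2.2)).
  rewrite e; congr (_ - _); apply: esym; exact: (linZ (inVC_linr u)).
exact: (lieL_angle_angle brP).
Qed.
End Bracket.
End Generators.
Arguments gen : simpl never.

(** * Brackets of elementary elements *)

Section Presented.
Variables (F : fieldType) (I : choiceType) (I0 : {fset I}) (q : BCquadruple F).
Hypothesis F0 : [pchar F] =i pred0.
Hypothesis ell_gt0 : (0 < ell I0)%N.
Local Notation alg := (calg q).
Local Notation V := (vsp F I).
Local Notation star := (@cstar F q).
Local Notation act := (@cact F q).
Local Notation f := (@cform F q).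
Local Notation half := (2%:R^-1 : F).
Local Notation Q := (@Qf F I I0).
Variables (L : lmodType F) (br : L -> L -> L) (gen : bool -> (V -> V) -> alg -> L)
  (VC : V -> cmod q -> L) (ang : bb q -> bb q -> L).
Hypothesis brP : presented I0 br gen VC ang.
Implicit Types (d : bool) (u w : V).

Let aP := pr_ang brP.
Let brl y : linear (br^~ y). Proof. by have [h _ _ _] := pr_lie brP. Qed.
Let brr x : linear (br x). Proof. by have [_ h _ _] := pr_lie brP. Qed.

Lemma gen0l d a : gen d 0 a = 0.
Proof.
have := pr_genl brP (d := d) (-1) a (spd0 _ _ _) (spd0 _ _ _).
by rewrite !scaleN1r !addNr.
Qed.

Lemma genDl d x y a : x \in spd d -> y \in spd d -> gen d (x + y) a = gen d x a + gen d y a.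
Proof. by move=> xd yd; have := pr_genl brP 1 a xd yd; rewrite !scale1r. Qed.

Lemma genZl d k x a : x \in spd d -> gen d (k *: x) a = k *: gen d x a.
Proof. by move=> xd; rewrite -[k *: x]addr0 (pr_genl brP) ?spd0 // gen0l addr0. Qed.

Lemma genNl d x a : x \in spd d -> gen d (- x) a = - gen d x a.
Proof. by move=> xd; rewrite -!scaleN1r genZl. Qed.

Lemma gen0r d x : gen d x 0 = 0.
Proof.
have := pr_genr brP (d := d) x (-1) (std0 _ _) (std0 _ _).
by rewrite !scaleN1r !addNr.
Qed.

Lemma genZr d x k a : a \in std d -> gen d x (k *: a) = k *: gen d x a.
Proof. by move=> ad; rewrite -[k *: a]addr0 (pr_genr brP) ?std0 // gen0r addr0. Qed.

Lemma gen_omega d t B a : (forall u w, B u w \in spd d) ->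
  gen d (omega t B) a = omega t (fun u w => gen d (B u w) a).
Proof.
move=> Bd; rewrite /omega; elim: t => [|i t IH]; first by rewrite !big_nil gen0l.
have s1 i' : B (bv F (inl i')) (bv F (inr i')) - B (bv F (inr i')) (bv F (inl i')) \in spd d.
  by rewrite -scaleN1r; apply: spdD => //; apply: spdZ.
have s2 : \sum_(i' <- t) (B (bv F (inl i')) (bv F (inr i')) - B (bv F (inr i')) (bv F (inl i'))) \in spd d.
  elim: (t) => [|i' t' IH']; first by rewrite big_nil spd0.
  by rewrite big_cons; apply: spdD.
rewrite !big_cons genDl // IH; congr (_ + _).
by rewrite -scaleN1r addrC (pr_genl brP) // scaleN1r addrC.
Qed.

(** The analogue of an elementary matrix with entry α in 𝔞, assembled from its 𝒢 ⊗ 𝒜 and 𝒮 ⊗ ℬ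
    parts. Exchanging u and w applies [star] to the entry. *)
Definition genQ u w (al : alg) : L :=
  gen false (Q false u w) (cpart false al) + gen true (Q true u w) (cpart true al).

Lemma genQ_linr u w : linear (genQ u w).
Proof.
move=> k a b; rewrite /genQ !cpart_lin !(pr_genr brP) ?cpart_std //.
by lmod F L; ring.
Qed.

Lemma genQ_swap u w al : genQ w u al = genQ u w (star al).
Proof.
rewrite /genQ !(Qf_swap F0 ell_gt0 _ u w) !genZl ?Qf_spd // -!genZr ?cpart_std //.
congr (gen _ _ _ + gen _ _ _).
  by rewrite scale1r /cpart !scale1r cstarK addrC.
by rewrite /cpart !expr1 !scaleN1r cstarK -scalerN opprB.
Qed.

Lemma genQ_gen d u w al : al \in std d ->
  genQ u w al = gen d (Q d u w) al.
Proof.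
rewrite /genQ => ad; have e := cpart_id F0 ad.
have e' : cpart (~~ d) al = 0 by rewrite cpart_other // negbK.
by case: d {ad} e e' => -> ->; rewrite gen0r ?add0r ?addr0.
Qed.

Lemma pr_ext (W : lmodType F) (f1 f2 : L -> W) : linear f1 -> linear f2 ->
  (forall d x a, x \in spd d -> a \in std d -> f1 (gen d x a) = f2 (gen d x a)) ->
  (forall u c, f1 (VC u c) = f2 (VC u c)) ->
  (forall b b', f1 (ang b b') = f2 (ang b b')) -> f1 =1 f2.
Proof.
move=> l1 l2 eg eV ea.
apply: (pr_ind brP (P := fun z => f1 z = f2 z) _ _ eg eV ea) => [|k x y ex ey].
  by rewrite (lin0 l1) (lin0 l2).
by rewrite l1 l2 ex ey.
Qed.

Lemma br_anti x y : br x y = - br y x.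
Proof.
have [_ _ alt _] := pr_lie brP.
have := alt (x + y); rewrite (linD (brl _)) !(linD (brr _)) !alt add0r addr0.
by move/eqP; rewrite addr_eq0 => /eqP.
Qed.

Lemma br_jac x y z : br x (br y z) = br (br x y) z + br y (br x z).
Proof.
have [_ _ _ jac] := pr_lie brP.
have := jac x y z; rewrite [br (br y z) x]br_anti [br (br z x) y]br_anti.
rewrite [br z x]br_anti (linN (brr _)) opprK => e.
by apply/eqP; rewrite eq_sym -subr_eq0 addrAC e.
Qed.

Lemma br_VCVC u w c c' :
  br (VC u c) (VC w c') =
  genQ u w (f c c') + vform u w *: ang (of_mod c) (of_mod c').
Proof. exact: (pr_VCVC brP). Qed.

(** Commutators with 1 and ⟨1, a⟩ vanish, so 𝒢 ⊗ 1 acts on the matrix factor alone. *)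
Lemma br_Ggen x d y a : x \in @spG F I -> y \in spd d -> a \in std d ->
  br (gen false x 1) (gen d y a) = gen d (mcomm x y) a.
Proof.
move=> xG yd ad; rewrite (pr_gen brP) //; last exact: std1.
rewrite /acomm /comm mulr1 mul1r subrr scaler0 gen0r half2 // addr0.
by rewrite (bl_1l aP) scaler0 addr0.
Qed.

Lemma br_GVC x u c : x \in @spG F I ->
  br (gen false x 1) (VC u c) = VC (x u) c.
Proof. by move=> xG; rewrite (pr_genVC brP (d := false)) ?cact1 //; apply: std1. Qed.

Lemma br_GQ x d u w a : x \in @spG F I -> vform u w = 0 -> a \in std d ->
  br (gen false x 1) (gen d (Q d u w) a) = gen d (Q d (x u) w) a + gen d (Q d u (x w)) a.
Proof.
by move=> xG uw ad; rewrite br_Ggen ?Qf_spd // mcomm_Qf // genDl ?Qf_spd.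
Qed.

(** [mcomm] and [mcirc] have the same four contractions, with parities matching the two [cpart]s of
    [a * a']; the matrix and coordinate formulas thus fuse into elements [genQ]. *)
Lemma br_Qgen d d' u w u' w' a a' : vform u w = 0 -> vform u' w' = 0 ->
    a \in std d -> a' \in std d' ->
  br (gen d (Q d u w) a) (gen d' (Q d' u' w') a') = half *: (
    vform w u' *: genQ u w' (a * a')
    + (-1) ^+ d' *: (vform w w' *: genQ u u' (a * a'))
    + (-1) ^+ d *: (vform u u' *: genQ w w' (a * a'))
    + (-1) ^+ (d (+) d') *: (vform u w' *: genQ w u' (a * a')))
  - ((d == d')%:R * half * (vform w u' * vform u w' + (-1) ^+ d * (vform w w' * vform u u')))
      *: ang (of_alg a) (of_alg a').
Proof.
move=> uw uw' ad ad'; rewrite (pr_gen brP) ?Qf_spd // tr_QfQf // mcomm_QfQf // mcirc_QfQf //.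
have e1 : half *: acomm a a' = cpart (d (+) d') (a * a').
  rewrite /cpart cstarM (star_std ad) (star_std ad') -!scalerAl -!scalerAr /acomm.
  case: d {uw uw' ad}; case: d' {ad'}; rewrite /= ?expr0 ?expr1;
    by lmod F (calg q); ring.
have e2 : half *: comm a a' = cpart (~~ (d (+) d')) (a * a').
  rewrite /cpart cstarM (star_std ad) (star_std ad') -!scalerAl -!scalerAr /comm.
  case: d {uw uw' ad e1}; case: d' {ad'}; rewrite /= ?expr0 ?expr1;
    by lmod F (calg q); ring.
rewrite e1 e2.
rewrite !(genZl, genDl); do ?by rewrite ?(spdZ, spdD, Qf_spd).
have YE e u1 u2 al : genQ u1 u2 al =
    gen e (Q e u1 u2) (cpart e al) + gen (~~ e) (Q (~~ e) u1 u2) (cpart (~~ e) al).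
  by case: e; rewrite /genQ //= addrC.
rewrite !(YE (d (+) d')); lmod F L.
all: by case: (d) (d') => [] []; rewrite /= ?expr0 ?expr1; ring.
Qed.

(** Expanding α and α' into 𝒜- and ℬ-parts, the signs of [br_Qgen] assemble into [star]: a
    coordinate is starred when the two slots of its factor have to be exchanged for the
    contraction. *)
Lemma br_YY u w u' w' al al' : vform u w = 0 -> vform u' w' = 0 ->
  br (genQ u w al) (genQ u' w' al') = half *: (
    vform w u' *: genQ u w' (al * al') + vform w w' *: genQ u u' (al * star al')
    + vform u u' *: genQ w w' (star al * al') + vform u w' *: genQ w u' (star al * star al'))
  - half *: ((vform w u' * vform u w') *: ang (of_alg al) (of_alg al') +
     (vform w w' * vform u u') *: ang (of_alg al) (of_alg (star al'))).
Proof.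
move=> uw uw'; have := cpart_diff F0 al; have := cpart_diff F0 al'.
have := cpart_sum F0 al; have := cpart_sum F0 al'; rewrite {1 2}/genQ.
have := cpart_std false al; have := cpart_std true al.
have := cpart_std false al'; have := cpart_std true al'.
move: (cpart false al) (cpart true al) (cpart false al') (cpart true al').
move=> a b a' b' Bb' Aa' Bb Aa <- <- <- <-.
rewrite !(linD (brl _)) !(linD (brr _)) !br_Qgen //.
rewrite !(linB (bl_algr aP _)) !(linD (bl_algl aP _)) !(linD (bl_algr aP _)).
rewrite (bl_ss aP Aa Bb') (bl_anti aP b) (bl_ss aP Aa' Bb).
rewrite !(mulrDl, mulrDr) !(mulrN, mulNr).
rewrite !(linD (genQ_linr _ _), linB (genQ_linr _ _), linN (genQ_linr _ _)) /=.
by rewrite ?expr0 ?expr1; lmod F L; ring.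
Qed.

End Presented.

(** * Linear maps out of ℒ(𝔮, 𝒦) *)

Section Lifts.
Variable F : fieldType.

Lemma fglift_lin (T : choiceType) (M : lmodType F) (f : T -> M) : linear (fglift f).
Proof.
have addf : {morph fglift f : x y / x - y} := lift_is_additive f.
have f0 : fglift f 0 = 0 by have := addf 0 0; rewrite !subrr.
have fD : {morph fglift f : x y / x + y}.
  by move=> x y; rewrite -[y in LHS]opprK addf -[- y]sub0r addf f0 sub0r opprK.
have fsum (s : seq T) (g : T -> {freeg T / F}) :
    fglift f (\sum_(x <- s) g x) = \sum_(x <- s) fglift f (g x).
  by elim: s => [|x s IH]; rewrite ?big_nil // !big_cons fD IH.
move=> k x y; rewrite fD; congr (_ + _).
rewrite -[in RHS](freeg_sumE x) -[k *: x]/(\sum_(z <- dom x) << k * coeff z x *g z >>).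
rewrite !fsum scaler_sumr; apply: eq_bigr => z _.
by rewrite !liftU scalerA.
Qed.

Lemma fglift1 (T : choiceType) (M : lmodType F) (f : T -> M) x : fglift f << x >> = f x.
Proof. by rewrite liftU scale1r. Qed.

Lemma quotm_lift (U M : lmodType F) (S : submodClosed U) (f : U -> M) :
  linear f -> (forall x, x \in S -> f x = 0) ->
  exists g : quotm S -> M, linear g /\ forall x, g (qproj S x) = f x.
Proof.
move=> lf fS; exists (fun z => f (repr z)).
have e x : f (repr (qproj S x)) = f x.
  apply/eqP; rewrite -subr_eq0 -(linB lf) fS //; apply/qprojP.
  by rewrite /qproj reprK.
split=> // k x y; elim/qprojW: x => x; elim/qprojW: y => y.
by rewrite -linearP !e lf.
Qed.

Lemma lspan_ker (U M : lmodType F) (X : set U) (f : U -> M) :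
  linear f -> (forall x, X x -> f x = 0) -> forall x, x \in lspan X -> f x = 0.
Proof.
move=> lf fX x /asboolP[s [sX ->]]; rewrite (lin_sum lf) big_seq big1 // => p ps.
by rewrite (linZ lf) fX ?scaler0 //; apply: sX.
Qed.

Lemma tensor_lift (U W M : lmodType F) (B : U -> W -> M) :
  (forall w, linear (B^~ w)) -> (forall u, linear (B u)) ->
  exists g : tensor U W -> M, linear g /\ forall u w, g (u ⊗ w) = B u w.
Proof.
move=> Bl Br; pose f := fglift (fun p : U * W => B p.1 p.2).
have lf : linear f := fglift_lin _.
have f1 u w : f << (u, w) >> = B u w by rewrite /f fglift1.
have [] := @quotm_lift _ M (lspan (@tensor_rel F U W)) f lf.
  apply: lspan_ker => // _ [u u' w|u w w'|k u w|k u w];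
    rewrite !(linB lf) ?(linZ lf) !f1 ?(linD (Bl _)) ?(linD (Br _)) ?(linZ (Bl _)) ?(linZ (Br _)).
  - by rewrite addrAC addrK subrr.
  - by rewrite addrAC addrK subrr.
  - by rewrite subrr.
  - by rewrite subrr.
by move=> g [lg ge]; exists g; split=> // u w; rewrite /tens ge f1.
Qed.

Lemma brace_lift (q : BCquadruple F) (M : lmodType F) (kap : bb q -> bb q -> M) :
  brace_like kap ->
  exists g : braces q -> M, linear g /\ forall x y, g (brace x y) = kap x y.
Proof.
move=> kP; have [f [lf fe]] := tensor_lift (bl_linl kP) (bl_linr kP).
have [] := @quotm_lift _ M (lspan (@brace_rel F q)) f lf.
  apply: lspan_ker => // _ [x c|x c|a b aA bB|x y|c c'|x y z|x c c'];
    rewrite ?(linB lf) ?(linD lf) !fe.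
  - exact: (bl_am kP).
  - exact: (bl_ma kP).
  - exact: (bl_ss kP).
  - by rewrite (bl_anti kP) addNr.
  - by rewrite (bl_sym kP) subrr.
  - exact: (bl_cyc kP).
  - by rewrite (bl_form kP) subrr.
by move=> g [lg ge]; exists g; split=> // x y; rewrite /brace ge fe.
Qed.
End Lifts.

(** The universal property from which θ is built. T is given on arbitrary functions and coordinates,
    so its linearity is required on members of [spd d] and [std d] only. *)
Lemma lieL_lift (F : fieldType) (I : choiceType) (q : BCquadruple F)
    (K : submodClosed (braces q)) (E : lmodType F)
    (T : bool -> (vsp F I -> vsp F I) -> calg q -> E) (TV : vsp F I -> cmod q -> E) :
  (forall d a c x y, a \in std d -> x \in spd d -> y \in spd d ->
    T d (c *: x + y) a = c *: T d x a + T d y a) ->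
  (forall d x c a b, x \in spd d -> a \in std d -> b \in std d ->
    T d x (c *: a + b) = c *: T d x a + T d x b) ->
  (forall c, linear (TV^~ c)) -> (forall u, linear (TV u)) ->
  exists theta : lieL I K -> E, [/\ linear theta,
    forall d x a, x \in spd d -> a \in std d -> theta (gen K d x a) = T d x a,
    forall u c, theta (inVC K u c) = TV u c & forall b b', theta (angle I K b b') = 0].
Proof.
move=> Tl Tr TVl TVr; pose V := vsp F I.
have lift d (S : submodClosed (V -> V)) (R : submodClosed (calg q)) :
    S =i spd d -> R =i std d ->
    exists f : tensor (submod S) (submod R) -> E, linear f /\
      forall x a, f (x ⊗ a) = T d (val x) (val a).
  move=> eS eR.
  have [||f [lf fe]] := @tensor_lift F (submod S) (submod R) E (fun x a => T d (val x) (val a)).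
  - by move=> a k x y; rewrite linearP /=; apply: Tl; rewrite -?eS -?eR; exact: valP.
  - by move=> x k a b; rewrite linearP /=; apply: Tr; rewrite -?eS -?eR; exact: valP.
  by exists f.
have [f1 [lf1 f1e]] := lift false (@spG F I) (@star_fixed F q) (fun _ => erefl) (fun _ => erefl).
have [f2 [lf2 f2e]] := lift true (@spS F I) (@star_skew F q) (fun _ => erefl) (fun _ => erefl).
have [f3 [lf3 f3e]] := tensor_lift TVl TVr.
pose theta (z : lieL I K) := f1 z.1.1.1 + f2 z.1.1.2 + f3 z.1.2.
exists theta; split.
- move=> k x y; rewrite /theta.
  rewrite -[(k *: x + y).1.1.1]/(k *: x.1.1.1 + y.1.1.1).
  rewrite -[(k *: x + y).1.1.2]/(k *: x.1.1.2 + y.1.1.2).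
  rewrite -[(k *: x + y).1.2]/(k *: x.1.2 + y.1.2).
  by rewrite lf1 lf2 lf3; lmod F E; ring.
- move=> d x a; case: d => xd ad; rewrite /theta /gen /= ?(lin0 lf1) ?(lin0 lf2) (lin0 lf3).
    by rewrite f2e !tosubK // add0r addr0.
  by rewrite f1e !tosubK // !addr0.
- by move=> u c; rewrite /theta /= (lin0 lf1) (lin0 lf2) f3e !add0r.
by move=> b b'; rewrite /theta /= (lin0 lf1) (lin0 lf2) (lin0 lf3) !addr0.
Qed.

(** * Making a cocycle vanish on 𝒢 ⊗ 1 *)

Section Theta.
Variables (F : fieldType) (I : choiceType) (I0 : {fset I}) (q : BCquadruple F).
Hypothesis F0 : [pchar F] =i pred0.
Hypothesis ell_gt0 : (0 < ell I0)%N.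
Hypothesis Iinf : infinite_set [set: I].
Local Notation alg := (calg q).
Local Notation V := (vsp F I).
Local Notation half := (2%:R^-1 : F).
Local Notation Q := (@Qf F I I0).
Variables (L : lmodType F) (br : L -> L -> L) (gen : bool -> (V -> V) -> alg -> L)
  (VC : V -> cmod q -> L) (ang : bb q -> bb q -> L).
Hypothesis brP : presented I0 br gen VC ang.
Implicit Types (d : bool) (u w : V).

Let brl y : linear (br^~ y). Proof. by have [h _ _ _] := pr_lie brP. Qed.
Let brr x : linear (br x). Proof. by have [_ h _ _] := pr_lie brP. Qed.
Let gen0l d a : gen d 0 a = 0. Proof. exact: (gen0l brP). Qed.

Definition vk (k : I) : V := bv F (inl k).
Definition vk' (k : I) : V := bv F (inr k).

Lemma vform_vk k : vform (vk k) (vk' k) = 2%:R.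
Proof. by rewrite vform_bv /= eqxx. Qed.

Lemma vform_vk' k : vform (vk' k) (vk k) = - 2%:R.
Proof. by rewrite vform_skew vform_vk. Qed.

(* For an index k outside the support of u, this maps v_k to - u. *)
Definition genP k u : L := gen false (vcirc u (vk' k)) 1.

Lemma genPE k u : genP k u = gen false (Q false u (vk' k)) 1.
Proof. by rewrite QfF. Qed.

Lemma genP_lin k : linear (genP k).
Proof.
by move=> c u w; rewrite !genPE Qf_linl // (pr_genl brP) // Qf_spd.
Qed.

Lemma vcirc_vk k u : vform u (vk k) = 0 -> vcirc u (vk' k) (vk k) = - u.
Proof.
move=> uk; rewrite /vcirc uk vform_vk' scale0r addr0 scalerA mulrN mulVf ?F2 //.
by rewrite scaleN1r.
Qed.

Lemma vcirc_w k u w : vform (vk' k) w = 0 ->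
  vcirc u (vk' k) w = (half * vform u w) *: vk' k.
Proof. by move=> kw; rewrite /vcirc kw scale0r add0r scalerA. Qed.

Lemma msupp_Qf t d u w : vform u w = 0 -> vsupp t u -> vsupp t w -> msupp t (Q d u w).
Proof.
move=> uw tu tw; split=> [j jt|z]; rewrite QfE //.
  rewrite (vsupp_vform tu jt) (vsupp_vform tw jt) !scale0r scaler0 addr0.
  by rewrite scaler0.
rewrite -[half *: _]addr0; apply: vsupp_lin; last exact: vsupp0.
have := vsupp_lin (vform w z) tu (vsupp_lin ((-1) ^+ d * vform u z) tw (@vsupp0 F I t)).
by rewrite addr0 scalerA.
Qed.

Section Fresh.
Variables (t : seq I) (k : I).
Hypothesis kt : k \notin t.

Lemma fresh_r u : vsupp t u -> vform u (vk k) = 0 /\ vform u (vk' k) = 0.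
Proof. by move=> tu; split; apply: vsupp_vform tu _. Qed.

Lemma fresh_l u : vsupp t u -> vform (vk k) u = 0 /\ vform (vk' k) u = 0.
Proof. by move=> tu; split; apply: vsupp_vforml tu _. Qed.

Lemma br_PQ d u w a : vsupp t u -> vsupp t w -> a \in std d ->
  br (genP k u) (gen d (Q d (vk k) w) a) =
  - gen d (Q d u w) a + (half * vform u w) *: gen d (Q d (vk k) (vk' k)) a.
Proof.
move=> tu tw ad; rewrite (br_GQ F0 ell_gt0 brP) ?vcirc_spG //; last by case: (fresh_l tw).
rewrite vcirc_vk; last by case: (fresh_r tu).
rewrite vcirc_w; last by case: (fresh_l tw).
have lr v : linear (Q d v) by move=> c z z'; rewrite Qf_linr.
have ll v : linear (fun z => Q d z v) by move=> c z z'; rewrite Qf_linl.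
by rewrite (linN (ll _)) (linZ (lr _)) (genNl brP) ?Qf_spd // (genZl brP) ?Qf_spd.
Qed.

(** Besides [- gen d (Q d (x u) w) a], each bracket contributes a multiple of one fixed element with
    coefficient (x u, w)/2; these sum to a multiple of the trace of x, which is 0, and [spd_decomp]
    applies. *)
Lemma gen_fresh d x a : x \in spd d -> uniq t -> msupp t x -> a \in std d ->
  gen d x a = half *: omega t (fun u w => br (genP k (x u)) (gen d (Q d (vk k) w) a)).
Proof.
move=> xd ut tx ad; have [e e0] := spd_decomp I0 F0 xd ut tx.
rewrite [in LHS]e (genZl brP); last by apply: spd_omega => j _; apply: Qf_spd.
rewrite (gen_omega brP); last by move=> u w; apply: Qf_spd.
rewrite [in RHS](eq_omega (B' := fun u w => - gen d (Q d (x u) w) a +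
    (half * vform (x u) w) *: gen d (Q d (vk k) (vk' k)) a)); last first.
  move=> j jt; apply: br_PQ => //; first by case: tx.
  by apply: vsupp_bv; rewrite idx_bar.
rewrite omegaD omegaN.
have lf : linear (fun c : F^o => (half * c) *: gen d (Q d (vk k) (vk' k)) a).
  by move=> c c1 c2; rewrite scalerA -scalerDl mulrDr mulrCA.
rewrite -(lin_omega _ _ lf) e0 mulr0 scale0r addr0.
by rewrite scalerN scaleNr.
Qed.

Lemma VC_fresh u c : vsupp t u -> VC u c = - br (genP k u) (VC (vk k) c).
Proof.
move=> tu; rewrite (br_GVC brP) ?vcirc_spG // vcirc_vk; last by case: (fresh_r tu).
by rewrite (linN (pr_VCl brP c)) opprK.
Qed.
End Fresh.

Variables (E : lmodType F) (tau : L -> L -> E).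
Hypothesis tauP : cocycle2 br tau.

Let taul y : linear (tau^~ y). Proof. by case: tauP. Qed.
Let taur x : linear (tau x). Proof. by case: tauP. Qed.

Lemma tau_anti x y : tau x y = - tau y x.
Proof.
have [_ _ alt _] := tauP.
have := alt (x + y); rewrite (linD (taul _)) !(linD (taur _)) !alt add0r addr0.
by move/eqP; rewrite addr_eq0 => /eqP.
Qed.

Lemma tau_jac x y z : tau x (br y z) = tau (br x y) z + tau y (br x z).
Proof.
have [_ _ _ jac] := tauP.
have := jac x y z; rewrite [tau (br y z) x]tau_anti [tau (br z x) y]tau_anti.
rewrite [br z x](br_anti brP) (linN (taur _)) opprK => e.
by apply/eqP; rewrite eq_sym -subr_eq0 addrAC e.
Qed.

(* [gen_fresh] with the bracket replaced by tau. *)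
Definition theta_fresh (t : seq I) k d x (a : alg) : E :=
  half *: omega t (fun u w => tau (genP k (x u)) (gen d (Q d (vk k) w) a)).

Lemma theta_fresh_linl t k d a c (x y : V -> V) :
  theta_fresh t k d (c *: x + y) a = c *: theta_fresh t k d x a + theta_fresh t k d y a.
Proof.
rewrite /theta_fresh scalerA mulrC -scalerA -scalerDr -omegaZD; congr (_ *: _).
apply: eq_omega => j _; rewrite -[(c *: x + y) _]/(c *: x _ + y _).
by rewrite genP_lin taul.
Qed.

Lemma theta_fresh_linr t k d x c a b : a \in std d -> b \in std d ->
  theta_fresh t k d x (c *: a + b) = c *: theta_fresh t k d x a + theta_fresh t k d x b.
Proof.
move=> ad bd.
rewrite /theta_fresh scalerA mulrC -scalerA -scalerDr -omegaZD; congr (_ *: _).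
by apply: eq_omega => j _; rewrite (pr_genr brP) // taur.
Qed.

Lemma theta_fresh_omega t k d a t' (B : V -> V -> V -> V) c :
  theta_fresh t k d (c *: omega t' B) a = c *: omega t' (fun u w => theta_fresh t k d (B u w) a).
Proof.
have l : linear (fun x => theta_fresh t k d x a) by move=> c' x y; apply: theta_fresh_linl.
by rewrite (linZ l) (lin_omega _ _ l).
Qed.

Lemma br_gP t k g u : k \notin t -> g \in @spG F I -> msupp t g -> vsupp t u ->
  br (gen false g 1) (genP k u) = genP k (g u).
Proof.
move=> kt gG [g0 g1] tu; rewrite genPE (br_GQ F0 ell_gt0 brP) //; last exact: std1.
  rewrite [g (vk' k)]g0 // -genPE.
  have lr v : linear (Q false v) by move=> c z z'; rewrite Qf_linr.
  by rewrite (lin0 (lr _)) gen0l addr0.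
by case: (fresh_r kt tu).
Qed.

Lemma br_gQ t k g d w a : k \notin t -> g \in @spG F I -> msupp t g -> vsupp t w ->
  a \in std d ->
  br (gen false g 1) (gen d (Q d (vk k) w) a) = gen d (Q d (vk k) (g w)) a.
Proof.
move=> kt gG [g0 g1] tw ad; rewrite (br_GQ F0 ell_gt0 brP) //.
  rewrite [g (vk k)]g0 //.
  have ll v : linear (fun z => Q d z v) by move=> c z z'; rewrite Qf_linl.
  by rewrite (lin0 (ll _)) gen0l add0r.
by case: (fresh_l kt tw).
Qed.

(** The cocycle identity lets g act on both arguments of each τ. [omega_inv] moves it from w to u
    with a sign, and g (x u) - x (g u) is the commutator applied to u. *)
Lemma theta_fresh_inv t k g d x a : uniq t -> k \notin t -> g \in @spG F I -> msupp t g ->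
  x \in spd d -> msupp t x -> a \in std d ->
  tau (gen false g 1) (gen d x a) = theta_fresh t k d (mcomm g x) a.
Proof.
move=> ut kt gG tg xd tx ad; have lx := spd_linear xd.
rewrite (gen_fresh kt xd ut tx ad) (linZ (taur _)) (lin_omega _ _ (taur _)).
congr (_ *: _); pose B u w := tau (genP k (x u)) (gen d (Q d (vk k) w) a).
transitivity (omega t (fun u w => tau (genP k (g (x u))) (gen d (Q d (vk k) w) a)
   + B u (g w))).
  apply: eq_omega => j jt; have tj : vsupp t (bv F (bar j)).
    by apply: vsupp_bv; rewrite idx_bar.
  have txj : vsupp t (x (bv F j)) by case: tx.
  by rewrite tau_jac (br_gP kt gG tg txj) (br_gQ kt gG tg tj ad).
rewrite omegaD; have -> : omega t (fun u w => B u (g w)) = - omega t (fun u w => B (g u) w).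
  rewrite (omega_inv F0 (B := B)) ?opprK //.
    by move=> w c u u'; rewrite /B lx genP_lin taul.
  by move=> u c w w'; rewrite /B Qf_linr // (pr_genl brP) ?Qf_spd // taur.
rewrite -omegaN -omegaD; apply: eq_omega => j _.
by rewrite /B -(linB (taul _)) -(linB (genP_lin _)).
Qed.

Lemma theta_fresh_widen t t' k d x a : uniq t -> uniq t' -> {subset t <= t'} -> msupp t x ->
  theta_fresh t' k d x a = theta_fresh t k d x a.
Proof.
move=> ut ut' tt' [x0 _]; rewrite /theta_fresh (omega_widen ut ut' tt') // => j jt.
by rewrite x0 // (lin0 (genP_lin _)) (lin0 (taul _)).
Qed.

(** As a matrix, x is a sum of commutators built with the index m. All of them are supported in
    [m :: t], for which k is fresh; by [theta_fresh_inv] the k-value of each commutator is the τ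
    occurring in the m-value of x. *)
Lemma theta_fresh_indep0 t k m d x a : uniq t -> k \notin t -> m \notin t -> k != m ->
  x \in spd d -> msupp t x -> a \in std d -> theta_fresh t k d x a = theta_fresh t m d x a.
Proof.
move=> ut kt mt km xd tx ad; have [e e0] := spd_decomp I0 F0 xd ut tx.
have ut' : uniq (m :: t) by rewrite /= mt.
have tt' : {subset t <= m :: t} by move=> i; rewrite inE orbC => ->.
have kt' : k \notin m :: t by rewrite inE negb_or km.
rewrite -(theta_fresh_widen k d a ut ut' tt' tx).
have {1}-> : x = half *: omega t (fun u w => mcomm (vcirc (x u) (vk' m)) (Q d (vk m) w)).
  rewrite [LHS]e [in RHS](eq_omega (B' := fun u w => (-1) *: Q d (x u) w +
    (half * vform (x u) w) *: Q d (vk m) (vk' m))).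
    rewrite omegaZD.
    have lf : linear (fun c : F^o => (half * c) *: Q d (vk m) (vk' m)).
      by move=> c c1 c2; rewrite scalerA -scalerDl mulrDr mulrCA.
    rewrite -(lin_omega _ _ lf) e0 mulr0 scale0r. by rewrite addr0 scalerA mulrN1.
  move=> j jt; have txj : vsupp t (x (bv F j)) by case: tx.
  have tj : vsupp t (bv F (bar j)) by apply: vsupp_bv; rewrite idx_bar.
  rewrite mcomm_Qf ?vcirc_spG //; last by case: (fresh_l mt tj).
  rewrite vcirc_vk; last by case: (fresh_r mt txj).
  rewrite vcirc_w; last by case: (fresh_l mt tj).
  have lr v : linear (Q d v) by move=> c z z'; rewrite Qf_linr.
  have ll v : linear (fun z => Q d z v) by move=> c z z'; rewrite Qf_linl.
  by rewrite (linN (ll _)) (linZ (lr _)) scaleN1r.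
rewrite theta_fresh_omega [RHS]/theta_fresh; congr (_ *: _); apply: eq_omega => j jt.
have txj : vsupp t (x (bv F j)) by case: tx.
have tj : vsupp t (bv F (bar j)) by apply: vsupp_bv; rewrite idx_bar.
have tm l : idx l = m -> vsupp (m :: t) (bv F l).
  by move=> lm; apply: vsupp_bv; rewrite lm mem_head.
have mj : vform (vk m) (bv F (bar j)) = 0 by case: (fresh_l mt tj).
rewrite -(theta_fresh_inv ut' kt') ?vcirc_spG ?Qf_spd // -?(QfF I0).
  by apply: msupp_Qf; [case: (fresh_r mt txj)|apply: vsuppW tt' _|apply: tm].
by apply: msupp_Qf; [|apply: tm|apply: vsuppW tt' _].
Qed.

Lemma fresh_seq (t : seq I) : exists k, k \notin t.
Proof. by have [k [kt _ _]] := fresh I0 Iinf (F := F) [::] t; exists k. Qed.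

Lemma theta_fresh_indep t k m d x a : uniq t -> k \notin t -> m \notin t ->
  x \in spd d -> msupp t x -> a \in std d -> theta_fresh t k d x a = theta_fresh t m d x a.
Proof.
(* The indices k and m may coincide; a third index is compared with each of them. *)
move=> ut kt mt xd tx ad; have [i] := fresh_seq [:: k, m & t].
rewrite !inE !negb_or => /and3P[ik im it].
by rewrite (@theta_fresh_indep0 t k i) // 1?eq_sym // (@theta_fresh_indep0 t i m).
Qed.

Lemma theta_fresh_indep_supp t t' k k' d x a : uniq t -> uniq t' -> k \notin t -> k' \notin t' ->
  x \in spd d -> msupp t x -> msupp t' x -> a \in std d ->
  theta_fresh t k d x a = theta_fresh t' k' d x a.
Proof.
move=> ut ut' kt kt' xd tx tx' ad; have [i] := fresh_seq (t ++ t').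
rewrite mem_cat negb_or => /andP[it it'].
have sl (s s' : seq I) : {subset s <= undup (s ++ s')} /\ {subset s' <= undup (s ++ s')}.
  by split=> j js; rewrite mem_undup mem_cat js ?orbT.
rewrite (theta_fresh_indep ut kt it) // (theta_fresh_indep ut' kt' it') //.
by rewrite -(theta_fresh_widen i d a ut (undup_uniq _) (sl t t').1 tx)
  -(theta_fresh_widen i d a ut' (undup_uniq _) (sl t t').2 tx').
Qed.

(** [genP k u] is minus the bracket of [genP k' u] with [genP k (vk k')]; the cocycle identity then
    shifts the index from k to k'. *)
Lemma VC_indep t t' k k' u c : k \notin t -> k' \notin t' -> vsupp t u -> vsupp t' u ->
  tau (genP k u) (VC (vk k) c) = tau (genP k' u) (VC (vk k') c).
Proof.
move=> kt kt' tu tu'; have [-> //|kk'] := eqVneq k k'.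
have uk := fresh_r kt tu; have uk' := fresh_r kt' tu'.
have v0 (i j : I + I) : idx i != idx j -> vform (bv F i) (bv F j) = 0 by exact: vform_bv0.
have e : genP k u = - br (genP k' u) (genP k (vk k')).
  rewrite [genP k (vk k')]genPE (br_GQ F0 ell_gt0 brP) ?vcirc_spG ?std1 //; last first.
    by apply: v0; rewrite eq_sym.
  rewrite vcirc_vk ?uk'.1 // vcirc_w; last by apply: v0; rewrite eq_sym.
  rewrite uk.2 mulr0 scale0r.
  have lr v : linear (Q false v) by move=> c' z z'; rewrite Qf_linr.
  have ll v : linear (fun z => Q false z v) by move=> c' z z'; rewrite Qf_linl.
  by rewrite (lin0 (lr _)) gen0l addr0 (linN (ll _)) (genNl brP) ?Qf_spd // opprK genPE.
rewrite [in LHS]e (linN (taul _)).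
have := tau_jac (genP k' u) (genP k (vk k')) (VC (vk k) c).
rewrite !(br_GVC brP) ?vcirc_spG // vcirc_vk; last by apply: v0; rewrite eq_sym.
rewrite vcirc_w; last by apply: v0; rewrite eq_sym.
rewrite uk.1 mulr0 scale0r (lin0 (pr_VCl brP c)) (lin0 (taur _)) addr0 => <-.
by rewrite (linN (pr_VCl brP c)) (linN (taur _)) opprK.
Qed.

Lemma tau_VC t k g u c : k \notin t -> g \in @spG F I -> msupp t g -> vsupp t u ->
  tau (gen false g 1) (VC u c) = - tau (genP k (g u)) (VC (vk k) c).
Proof.
move=> kt gG tg tu; rewrite (VC_fresh kt c tu) (linN (taur _)) tau_jac.
rewrite (br_gP kt gG tg tu) (br_GVC brP) // [g (vk k)](tg.1) //.
by rewrite (lin0 (pr_VCl brP c)) (lin0 (taur _)) addr0.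
Qed.

(** [presented] provides generators but no freeness; this supplies linear maps out of L with
    prescribed values on the matrix and vector generators and the value 0 on ⟨𝔟, 𝔟⟩. *)
Hypothesis lift : forall (T : bool -> (V -> V) -> alg -> E) (TV : V -> cmod q -> E),
  (forall d a c x y, a \in std d -> x \in spd d -> y \in spd d ->
    T d (c *: x + y) a = c *: T d x a + T d y a) ->
  (forall d x c a b, x \in spd d -> a \in std d -> b \in std d ->
    T d x (c *: a + b) = c *: T d x a + T d x b) ->
  (forall c, linear (TV^~ c)) -> (forall u, linear (TV u)) ->
  exists theta : L -> E, [/\ linear theta,
    forall d x a, x \in spd d -> a \in std d -> theta (gen d x a) = T d x a,
    forall u c, theta (VC u c) = TV u c & forall b b', theta (ang b b') = 0].

Lemma theta_ex : exists theta : L -> E,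
  [/\ linear theta, forall b b', theta (ang b b') = 0 &
   forall g z, g \in @spG F I -> tau (gen false g 1) z = theta (br (gen false g 1) z)].
Proof.
have [i0 _] := fresh_seq [::].
(* A support and an index outside it, chosen for each x. The default value is never met on [spd d],
   and by [TE] the choice does not matter, so linearity can be checked on a common support. *)
pose tk (x : V -> V) := xget ([::], i0) [set p : seq I * I | [/\ uniq p.1, msupp p.1 x & p.2 \notin p.1]].
have tkP d (x : V -> V) : x \in spd d -> [/\ uniq (tk x).1, msupp (tk x).1 x & (tk x).2 \notin (tk x).1].
  move=> xd; have [t ut tx] := spd_supp xd; have [k kt] := fresh_seq t.
  rewrite /tk; case: xgetP => [p _ //|/(_ (t, k)) []].
  by split.
pose T d (x : V -> V) a := theta_fresh (tk x).1 (tk x).2 d x a.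
have TE d t k (x : V -> V) a : x \in spd d -> a \in std d -> uniq t -> msupp t x -> k \notin t ->
    T d x a = theta_fresh t k d x a.
  by move=> xd ad ut tx kt; have [? ? ?] := tkP d x xd; apply: theta_fresh_indep_supp.
have Tl d a c (x y : V -> V) : a \in std d -> x \in spd d -> y \in spd d ->
    T d (c *: x + y) a = c *: T d x a + T d y a.
  move=> ad xd yd; have [t ut tx] := spd_supp xd; have [t' ut' ty] := spd_supp yd.
  pose s := undup (t ++ t'); have us : uniq s := undup_uniq _.
  have sx : msupp s x by apply: msuppW tx => i it; rewrite mem_undup mem_cat it.
  have sy : msupp s y by apply: msuppW ty => i it; rewrite mem_undup mem_cat it orbT.
  have [k ks] := fresh_seq s.
  have sxy : msupp s (c *: x + y).
    split=> [j js|u]; rewrite -[(c *: x + y) _]/(c *: x _ + y _).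
      by rewrite sx.1 // sy.1 // scaler0 addr0.
    by apply: vsupp_lin; [apply: sx.2|apply: sy.2].
  by rewrite !(TE d s k) ?spd_lin // theta_fresh_linl.
have Tr d (x : V -> V) c a b : x \in spd d -> a \in std d -> b \in std d ->
    T d x (c *: a + b) = c *: T d x a + T d x b.
  by move=> xd ad bd; apply: theta_fresh_linr.
pose tV (u : V) := undup [seq idx j | j <- dom u].
pose kV u := xget i0 [set k | k \notin tV u].
have kVP u : kV u \notin tV u.
  by rewrite /kV; case: xgetP => [k _ //|nk]; have [k kt] := fresh_seq (tV u); case: (nk k).
pose TV u c := - tau (genP (kV u) u) (VC (vk (kV u)) c).
have TVE u c t k : vsupp t u -> k \notin t -> TV u c = - tau (genP k u) (VC (vk k) c).
  move=> tu kt; congr (- _); apply: VC_indep (kVP u) kt _ tu; exact: vsupp_dom.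
have TVl c : linear (TV^~ c).
  move=> k u w; pose s := undup (tV u ++ tV w).
  have su : vsupp s u by apply: vsuppW (@vsupp_dom _ _ u) => i it; rewrite mem_undup mem_cat it.
  have sw : vsupp s w by apply: vsuppW (@vsupp_dom _ _ w) => i it; rewrite mem_undup mem_cat it orbT.
  have [m ms] := fresh_seq s; rewrite !(TVE _ c s m) //; last exact: vsupp_lin.
  by rewrite genP_lin taul scalerN opprD.
have TVr u : linear (TV u).
  by move=> k c c'; rewrite /TV (pr_VCr brP) taur scalerN opprD.
have [theta [lth thG thV thA]] := lift Tl Tr TVl TVr.
exists theta; split=> // g z gG.
have hG (g1 : V -> V) d (x : V -> V) a : g1 \in @spG F I -> x \in spd d -> a \in std d ->
    tau (gen false g1 1) (gen d x a) = theta (br (gen false g1 1) (gen d x a)).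
  move=> g1G xd ad; have [t ut tx] := spd_supp xd.
  have [t' ut' tg] := @spd_supp F I false _ g1G.
  pose s := undup (t ++ t'); have us : uniq s := undup_uniq _.
  have sx : msupp s x by apply: msuppW tx => i it; rewrite mem_undup mem_cat it.
  have sg : msupp s g1 by apply: msuppW tg => i it; rewrite mem_undup mem_cat it orbT.
  have [k ks] := fresh_seq s.
  rewrite (theta_fresh_inv us ks g1G sg xd sx ad) (br_Ggen F0 brP) //.
  have gxd : mcomm g1 x \in spd d := @mcomm_spd F I false d _ _ g1G xd.
  rewrite thG // (TE d s k) //.
  split=> [j js|u]; rewrite /mcomm -[(_ - _) _]/(g1 (x _) - x (g1 _)).
    have lx := spd_linear xd; have lg : linear g1 := @spd_linear F I false _ g1G.
    by rewrite sx.1 // sg.1 // (lin0 lx) (lin0 lg) subrr.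
  by rewrite addrC -scaleN1r; apply: vsupp_lin; [apply: sx.2|apply: sg.2].
have lL : linear (fun z => tau (gen false g 1) z) by exact: taur.
have lR g1 : linear (fun z => theta (br (gen false g1 1) z)).
  by move=> k x y; rewrite brr lth.
apply: (pr_ext brP (taur _) (lR g)) => [d x a|u c|b b']; first exact: hG.
  have [t ut tg] := @spd_supp F I false _ gG.
  pose s := undup (t ++ tV u).
  have su : vsupp s u by apply: vsuppW (@vsupp_dom _ _ u) => i it; rewrite mem_undup mem_cat it orbT.
  have sg : msupp s g by apply: msuppW tg => i it; rewrite mem_undup mem_cat it.
  have [k ks] := fresh_seq s.
  by rewrite (tau_VC c ks gG sg su) (br_GVC brP) // thV (TVE _ c s k) //; apply: sg.2.
(* On ⟨𝔟, 𝔟⟩ the element g is first written as a combination of brackets in 𝒢 ⊗ 1. Each factor maps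
   ⟨b, b'⟩ into 𝒮 ⊗ ℬ, where the claim is already known by [hG], and the cocycle and Jacobi
   identities conclude. *)
have [t ut tg] := @spd_supp F I false _ gG; have [k kt] := fresh_seq t.
have eg := gen_fresh kt (d := false) gG ut tg (std1 q).
rewrite eg.
pose D := ang b b'; pose Psi z := tau z D - theta (br z D).
have lP : linear Psi.
  by move=> c x x'; rewrite /Psi taul brl lth; lmod F E; ring.
apply/eqP; rewrite -subr_eq0; apply/eqP.
rewrite -[LHS]/(Psi _) (linZ lP) (lin_omega _ _ lP).
rewrite [omega _ _](_ : _ = 0) ?scaler0 // /omega big1 // => i _.
have AG (g1 : V -> V) : g1 \in @spG F I -> exists2 s, s \in @spS F I & exists2 be, be \in star_skew &
    br (gen false g1 1) D = gen true s be.
  move=> g1G; rewrite (br_anti brP) (pr_ang_gen brP) //; last exact: std1.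
  exists ((4 * ell I0)%:R^-1 *: mcomm g1 (idI0 I0)).
    by apply: rpredZ; apply: mcomm_spG_idI0.
  exists (acomm 1 (bstar b b')).
    by rewrite /acomm mul1r mulr1; apply: rpredD; apply: bstar_skew.
  rewrite /comm mul1r mulr1 subrr (gen0r brP) add0r mul0r scale0r addr0 opprK.
  by rewrite (genZl brP (d := true)) //; apply: mcomm_spG_idI0.
have step (g1 g2 : V -> V) : g1 \in @spG F I -> g2 \in @spG F I ->
    tau (br (gen false g1 1) (gen false g2 1)) D - theta (br (br (gen false g1 1) (gen false g2 1)) D) = 0.
  move=> G1 G2; have := tau_jac (gen false g1 1) (gen false g2 1) D.
  have := br_jac brP (gen false g1 1) (gen false g2 1) D.
  have [s sS [be beB ->]] := AG g2 G2; have [s' sS' [be' beB' ->]] := AG g1 G1.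
  rewrite !(hG _ true) // => e1 e2; rewrite e1 (linD lth) in e2.
  by apply/eqP; rewrite subr_eq0; apply/eqP/(addIr _ (esym e2)).
have st u v w : Psi (br (genP k u) (gen false (Q false v w) 1)) = 0.
  exact: (step _ _ (vcirc_spG _ _) (Qf_spd F0 ell_gt0 false v w)).
by rewrite !st subrr.
Qed.
End Theta.

(** * Invariant cocycles *)

Section Kappa.
Variables (F : fieldType) (I : choiceType) (I0 : {fset I}) (q : BCquadruple F).
Hypothesis F0 : [pchar F] =i pred0.
Hypothesis ell_gt0 : (0 < ell I0)%N.
Hypothesis Iinf : infinite_set [set: I].
Local Notation alg := (calg q).
Local Notation star := (@cstar F q).
Local Notation act := (@cact F q).
Local Notation f := (@cform F q).
Local Notation V := (vsp F I).
Local Notation half := (2%:R^-1 : F).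
Local Notation Q := (@Qf F I I0).
Local Notation vk := (@vk F I).
Local Notation vk' := (@vk' F I).
Variables (L : lmodType F) (br : L -> L -> L) (gen : bool -> (V -> V) -> alg -> L)
  (VC : V -> cmod q -> L) (ang : bb q -> bb q -> L).
Hypothesis brP : presented I0 br gen VC ang.
Local Notation Y := (@genQ F I I0 q L gen).
Local Notation P := (@genP F I q L gen).
Variables (E : lmodType F) (tau : L -> L -> E).
Hypothesis tauP : cocycle2 br tau.
Hypothesis tau0 : forall g z, g \in @spG F I -> tau (gen false g 1) z = 0.
Implicit Types (d : bool) (u w : V).

Let brl y : linear (br^~ y). Proof. by have [h _ _ _] := pr_lie brP. Qed.
Let brr x : linear (br x). Proof. by have [_ h _ _] := pr_lie brP. Qed.
Let gen0l d a : gen d 0 a = 0. Proof. exact: (gen0l brP). Qed.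
Let taul y : linear (tau^~ y). Proof. by case: tauP. Qed.
Let taur x : linear (tau x). Proof. by case: tauP. Qed.
Let Ql d w : linear (fun u => Q d u w). Proof. by move=> c u u'; rewrite Qf_linl. Qed.
Let Qr d u : linear (Q d u). Proof. by move=> c w w'; rewrite Qf_linr. Qed.

Lemma tau_invar g x y : g \in @spG F I ->
  tau (br (gen false g 1) x) y = - tau x (br (gen false g 1) y).
Proof.
move=> gG; have := tau_jac brP tauP (gen false g 1) x y; rewrite tau0 // => e.
by apply/eqP; rewrite -addr_eq0 -e.
Qed.

Lemma tau_P k u x y : tau (br (P k u) x) y = - tau x (br (P k u) y).
Proof. by apply: tau_invar; apply: vcirc_spG. Qed.

Lemma br_PVC k u w c : vform (vk' k) w = 0 ->
  br (P k u) (VC w c) = (half * vform u w) *: VC (vk' k) c.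
Proof.
move=> kw; rewrite (br_GVC brP) ?vcirc_spG // vcirc_w //.
by rewrite (linZ (pr_VCl brP c)).
Qed.

Lemma vsupp_vk t k : k \in t -> vsupp t (vk k) /\ vsupp t (vk' k).
Proof. by move=> kt; split; apply: vsupp_bv. Qed.

Lemma vform_vkk i j : [/\ vform (vk i) (vk j) = 0, vform (vk' i) (vk' j) = 0 &
  i != j -> vform (vk i) (vk' j) = 0 /\ vform (vk' i) (vk j) = 0].
Proof.
by split=> [||ij]; [rewrite vform_bv|rewrite vform_bv|split; apply: vform_bv0].
Qed.

Let vformkk i j : vform (vk i) (vk j) = 0. Proof. by have [] := vform_vkk i j. Qed.
Let vformkk' i j : vform (vk' i) (vk' j) = 0. Proof. by have [] := vform_vkk i j. Qed.
Let vform_ne i j : i != j -> vform (vk i) (vk' j) = 0.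
Proof. by have [_ _ h] := vform_vkk i j; move/h => []. Qed.
Let vform_ne' i j : i != j -> vform (vk' i) (vk j) = 0.
Proof. by have [_ _ h] := vform_vkk i j; move/h => []. Qed.

Lemma common_supp (us : seq V) (s : seq I) : exists t,
  [/\ uniq t, forall u, u \in us -> vsupp t u & {subset s <= t}].
Proof.
exists (undup (s ++ flatten [seq [seq idx j | j <- dom u] | u <- us])).
split=> [|u uus j|i]; first exact: undup_uniq.
  rewrite mem_undup mem_cat negb_or => /andP[_ jt]; apply: coeff_outdom.
  apply: contra jt => ju; apply/flattenP; exists [seq idx j | j <- dom u].
    exact: map_f.
  exact: map_f.
by rewrite mem_undup mem_cat => ->.
Qed.

Variables (i0 j0 : I).
Hypothesis ij0 : i0 != j0.

Definition kapC (c c' : cmod q) : E := half *: tau (VC (vk i0) c) (VC (vk' i0) c').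

(** Writing u as the image of v_k and moving the operator to w leaves a multiple (u, w)/2 of v_k̄.
    The remaining value depends only on k, and the pair at i0 fixes it. *)
Lemma tau_VV u w c c' : tau (VC u c) (VC w c') = vform u w *: kapC c c'.
Proof.
have [t [_ ts ti]] := common_supp [:: u; w] [:: i0].
have [k kt] := fresh_seq F I0 Iinf t.
have key u1 w1 : vsupp t u1 -> vsupp t w1 -> tau (VC u1 c) (VC w1 c') =
    (half * vform u1 w1) *: tau (VC (vk k) c) (VC (vk' k) c').
  move=> tu tw; rewrite (VC_fresh F0 brP kt c tu) (linN (taul _)) tau_P opprK.
  by rewrite br_PVC ?(linZ (taur _)) //; case: (fresh_l kt tw).
have [ti1 ti2] := vsupp_vk (ti i0 (mem_head _ _)).
have [tu tw] : vsupp t u /\ vsupp t w by split; apply: ts; rewrite !inE eqxx ?orbT.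
rewrite /kapC (key (vk i0)) // vform_vk (key u) // !scalerA; congr (_ *: _).
by rewrite mulVf ?F2 // mulr1 mulrC.
Qed.

Definition kap0 d d' (a a' : alg) : E :=
  tau (gen d (Q d (vk i0) (vk j0)) a) (gen d' (Q d' (vk' i0) (vk' j0)) a').

Lemma gen_PmQ t k m d w a : k \notin t -> m \notin t -> k != m -> vsupp t w ->
  a \in std d ->
  gen d (Q d (vk k) w) a = - br (P m w) (gen d (Q d (vk k) (vk m)) a).
Proof.
move=> kt mt km tw ad; rewrite (br_GQ F0 ell_gt0 brP) ?vcirc_spG ?vformkk //.
rewrite (vcirc_vk F0); last by case: (fresh_r mt tw).
rewrite vcirc_w; last by rewrite vform_ne' // eq_sym.
rewrite (fresh_r kt tw).1 mulr0 scale0r (lin0 (Ql _ _)) gen0l add0r.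
by rewrite (linN (Qr _ _)) (genNl brP) ?Qf_spd // opprK.
Qed.

(** Invariance moves u across at the index k and then w at m. Only two ways of contracting with u'
    and w' survive, the second with the sign of exchanging the slots at k and m. *)
Lemma tau_YY0 t k m d d' u w u' w' a a' : k \notin t -> m \notin t -> k != m ->
    vsupp t u -> vsupp t w -> vsupp t u' -> vsupp t w' ->
    vform u w = 0 -> vform u' w' = 0 -> a \in std d -> a' \in std d' ->
  tau (gen d (Q d u w) a) (gen d' (Q d' u' w') a') =
  (half * half * (vform u u' * vform w w' + (-1) ^+ d' * (vform u w' * vform w u'))) *:
  tau (gen d (Q d (vk k) (vk m)) a) (gen d' (Q d' (vk' k) (vk' m)) a').
Proof.
move=> kt mt km tu tw tu' tw' uw uw' ad ad'.
have e : gen d (Q d u w) a = - br (P k u) (gen d (Q d (vk k) w) a).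
  by rewrite (br_PQ F0 ell_gt0 brP kt tu tw ad) uw mulr0 scale0r addr0 opprK.
rewrite e (linN (taul _)) tau_P opprK (gen_PmQ kt mt km tw ad) (linN (taul _)) tau_P opprK.
rewrite (br_GQ F0 ell_gt0 brP) ?vcirc_spG //.
rewrite !vcirc_w; [|by case: (fresh_l kt tw')|by case: (fresh_l kt tu')].
rewrite (linZ (Ql d' w')) (linZ (Qr d' u')) !(genZl brP) ?Qf_spd // (linD (brr _)).
rewrite !(linZ (brr _)).
rewrite !(br_GQ F0 ell_gt0 brP) ?vcirc_spG //;
  [|by case: (fresh_r kt tu')|by case: (fresh_l kt tw')].
rewrite !(vcirc_w (k := m)) ?vformkk' //;
  [|by case: (fresh_l mt tu')
  |by case: (fresh_l mt tw')].
rewrite (fresh_r kt tw).2 mulr0 scale0r (lin0 (Ql _ _)) (lin0 (Qr _ _)) gen0l add0r addr0.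
rewrite (linZ (Ql _ _)) (linZ (Qr _ _)) !(genZl brP) ?Qf_spd //.
rewrite (Qf_swap F0 ell_gt0 d' (vk' k) (vk' m)) (genZl brP) ?Qf_spd //.
rewrite (linD (taur _)) !(linZ (taur _)); lmod F E.
by ring.
Qed.

(** [tau_YY0], applied to the given vectors and to the reference pair of [kap0] with the same k and
    m, eliminates the fresh indices. *)
Lemma tau_YY d d' u w u' w' a a' :
    vform u w = 0 -> vform u' w' = 0 -> a \in std d -> a' \in std d' ->
  tau (gen d (Q d u w) a) (gen d' (Q d' u' w') a') =
  (half * half * (vform u u' * vform w w' + (-1) ^+ d' * (vform u w' * vform w u'))) *:
    kap0 d d' a a'.
Proof.
move=> uw uw' ad ad'.
have [t [_ ts ti]] := common_supp [:: u; w; u'; w'] [:: i0; j0].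
have [k kt] := fresh_seq F I0 Iinf t; have [m] := fresh_seq F I0 Iinf (k :: t).
rewrite inE negb_or eq_sym => /andP[km mt].
have [ti1 ti2] := vsupp_vk (ti i0 (mem_head _ _)).
have [tj1 tj2] : vsupp t (vk j0) /\ vsupp t (vk' j0).
  by apply/vsupp_vk/ti; rewrite !inE eqxx orbT.
rewrite /kap0 (tau_YY0 (u := vk i0) kt mt km) // !vform_vk vform_ne //.
have [[tu tw] [tu' tw']] :
    (vsupp t u /\ vsupp t w) /\ (vsupp t u' /\ vsupp t w').
  by do 2!split; apply: ts; rewrite !inE eqxx ?orbT.
rewrite mul0r mulr0 addr0 (tau_YY0 (u := u) kt mt km) //.
rewrite scalerA; congr (_ *: _); set X := (_ + _).
by field; rewrite F2.
Qed.

(** Exchanging i0 and j0 in both arguments leaves the contraction unchanged, but produces the sign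
    -1 when the parities differ. *)
Lemma kap0_mixed d a a' : a \in std d -> a' \in std (~~ d) -> kap0 d (~~ d) a a' = 0.
Proof.
move=> ad ad'; have := @tau_YY d (~~ d) (vk j0) (vk i0) (vk' j0) (vk' i0) a a'
  (vformkk _ _) (vformkk' _ _) ad ad'.
rewrite !vform_vk !vform_ne // 1?eq_sym // mul0r mulr0 addr0.
rewrite [half * half * _](_ : _ = 1); last by field; rewrite F2.
rewrite scale1r (Qf_swap F0 ell_gt0 d (vk i0)) (Qf_swap F0 ell_gt0 (~~ d) (vk' i0)).
rewrite !(genZl brP) ?Qf_spd // (linZ (taul _)) (linZ (taur _)) scalerA -/(kap0 d (~~ d) a a').
have -> : (-1) ^+ d * (-1) ^+ (~~ d) = -1 :> F.
  by case: d {ad ad'}; rewrite /= ?expr0 ?expr1 ?mulr1 ?mul1r.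
rewrite scaleN1r => /esym/eqP; rewrite -subr_eq0 opprK -mulr2n -scaler_nat scaler_eq0.
by rewrite (negbTE (F2 F0)) => /eqP.
Qed.

Lemma tr_omega t (z : V -> V) : uniq t -> (forall j, idx j \notin t -> z (bv F j) = 0) ->
  omega t (fun u w => vform (z u) w : F^o) = 2%:R * tr z.
Proof.
move=> ut z0; rewrite (@trE _ _ (map inl t ++ map inr t)).
- rewrite big_cat !big_map /= -big_split mulr_sumr; apply: eq_bigr => i _.
  rewrite (vform_bvr (inl i)) (vform_bvr (inr i)) /= mulNr opprK.
  by rewrite -mulrDr.
- rewrite cat_uniq (map_inj_uniq (@inl_inj _ _)) (map_inj_uniq (@inr_inj _ _)).
  by rewrite ut andbT /=; apply/hasPn => _ /mapP[i it ->] /=; apply/mapP => -[].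
- move=> j; rewrite mem_cat negb_or => /andP[jl jr]; rewrite z0 ?coeff0 //.
  case: j jl jr => i jl jr; first by apply: contra jl => /(map_f inl).
  by apply: contra jr => /(map_f inr).
Qed.

(** For equal parities the product of the two matrices has trace -2, whence the factor -1/2 in the
    normalization τ(x ⊗ α, y ⊗ α') = tr(xy) κ(α, α'). *)
Definition kapA (x y : alg) : E :=
  (- half) *: tau (Y (vk i0) (vk j0) x) (Y (vk' j0) (vk' i0) y).

Lemma kapA_linl y : linear (kapA^~ y).
Proof.
move=> k x x'; rewrite /kapA (genQ_linr brP _ _ k x x') taul.
by lmod F E; ring.
Qed.

Lemma kapA_linr x : linear (kapA x).
Proof.
move=> k y y'; rewrite /kapA (genQ_linr brP _ _ k y y') taur.
by lmod F E; ring.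
Qed.

Lemma kapA_kap0 d d' a a' : a \in std d -> a' \in std d' ->
  kapA a a' = (- half * (-1) ^+ d') *: kap0 d d' a a'.
Proof.
move=> ad ad'; rewrite /kapA (genQ_gen F0 brP _ _ ad) (genQ_gen F0 brP _ _ ad').
by rewrite (Qf_swap F0 ell_gt0 d' (vk' i0)) (genZl brP) ?Qf_spd // (linZ (taur _)) scalerA.
Qed.

Lemma kapA_mixed d a a' : a \in std d -> a' \in std (~~ d) -> kapA a a' = 0.
Proof. by move=> ad ad'; rewrite (kapA_kap0 ad ad') kap0_mixed // scaler0. Qed.

Lemma common_msupp d d' (x y : V -> V) (us : seq V) (s : seq I) : x \in spd d -> y \in spd d' -> exists t,
  [/\ uniq t, msupp t x, msupp t y, forall u, u \in us -> vsupp t u & {subset s <= t}].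
Proof.
move=> xd yd; have [t1 _ tx] := spd_supp xd; have [t2 _ ty] := spd_supp yd.
have [t [ut tu tt]] := common_supp us (t1 ++ t2 ++ s).
have tt' i : (i \in t1) || (i \in t2) || (i \in s) -> i \in t.
  by move=> h; apply: tt; rewrite !mem_cat orbA.
exists t; split=> //; first by apply: msuppW tx => i it; apply: tt'; rewrite it.
  by apply: msuppW ty => i it; apply: tt'; rewrite it orbT.
by move=> i it; apply: tt'; rewrite it orbT.
Qed.

(** After [gen_fresh] the operator at k is moved to y, which kills v_k̄. What remains pairs to
    multiples of (y (x u), w), and their contraction is twice the trace of yx. *)
Lemma tau_gen d d' x y a a' : x \in spd d -> y \in spd d' -> a \in std d -> a' \in std d' ->
  tau (gen d x a) (gen d' y a') = tr (x \o y) *: kapA a a'.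
Proof.
move=> xd yd ad ad'; have [t [ut tx ty _ _]] := common_msupp [::] [::] xd yd.
have [k kt] := fresh_seq F I0 Iinf t; have ly := spd_linear yd.
have tyx : omega t (fun u w => vform (y (x u)) w : F^o) = 2%:R * tr (y \o x).
  by rewrite tr_omega // => j jt /=; rewrite tx.1 // (lin0 ly).
rewrite (tr_compC (spd_gl xd) (spd_gl yd)) (kapA_kap0 ad ad').
rewrite (gen_fresh F0 ell_gt0 brP kt xd ut tx ad) (linZ (taul _)) (lin_omega _ _ (taul _)).
rewrite (eq_omega (B' := fun u w => (- (half * (-1) ^+ d') * vform (y (x u)) w)
  *: kap0 d d' a a')); last first.
  move=> j jt; have tj : vsupp t (bv F (bar j)) by apply: vsupp_bv; rewrite idx_bar.
  have txj := ty.2 (x (bv F j)).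
  rewrite tau_P (br_Ggen F0 brP) ?vcirc_spG //.
  rewrite (@mcomm_vcirc_kill F I I0 F0 d') //.
  - rewrite (genNl brP) ?Qf_spd // (linN (taur _)) opprK tau_YY //.
    + rewrite (fresh_l kt txj).1 vform_vk mul0r add0r; congr (_ *: _).
      by rewrite (vform_skew (bv F (bar j))); field; rewrite F2.
    + by case: (fresh_l kt tj).
    + by case: (fresh_r kt txj).
  - exact: spd_adjs.
  - by rewrite ty.1.
have lf : linear (fun c : F^o => (- (half * (-1) ^+ d') * c) *: kap0 d d' a a').
  by move=> c c1 c2; rewrite scalerA -scalerDl mulrDr mulrCA.
rewrite -(lin_omega _ _ lf) tyx !scalerA; congr (_ *: _).
by field; rewrite F2.
Qed.

(** Moving the operator at k turns the vector into a multiple of v_k̄; the next operator, at m and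
    built from w over t, kills it. *)
Lemma tau_genVC d x a u c : x \in spd d -> a \in std d -> tau (gen d x a) (VC u c) = 0.
Proof.
move=> xd ad; have [t [ut tx _ tu _]] := common_msupp [:: u] [::] xd xd.
have [k kt] := fresh_seq F I0 Iinf t; have [m] := fresh_seq F I0 Iinf (k :: t).
rewrite inE negb_or eq_sym => /andP[km mt].
have tu' : vsupp t u by apply: tu; rewrite mem_head.
rewrite (gen_fresh F0 ell_gt0 brP kt xd ut tx ad) (linZ (taul _)) (lin_omega _ _ (taul _)).
rewrite (eq_omega (B' := fun u w => 0)) ?omega0 ?scaler0 // => j jt.
have tj : vsupp t (bv F (bar j)) by apply: vsupp_bv; rewrite idx_bar.
rewrite tau_P br_PVC; last by case: (fresh_l kt tu').
rewrite (gen_PmQ kt mt km tj ad) (linN (taul _)) tau_P (linZ (brr _)).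
rewrite br_PVC; last by rewrite vformkk'.
rewrite (fresh_r kt tj).2 mulr0 scale0r scaler0 (lin0 (taur _)).
by rewrite !oppr0.
Qed.

Lemma kapA_parts x y : kapA x y = kapA (cpart false x) (cpart false y)
  + kapA (cpart true x) (cpart true y).
Proof.
rewrite -[x in LHS](cpart_sum F0) -[y in LHS](cpart_sum F0).
rewrite (linD (kapA_linl _)) !(linD (kapA_linr _)).
rewrite (kapA_mixed (cpart_std false _) (cpart_std true _)).
by rewrite (kapA_mixed (cpart_std true _) (cpart_std false _)) addr0 add0r.
Qed.

Lemma kapA_star x y : kapA x (star y) = kapA (cpart false x) (cpart false y)
  - kapA (cpart true x) (cpart true y).
Proof.
rewrite -[x in LHS](cpart_sum F0) -(cpart_diff F0 y).
rewrite (linD (kapA_linl _)) !(linB (kapA_linr _)).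
rewrite (kapA_mixed (cpart_std false _) (cpart_std true _)).
by rewrite (kapA_mixed (cpart_std true _) (cpart_std false _)) subr0 sub0r.
Qed.

Lemma tau_Y u w u' w' x y : vform u w = 0 -> vform u' w' = 0 ->
  tau (Y u w x) (Y u' w' y) =
  (- half) *: ((vform w u' * vform u w') *: kapA x y +
     (vform w w' * vform u u') *: kapA x (star y)).
Proof.
move=> uw uw'; rewrite /genQ !(linD (taul _)) !(linD (taur _)).
rewrite !tau_gen ?Qf_spd ?cpart_std // !tr_QfQf //=.
rewrite !(kapA_mixed (cpart_std false _) (cpart_std true _)).
rewrite !(kapA_mixed (cpart_std true _) (cpart_std false _)).
rewrite (kapA_parts x y) kapA_star.
by rewrite ?expr0 ?expr1; lmod F E; ring.
Qed.

Lemma br_YVC u w z x c : vform u w = 0 ->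
  br (Y u w x) (VC z c) = half *: (vform w z *: VC u (act x c) + vform u z *: VC w (act (star x) c)).
Proof.
move=> uw; rewrite /genQ (linD (brl _)) !(pr_genVC brP) ?Qf_spd ?cpart_std // !QfE //.
rewrite !(linZ (pr_VCl brP _)) !(linD (pr_VCl brP _)) !(linZ (pr_VCl brP _)).
have cl := @cact_linearl F q c.
have -> : act x c = act (cpart false x) c + act (cpart true x) c.
  by rewrite -(linD cl) cpart_sum.
have -> : act (star x) c = act (cpart false x) c - act (cpart true x) c.
  by rewrite -(linB cl) cpart_diff.
rewrite (linB (pr_VCr brP w)) (linD (pr_VCr brP u)).
by rewrite ?expr0 ?expr1; lmod F L; ring.
Qed.

Lemma tau_sum x y z : tau (br x y) z + tau (br y z) x + tau (br z x) y = 0.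
Proof. by case: tauP. Qed.

Lemma kapA_anti x y : kapA x y = - kapA y x.
Proof.
rewrite {1}/kapA (tau_anti tauP) tau_Y //.
rewrite !vform_vk' (vform_ne' ij0) mul0r scale0r addr0 mulrNN.
by lmod F E; field; rewrite F2.
Qed.

Lemma kapC_sym c c' : kapC c c' = kapC c' c.
Proof.
rewrite {1}/kapC (tau_anti tauP) tau_VV vform_vk'.
by lmod F E; field; rewrite F2.
Qed.

Lemma three_indices : exists i j k : I, [/\ i != j, i != k & j != k].
Proof.
have [i _] := fresh_seq F I0 Iinf [::]; have [j ji] := fresh_seq F I0 Iinf [:: i].
have [k] := fresh_seq F I0 Iinf [:: i; j]; rewrite !inE negb_or => /andP[ki kj].
by exists i, j, k; split; rewrite eq_sym //; move: ji; rewrite inE.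
Qed.

Lemma br_chain i j k x y : i != j -> i != k -> j != k ->
  br (Y (vk i) (vk' j) x) (Y (vk j) (vk' k) y) = - Y (vk i) (vk' k) (x * y).
Proof.
move=> ij ik jk; rewrite (br_YY F0 ell_gt0 brP _ _ (vform_ne ij) (vform_ne jk)).
rewrite vform_vk' vformkk vformkk' (vform_ne ik).
by lmod F L; field; rewrite F2.
Qed.

Lemma tau_cycle i k x y : i != k ->
  tau (Y (vk i) (vk' k) x) (Y (vk k) (vk' i) y) = 2%:R *: kapA x y.
Proof.
move=> ik; have ki : k != i by rewrite eq_sym.
rewrite (tau_Y _ _ (vform_ne ik) (vform_ne ki)).
rewrite vform_vk' vform_vk vformkk vformkk'.
by lmod F E; field; rewrite F2.
Qed.

(** The cocycle identity around a triangle of three distinct indices: each bracket closes one side,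
    and the pairing with the third element is [tau_cycle]. *)
Lemma kapA_cyc x y z : kapA (x * y) z + kapA (z * x) y + kapA (y * z) x = 0.
Proof.
have [i [j [k [ij ik jk]]]] := three_indices.
have := tau_sum (Y (vk i) (vk' j) x) (Y (vk j) (vk' k) y) (Y (vk k) (vk' i) z).
rewrite !br_chain // 1?eq_sym // !(linN (taul _)) !tau_cycle // 1?eq_sym //.
move=> e; apply: (@scaler_cancel _ _ (- 2%:R)); first by rewrite oppr_eq0 F2.
by rewrite scaler0 -e; lmod F E; ring.
Qed.

(** The cocycle identity for one matrix element at (i, j̄) and two vectors at j and ī, chosen so
    that each of the three brackets has a single contraction. *)
Lemma kap_form x c c' : kapA (f c c') x + kapC (act (star x) c') c = kapC (act x c) c'.
Proof.
have [i [j [k [ij _ _]]]] := three_indices.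
have := tau_sum (Y (vk i) (vk' j) x) (VC (vk j) c) (VC (vk' i) c').
rewrite (br_anti brP (VC (vk' i) c')). rewrite !(br_YVC _ _ _ (vform_ne ij)) (pr_VCVC brP).
rewrite -/(Y (vk j) (vk' i) (f c c')) !vform_vk !vform_vk' !vform_ne ?vform_ne' ?vformkk
  ?vformkk' // 1?eq_sym //.
rewrite !scale0r !(addr0, add0r) (linN (taul _)) !(linZ (taul _)) !tau_VV tau_cycle 1?eq_sym //.
rewrite vform_vk vform_vk' => e.
apply: (@scaler_cancel _ _ 2%:R); first by rewrite F2.
apply/eqP; rewrite -subr_eq0 -e; apply/eqP.
by lmod F E; field; rewrite F2.
Qed.

Definition kap (b b' : bb q) : E := kapA b.1 b'.1 + kapC b.2 b'.2.

Lemma kapC_linl c' : linear (kapC^~ c').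
Proof. by move=> k c c1; rewrite /kapC (pr_VCr brP) taul; lmod F E; ring. Qed.

Lemma kapC_linr c : linear (kapC c).
Proof. by move=> k c' c1; rewrite /kapC (pr_VCr brP) taur; lmod F E; ring. Qed.

Lemma kap_alg x y : kap (of_alg x) (of_alg y) = kapA x y.
Proof. by rewrite /kap /= (lin0 (kapC_linl _)) addr0. Qed.

Lemma kap_mod c c' : kap (of_mod c) (of_mod c') = kapC c c'.
Proof. by rewrite /kap /= (lin0 (kapA_linl _)) add0r. Qed.

Lemma kap_brace_like : brace_like kap.
Proof.
split.
- move=> y k x x'; rewrite /kap /= kapA_linl kapC_linl; lmod F E; ring.
- move=> x k y y'; rewrite /kap /= kapA_linr kapC_linr; lmod F E; ring.
- by move=> x c; rewrite /kap /= (lin0 (kapA_linr _)) (lin0 (kapC_linl _)) addr0.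
- by move=> x c; rewrite /kap /= (lin0 (kapA_linl _)) (lin0 (kapC_linr _)) addr0.
- by move=> a b aA bB; rewrite kap_alg; apply: (@kapA_mixed false).
- by move=> x y; rewrite !kap_alg; apply: kapA_anti.
- by move=> c c'; rewrite !kap_mod; apply: kapC_sym.
- by move=> x y z; rewrite !kap_alg; apply: kapA_cyc.
by move=> x c c'; rewrite kap_alg !kap_mod; apply: kap_form.
Qed.

(** * Values of the invariant cocycle on ⟨𝔟, 𝔟⟩ *)

Local Notation l := (ell I0).
Local Notation id0 := (@idI0 F I I0).
Local Notation D := ang.

(** Since k lies outside I0, [idI0] kills v_k̄ and only its action on u is left; the commutator with
    the coordinate 1 vanishes and the anticommutator doubles [bstar]. *)
Lemma br_DP b1 b2 k u : k \notin I0 ->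
  br (D b1 b2) (P k u) = (2 * l)%:R^-1 *: gen true (Q true (id0 u) (vk' k)) (bstar b1 b2).
Proof.
move=> kI0; rewrite (pr_ang_gen brP) ?vcirc_spG //; last exact: std1.
have be := bstar_skew b1 b2; rewrite /comm /acomm mul1r mulr1 subrr (gen0r brP) add0r.
rewrite mul0r scale0r addr0 (@mcomm_vcirc_kill F I I0 F0 true).
- rewrite (genNl brP) ?Qf_spd // -[_ + bstar _ _]mulr2n -scaler_nat.
  rewrite -[2%:R *: _]addr0 (pr_genr brP (d := true)) ?std0 // (gen0r brP) addr0.
  by lmod F L; rewrite !natrM; field; rewrite ?F2 ?ellF0 ?natF.
- exact: idI0_linear.
- exact: adjs_idI0.
exact: idI0_bv0.
Qed.

Lemma tau_DG b1 b2 g x : g \in @spG F I ->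
  tau (D b1 b2) (br (gen false g 1) x) = tau (br (D b1 b2) (gen false g 1)) x.
Proof.
move=> gG; rewrite (tau_jac brP tauP) [tau (gen _ _ _) _](_ : _ = 0) ?addr0 //.
exact: tau0.
Qed.

Lemma fresh_I0 (t : seq I) : exists k, k \notin t /\ k \notin I0.
Proof. by have [k [kt kI0 _]] := fresh I0 Iinf (F := F) [::] t; exists k. Qed.

(** [gen_fresh] at an index outside I0 and [tau_DG] move D onto the operator, which lands in 𝒮 ⊗ ℬ
    where τ is known. For x in 𝒢 the result vanishes by parity. *)
Lemma tau_Dgen b1 b2 d x a : x \in spd d -> a \in std d ->
  tau (D b1 b2) (gen d x a) =
  - (d%:R * ((2 * l)%:R^-1 * tr (x \o id0))) *: kapA a (bstar b1 b2).
Proof.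
move=> xd ad; have [t [ut tx _ _ _]] := common_msupp [::] [::] xd xd.
have [k [kt kI0]] := fresh_I0 t; have be := bstar_skew b1 b2.
have txo : omega t (fun u w => vform (id0 (x u)) w : F^o) = 2%:R * tr (id0 \o x).
  by rewrite tr_omega // => j jt /=; rewrite tx.1 // (lin0 (@idI0_linear F I I0)).
rewrite (tr_compC (spd_gl xd) (idI0_gl F I0)).
rewrite (gen_fresh F0 ell_gt0 brP kt xd ut tx ad) (linZ (taur _)) (lin_omega _ _ (taur _)).
rewrite (eq_omega (B' := fun u w => (- ((2 * l)%:R^-1 * half * (-1) ^+ d) * vform (id0 (x u)) w)
  *: kap0 true d (bstar b1 b2) a)); last first.
  move=> j jt; have tj : vsupp t (bv F (bar j)) by apply: vsupp_bv; rewrite idx_bar.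
  have id0k w k' : idx k' = k -> vform (id0 w) (bv F k') = 0.
    by move=> kk; rewrite adjs_idI0 idI0_bv0 ?kk // vform0r mulr0.
  rewrite tau_DG ?vcirc_spG // br_DP // (linZ (taul _)) tau_YY //.
  - rewrite (id0k _ (inl k)) // vform_vk' mul0r add0r scalerA; congr (_ *: _).
    by rewrite natrM; field; rewrite ?F2 ?ellF0.
  - exact: id0k.
  - by case: (fresh_l kt tj).
have lf : linear (fun c : F^o => (- ((2 * l)%:R^-1 * half * (-1) ^+ d) * c) *: kap0 true d (bstar b1 b2) a).
  by move=> c c1 c2; rewrite scalerA -scalerDl mulrDr mulrCA.
rewrite -(lin_omega _ _ lf) txo scalerA kapA_anti (@kapA_kap0 true d _ _ be ad) scalerN -scaleNr scalerA.
case: d xd ad {lf} => xd ad.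
  congr (_ *: _); rewrite expr1 mul1r natrM; field; by rewrite ?F2 ?ellF0.
by rewrite (@kap0_mixed true) // !scaler0.
Qed.

Lemma tau_DVC b1 b2 u c : tau (D b1 b2) (VC u c) = 0.
Proof.
have [t [_ tu _]] := common_supp [:: u] [::]; have [k [kt kI0]] := fresh_I0 t.
rewrite (VC_fresh F0 brP kt c (tu u (mem_head _ _))) (linN (taur _)).
rewrite tau_DG ?vcirc_spG // br_DP // (linZ (taul _)) tau_genVC ?Qf_spd ?bstar_skew //.
by rewrite scaler0 oppr0.
Qed.

Lemma idI0_idem : id0 \o id0 = id0.
Proof.
apply/funext => z /=; rewrite (vsumE z) !(lin_sum (@idI0_linear F I I0)); apply: eq_bigr => j _.
rewrite !(linZ (@idI0_linear F I I0)) -[<< j >>]/(bv F j).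
congr (_ *: _); have e : id0 (bv F j) = if idx j \in I0 then bv F j else 0 := idI0E _ _ j.
by rewrite e; case: ifP e => // _ _; apply: (lin0 (@idI0_linear F I I0)).
Qed.

(** On the image of [id0] only the correction [id0]/ℓ of [Qf] survives, and [id0] has trace 2ℓ. *)
Lemma tr_Qkk k : k \notin I0 -> tr (Q true (vk k) (vk' k) \o id0) = 2%:R.
Proof.
move=> kI0.
have -> : Q true (vk k) (vk' k) \o id0 = l%:R^-1 *: id0 + 0.
  apply/funext => z; rewrite -[LHS]/(Q true _ _ (id0 z)) QfD vform_vk.
  have v0 j : idx j = k -> vform (bv F j) (id0 z) = 0.
    by move=> jk; rewrite vform_skew adjs_idI0 idI0_bv0 ?jk // vform0r mulr0 oppr0.
  rewrite !v0 // !scale0r !scaler0 !add0r -[id0 (id0 z)]/((id0 \o id0) z) idI0_idem.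
  rewrite -[RHS]/(_ *: id0 z + 0) addr0 scaler0 add0r; congr (_ *: _).
  by rewrite mul1r natrM; field; rewrite ?F2 ?ellF0.
rewrite tr_linear; [|exact: idI0_gl|exact: rpred0].
rewrite tr0 addr0 tr_idI0 natrM mulrCA mulVf ?mulr1 //.
exact: ellF0.
Qed.

Lemma tau_DYkk b1 b2 k x : k \notin I0 ->
  tau (D b1 b2) (Y (vk k) (vk' k) x) = - l%:R^-1 *: kapA x (bstar b1 b2).
Proof.
move=> kI0; rewrite /genQ (linD (taur _)) !tau_Dgen ?Qf_spd ?cpart_std //.
rewrite mul0r oppr0 scale0r add0r tr_Qkk //.
rewrite -kap_alg (bl_skew F0 kap_brace_like) ?bstar_skew // kap_alg; congr (_ *: _).
by rewrite mul1r natrM; field; rewrite ?F2 ?ellF0.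
Qed.

(** With both indices outside I0 the matrix has zero product with [idI0] on either side, so every
    term of the action vanishes. *)
Lemma br_DQ b1 b2 d k m a : k \notin I0 -> m \notin I0 -> k != m -> a \in std d ->
  forall j j', idx j = k -> idx j' = m ->
  br (D b1 b2) (gen d (Q d (bv F j) (bv F j')) a) = 0.
Proof.
move=> kI0 mI0 km ad j j' jk jm; rewrite (pr_ang_gen brP) ?Qf_spd //.
have v0 i z : idx i \notin I0 -> vform (bv F i) (id0 z) = 0.
  by move=> iI; rewrite vform_skew adjs_idI0 idI0_bv0 // vform0r mulr0 oppr0.
have jj : vform (bv F j) (bv F j') = 0 by apply: vform_bv0; rewrite jk jm.
have li := @idI0_linear F I I0.
have e1 : Q d (bv F j) (bv F j') \o id0 = 0.
  apply/funext => z; rewrite -[LHS]/(Q d _ _ (id0 z)) QfE // !v0 ?jk ?jm //.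
  by rewrite !scale0r !scaler0 addr0 scaler0.
have e2 : id0 \o Q d (bv F j) (bv F j') = 0.
  apply/funext => z; rewrite -[LHS]/(id0 (Q d _ _ z)) QfE // (linZ li) (linD li) !(linZ li).
  by rewrite !idI0_bv0 ?jk ?jm // !scaler0 addr0 scaler0.
rewrite /mcomm /mcirc e1 e2 tr0 mul0r scale0r !subr0 addr0 !mulr0 scale0r addr0.
by rewrite !gen0l addr0 scaler0 oppr0.
Qed.

(** ⟨β, β'⟩ is recovered from brackets at indices outside I0, where the action of D is zero on the
    matrix elements used and is [delta] on vectors; the other components of these brackets are
    handled by [tau_DYkk]. *)
Lemma tau_DD b1 b2 b1' b2' :
  tau (D b1 b2) (D b1' b2') = kap (bder l b1 b2 b1') b2' + kap b1' (bder l b1 b2 b2').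
Proof.
have kP := kap_brace_like; rewrite (kap_bder F0 kP ell_gt0) !kap_mod kap_alg.
rewrite (bstarE F0 b1' b2') (linB (kapA_linl _)) -{1}kap_alg (bl_skew F0 kP) ?bstar_skew // kap_alg.
have [k [_ kI0]] := fresh_I0 [::]; have [m [km mI0]] := fresh_I0 [:: k].
have {}km : k != m by move: km; rewrite inE eq_sym.
rewrite (bl_split (pr_ang brP) b1') (linD (taur _)).
set x := b1'.1; set y := b2'.1; set c := b1'.2; set c' := b2'.2; set be := bstar b1 b2.
have eA : tau (D b1 b2) (D (of_alg x) (of_alg y)) =
    - (2 * l)%:R^-1 *: kapA (comm x y) be.
  have YD j j' z : idx j = k -> idx j' = m -> br (D b1 b2) (Y (bv F j) (bv F j') z) = 0.
    move=> jk jm; rewrite /genQ (linD (brr _)).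
    by rewrite !(br_DQ _ _ kI0 mI0 km) ?cpart_std // addr0.
  (* D annihilates both arguments, so τ(D, ·) vanishes on their bracket. The coordinate [star y]
     makes the ⟨𝔟, 𝔟⟩-component a multiple of ⟨x, y⟩. *)
  have := tau_jac brP tauP (D b1 b2) (Y (vk k) (vk m) x) (Y (vk' k) (vk' m) (star y)).
  rewrite !YD // (lin0 (taul _)) (lin0 (taur _)) addr0.
  rewrite (br_YY F0 ell_gt0 brP) // !vform_vk !vform_ne // 1?eq_sym // cstarK.
  rewrite !scale0r !mul0r !scale0r !(addr0, add0r).
  rewrite (linB (taur _)) !(linZ (taur _)) (linD (taur _)) !(linZ (taur _)).
  rewrite !tau_DYkk // => e.
  have <- : kapA (x * y) be + kapA (star x * star y) be = kapA (comm x y) be.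
    have st z : kapA z be = - kapA (star z) be.
      rewrite -kap_alg -(bl_skew F0 kP) ?bstar_skew // kap_alg.
      rewrite -[in RHS]kap_alg -(bl_skew F0 kP) ?bstar_skew // kap_alg -(linN (kapA_linl _)).
      by congr (kapA _ _); rewrite /cpart cstarK expr1 !scaleN1r -scalerN opprB.
    by rewrite (st (star x * star y)) cstarM !cstarK -(linB (kapA_linl _)).
  apply: (@scaler_cancel _ _ 2%:R); first by rewrite F2.
  apply/eqP; rewrite -subr_eq0; apply/eqP.
  transitivity (- (0 : E)); last by rewrite oppr0.
  rewrite -e; lmod F E; rewrite ?natrM; field; by rewrite ?F2 ?ellF0.
have eC : tau (D b1 b2) (D (of_mod c) (of_mod c')) =
    kapC (delta b1 b2 c) c' + kapC c (delta b1 b2 c') + (2 * l)%:R^-1 *: kapA (heart c c') be.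
  have VD j z : idx j = k -> br (D b1 b2) (VC (bv F j) z) = VC (bv F j) (delta b1 b2 z).
    move=> jk; rewrite (pr_ang_VC brP) idI0_bv0 ?jk //.
    by rewrite (lin0 (pr_VCl brP _)) scaler0 add0r.
  have := tau_jac brP tauP (D b1 b2) (VC (vk k) c) (VC (vk' k) c').
  rewrite !VD // !tau_VV (pr_VCVC brP) -/(Y (vk k) (vk' k) (f c c')) vform_vk.
  rewrite (linD (taur _)) (linZ (taur _)) tau_DYkk //.
  have -> : kapA (f c c') be = kapA (heart c c') be.
    rewrite -kap_alg -(bl_skew F0 kP) ?bstar_skew // kap_alg; congr (kapA _ _).
    by rewrite /cpart /heart expr1 scaleN1r cform_skew opprK.
  move=> e; apply: (@scaler_cancel _ _ 2%:R); first by rewrite F2.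
  move/eqP: e; rewrite -subr_eq0 => /eqP e; apply/eqP; rewrite -subr_eq0 -e; apply/eqP.
  lmod F E; rewrite ?natrM; field; by rewrite ?F2 ?ellF0.
by rewrite eA eC -/x -/y -/c -/c'; lmod F E; ring.
Qed.
End Kappa.

(** * The central extension *)

Section Extension.
Variables (F : fieldType) (I : choiceType) (I0 : {fset I}) (q : BCquadruple F).
Hypothesis F0 : [pchar F] =i pred0.
Hypothesis ell_gt0 : (0 < ell I0)%N.
Hypothesis Iinf : infinite_set [set: I].
Local Notation alg := (calg q).
Local Notation V := (vsp F I).
Variables (L : lmodType F) (br : L -> L -> L) (gen : bool -> (V -> V) -> alg -> L)
  (VC : V -> cmod q -> L) (ang : bb q -> bb q -> L).
Hypothesis brP : presented I0 br gen VC ang.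
Variables (E : lmodType F) (tau : L -> L -> E).
Hypothesis tauP : cocycle2 br tau.
Variable theta : L -> E.
Hypothesis theta_lin : linear theta.

Lemma ext_bracket_lie : lie_bracket (ext_bracket br tau).
Proof.
have [bl brr alt jac] := pr_lie brP; have [tl tr talt tjac] := tauP.
split.
- move=> y k x x'; apply: injective_projections; [exact: bl|exact: tl].
- move=> x k y y'; apply: injective_projections; [exact: brr|exact: tr].
- by move=> x; rewrite /ext_bracket alt talt.
- by move=> x y z; apply: injective_projections; [exact: jac|exact: tjac].
Qed.

Definition twist (x y : L) : E := tau x y - theta (br x y).

Lemma twist_cocycle : cocycle2 br twist.
Proof.
have [bl brr alt jac] := pr_lie brP; have [tl tr talt tjac] := tauP.
split.
- by move=> y k x x'; rewrite /twist tl bl theta_lin; lmod F E; ring.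
- by move=> x k y y'; rewrite /twist tr brr theta_lin; lmod F E; ring.
- by move=> x; rewrite /twist talt alt (lin0 theta_lin) subrr.
move=> x y z; rewrite /twist.
have := tjac x y z; have := congr1 theta (jac x y z).
rewrite !(linD theta_lin) (lin0 theta_lin) => e1 e2.
by rewrite -[RHS](subrr 0) -{1}e2 -e1; lmod F E; ring.
Qed.

Hypothesis theta_ang : forall b b', theta (ang b b') = 0.
Hypothesis twist0 : forall g z, g \in @spG F I -> twist (gen false g 1) z = 0.
Hypothesis ext_perfect : perfect (ext_bracket br tau).
Variables (i0 j0 : I).
Hypothesis ij0 : i0 != j0.

Local Notation kappa := (@kap F I I0 q L gen VC E twist i0 j0).

(** The graph of θ: lifting along it replaces τ by [twist]. On ⟨𝔟, 𝔟⟩, where θ is 0, the lift [eang]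
    carries κ instead. *)
Definition egen d x a : (L * E)%type := (gen d x a, theta (gen d x a)).
Definition eVC u c : (L * E)%type := (VC u c, theta (VC u c)).
Definition eang b b' : (L * E)%type := (ang b b', kappa b b').

Let tw x y : tau x y = twist x y + theta (br x y).
Proof. by rewrite /twist subrK. Qed.

Let P0 := twist_cocycle.

(** First components repeat the formulas of L; second components are the computed values of [twist]
    plus θ of the bracket. The induction principle, that is spanning, is where perfectness
    enters. *)
Lemma ext_presented : presented I0 (ext_bracket br tau) egen eVC eang.
Proof.
have tG := tau_gen F0 ell_gt0 Iinf brP P0 twist0 ij0.
have tGV := tau_genVC F0 ell_gt0 Iinf brP P0 twist0.
have tVV := tau_VV F0 Iinf brP P0 twist0.
have tDG := tau_Dgen F0 ell_gt0 Iinf brP P0 twist0 ij0.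
have tDV := tau_DVC F0 ell_gt0 Iinf brP P0 twist0.
have tDD := tau_DD F0 ell_gt0 Iinf brP P0 twist0 ij0.
have kP := kap_brace_like F0 ell_gt0 Iinf brP P0 twist0 ij0.
have kA := kap_alg brP P0 i0 j0.
have kC := kap_mod brP P0 i0 j0.
have k0 := kapA_mixed F0 ell_gt0 Iinf brP P0 twist0 ij0.
have thD := linD theta_lin; have thZ := linZ theta_lin; have thN := linN theta_lin.
have aP := pr_ang brP.
have pgenl : forall d k x y a, x \in spd d -> y \in spd d ->
    egen d (k *: x + y) a = k *: egen d x a + egen d y a.
  move=> d k x y a xd yd; rewrite /egen (pr_genl brP) // theta_lin.
  by apply: injective_projections.
have pVCl c : linear (eVC^~ c).
  move=> k u w; rewrite /eVC (pr_VCl brP) theta_lin; exact: injective_projections.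
have pVCr u : linear (eVC u).
  move=> k u' w; rewrite /eVC (pr_VCr brP) theta_lin; exact: injective_projections.
have pgen : forall d d' x y a a', x \in spd d -> y \in spd d' ->
      a \in std d -> a' \in std d' ->
    ext_bracket br tau (egen d x a) (egen d' y a') =
      egen (d (+) d') (mcomm x y) (2%:R^-1 *: acomm a a')
      + egen (~~ (d (+) d')) (mcirc I0 x y) (2%:R^-1 *: comm a a')
      + ((d == d')%:R * tr (x \o y)) *: eang (of_alg a) (of_alg a').
  move=> d d' x y a a' xd yd ad ad'; apply: injective_projections => /=.
    exact: (pr_gen brP).
  rewrite tw tG // (pr_gen brP) // !thD thZ theta_ang scaler0 addr0 kA addrC.
  congr (_ + _); have [_|dd] := eqVneq d d'; first by rewrite mul1r.
  have e : d' = ~~ d by case: d d' dd {xd yd ad ad'} => [] [].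
  by rewrite mul0r scale0r (k0 d) ?scaler0 // -e.
have pgenVC : forall d x a u c, x \in spd d -> a \in std d ->
    ext_bracket br tau (egen d x a) (eVC u c) = eVC (x u) (cact a c).
  move=> d x a u c xd ad; apply: injective_projections => /=.
    exact: (pr_genVC brP).
  by rewrite tw tGV // add0r (pr_genVC brP).
have pVCVC : forall u w c c',
    ext_bracket br tau (eVC u c) (eVC w c') =
      egen false (Qf I0 false u w) (cpart false (cform c c'))
      + egen true (Qf I0 true u w) (cpart true (cform c c'))
      + vform u w *: eang (of_mod c) (of_mod c').
  move=> u w c c'; apply: injective_projections => /=.
    exact: (pr_VCVC brP).
  by rewrite tw (tVV i0) (pr_VCVC brP) !thD thZ theta_ang scaler0 addr0 kC addrC.
have pDG : forall b1 b2 d x a, x \in spd d -> a \in std d ->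
    ext_bracket br tau (eang b1 b2) (egen d x a) = - ((4 * ell I0)%:R^-1 *:
      (egen d (mcirc I0 x (idI0 I0)) (comm a (bstar b1 b2))
       + egen (~~ d) (mcomm x (idI0 I0)) (acomm a (bstar b1 b2))
       + (d%:R * (2%:R * tr (x \o idI0 I0))) *:
           eang (of_alg a) (of_alg (bstar b1 b2)))).
  move=> b1 b2 d x a xd ad; apply: injective_projections => /=.
    exact: (pr_ang_gen brP).
  rewrite tw tDG // (pr_ang_gen brP) // thN thZ !thD thZ theta_ang kA.
  by lmod F E; rewrite ?natrM; field; rewrite ?ellF0 ?natF.
have pDV : forall b1 b2 u c,
    ext_bracket br tau (eang b1 b2) (eVC u c) =
      (2 * ell I0)%:R^-1 *: eVC (idI0 I0 u) (cact (bstar b1 b2) c)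
      + eVC u (delta b1 b2 c).
  move=> b1 b2 u c; apply: injective_projections => /=.
    exact: (pr_ang_VC brP).
  by rewrite tw tDV add0r (pr_ang_VC brP) thD thZ.
have pDD : forall b1 b2 b1' b2',
    ext_bracket br tau (eang b1 b2) (eang b1' b2') =
      eang (bder (ell I0) b1 b2 b1') b2' + eang b1' (bder (ell I0) b1 b2 b2').
  move=> b1 b2 b1' b2'; apply: injective_projections => /=.
    exact: (pr_ang_ang brP).
  by rewrite tw tDD (pr_ang_ang brP) thD !theta_ang !addr0.
have pang : brace_like eang.
  split=> *; rewrite /eang.
  - by move=> k x y; rewrite (bl_linl aP) (bl_linl kP); apply: injective_projections.
  - by move=> k x y; rewrite (bl_linr aP) (bl_linr kP); apply: injective_projections.
  - by rewrite (bl_am aP) (bl_am kP).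
  - by rewrite (bl_ma aP) (bl_ma kP).
  - by rewrite (bl_ss aP) // (bl_ss kP).
  - by rewrite (bl_anti aP) (bl_anti kP); apply: injective_projections.
  - by rewrite (bl_sym aP) (bl_sym kP).
  - by apply: injective_projections; [apply: (bl_cyc aP)|apply: (bl_cyc kP)].
  - by apply: injective_projections; [apply: (bl_form aP)|apply: (bl_form kP)].
have LA := ext_bracket_lie.
split=> //; first by move=> d x k a b ad bd; rewrite /egen (pr_genr brP) // theta_lin;
  apply: injective_projections.
move=> P PP0 Plin Pg PV Pa.
have PZ k x : P x -> P (k *: x) by move=> Px; rewrite -[k *: x]addr0; apply: Plin.
have PD x y : P x -> P y -> P (x + y) by rewrite -{2}[x]scale1r; apply: Plin.
have PN x : P x -> P (- x) by rewrite -scaleN1r; apply: PZ.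
have [el er ealt _] := LA.
have anti x y : ext_bracket br tau x y = - ext_bracket br tau y x.
  have := ealt (x + y); rewrite (linD (el _)) !(linD (er _)) !ealt add0r addr0.
  by move/eqP; rewrite addr_eq0 => /eqP.
have Panti x y : P (ext_bracket br tau y x) -> P (ext_bracket br tau x y).
  by move=> h; rewrite anti; apply: PN.
have sc d d' (a a' : alg) : a \in std d -> a' \in std d' ->
    2%:R^-1 *: acomm a a' \in @std F q (d (+) d') /\
    2%:R^-1 *: comm a a' \in @std F q (~~ (d (+) d')).
  by move=> ad ad'; split; apply: half_std; [apply: acomm_std|apply: comm_std].
(* By perfectness it suffices to reach brackets. These ignore the E-components of their arguments,
   so each generator may be replaced by its lift and the formulas applied. *)
have key (x y : L) : P (ext_bracket br tau (x, 0) (y, 0)).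
  have R1 e1 e2 (z z' : L) : P (ext_bracket br tau (z, e1) (z', e2)) ->
    P (ext_bracket br tau (z, 0) (z', 0)) by [].
  have Rl (z1 z2 z : L) k : ext_bracket br tau (k *: z1 + z2, 0) (z, 0) =
      k *: ext_bracket br tau (z1, 0) (z, 0) + ext_bracket br tau (z2, 0) (z, 0).
    have e : (k *: z1 + z2, 0) = k *: (z1, 0) + (z2, 0) :> (L * E)%type.
      by rewrite -[RHS]/(k *: z1 + z2, k *: 0 + 0) scaler0 addr0.
    by rewrite e el.
  have Rr (z1 z2 z : L) k : ext_bracket br tau (z, 0) (k *: z1 + z2, 0) =
      k *: ext_bracket br tau (z, 0) (z1, 0) + ext_bracket br tau (z, 0) (z2, 0).
    have e : (k *: z1 + z2, 0) = k *: (z1, 0) + (z2, 0) :> (L * E)%type.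
      by rewrite -[RHS]/(k *: z1 + z2, k *: 0 + 0) scaler0 addr0.
    by rewrite e er.
  have R0 (z : L) : P (ext_bracket br tau (0, 0) (z, 0)) by rewrite (lin0 (el _)).
  have R0' (z : L) : P (ext_bracket br tau (z, 0) (0, 0)) by rewrite (lin0 (er _)).
  move: x; apply: (pr_ind brP) => [|k x x' hx hx'|d x a xd ad|u c|b b'] //.
  - by rewrite Rl; apply: Plin.
  - move: y; apply: (pr_ind brP) => [|k y y' hy hy'|d' y a' yd ad'|w c'|b1 b1'] //.
    + by rewrite Rr; apply: Plin.
    + apply: (R1 (theta (gen d x a)) (theta (gen d' y a'))).
      rewrite -[ext_bracket _ _ _ _]/(ext_bracket br tau (egen d x a) (egen d' y a')).
      have [s1 s2] := sc _ _ _ _ ad ad'; rewrite pgen //; apply: (PD); [apply: (PD)|exact: PZ].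
        by apply: Pg => //; apply: mcomm_spd.
      by apply: Pg => //; apply: mcirc_spd.
    + apply: (R1 (theta (gen d x a)) (theta (VC w c'))).
      by rewrite -[ext_bracket _ _ _ _]/(ext_bracket br tau (egen d x a) (eVC w c')) pgenVC.
    + apply: (R1 (theta (gen d x a)) (kappa b1 b1')); apply: Panti.
      rewrite -[ext_bracket _ _ _ _]/(ext_bracket br tau (eang b1 b1') (egen d x a)) pDG //.
      have be := bstar_skew b1 b1'.
      apply/PN/PZ/PD; last exact: PZ.
      apply: PD; apply: Pg.
      * by case: d xd {ad} => xd; [apply: mcirc_spS_idI0|apply: mcirc_spG_idI0].
      * by have := @comm_std F q d true a _ ad be; rewrite addbT negbK.
      * by case: d xd {ad} => xd; [apply: mcomm_spS_idI0|apply: mcomm_spG_idI0].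
      * by have := @acomm_std F q d true a _ ad be; rewrite addbT.
  - move: y; apply: (pr_ind brP) => [|k y y' hy hy'|d' y a' yd ad'|w c'|b1 b1'] //.
    + by rewrite Rr; apply: Plin.
    + apply: (R1 (theta (VC u c)) (theta (gen d' y a'))); apply: Panti.
      by rewrite -[ext_bracket _ _ _ _]/(ext_bracket br tau (egen d' y a') (eVC u c)) pgenVC.
    + apply: (R1 (theta (VC u c)) (theta (VC w c'))).
      rewrite -[ext_bracket _ _ _ _]/(ext_bracket br tau (eVC u c) (eVC w c')) pVCVC.
      by apply: (PD); [apply: (PD); apply: Pg; rewrite ?Qf_spd ?cpart_std|exact: PZ].
    + apply: (R1 (theta (VC u c)) (kappa b1 b1')); apply: Panti.
      rewrite -[ext_bracket _ _ _ _]/(ext_bracket br tau (eang b1 b1') (eVC u c)) pDV //.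
      by apply: PD => //; apply: PZ.
  move: y; apply: (pr_ind brP) => [|k y y' hy hy'|d y a yd ad|w c'|b1 b1'] //.
  - by rewrite Rr; apply: Plin.
  - apply: (R1 (kappa b b') (theta (gen d y a))).
    rewrite -[ext_bracket _ _ _ _]/(ext_bracket br tau (eang b b') (egen d y a)) pDG //.
    have be := bstar_skew b b'.
    apply/PN/PZ/PD; last exact: PZ.
    apply: PD; apply: Pg.
    + by case: d yd {ad} => yd; [apply: mcirc_spS_idI0|apply: mcirc_spG_idI0].
    + by have := @comm_std F q d true a _ ad be; rewrite addbT negbK.
    + by case: d yd {ad} => yd; [apply: mcomm_spS_idI0|apply: mcomm_spG_idI0].
    + by have := @acomm_std F q d true a _ ad be; rewrite addbT.
  - apply: (R1 (kappa b b') (theta (VC w c'))).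
    rewrite -[ext_bracket _ _ _ _]/(ext_bracket br tau (eang b b') (eVC w c')) pDV //.
    by apply: PD => //; apply: PZ.
  apply: (R1 (kappa b b') (kappa b1 b1')).
  rewrite -[ext_bracket _ _ _ _]/(ext_bracket br tau (eang b b') (eang b1 b1')) pDD.
  exact: PD.
move=> z; have /asboolP[s [sX ->]] := ext_perfect z.
rewrite big_seq; apply: big_ind => // p ps; have [u [v ->]] := sX p ps.
by apply/PZ/key.
Qed.
End Extension.

(** * Transport of the bracket formulas along a linear bijection *)

Section Transport.
Variables (F : fieldType) (I : choiceType) (I0 : {fset I}) (q : BCquadruple F).
Hypothesis F0 : [pchar F] =i pred0.
Hypothesis ell_gt0 : (0 < ell I0)%N.
Local Notation V := (vsp F I).
Variables (M : lmodType F) (brM : M -> M -> M)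
  (genM : bool -> (V -> V) -> calg q -> M) (VCM : V -> cmod q -> M)
  (angM : bb q -> bb q -> M).
Hypothesis MP : presented I0 brM genM VCM angM.
Variables (K : submodClosed (braces q)) (phi : lieL I K -> M) (psi : M -> lieL I K).
Hypothesis lphi : linear phi.
Hypotheses (phiK : cancel phi psi) (psiK : cancel psi phi).
Hypothesis phi_gen : forall d x a, x \in spd d -> a \in std d ->
  phi (gen K d x a) = genM d x a.
Hypothesis phi_VC : forall u c, phi (inVC K u c) = VCM u c.
Hypothesis phi_ang : forall b b', phi (angle I K b b') = angM b b'.

Definition pull_bracket (x y : lieL I K) : lieL I K := psi (brM (phi x) (phi y)).

Let phiG x a : x \in spG -> a \in star_fixed -> phi (inGA K x a) = genM false x a.
Proof. by move=> xG aA; rewrite -phi_gen. Qed.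

Let phiS x a : x \in spS -> a \in star_skew -> phi (inSB K x a) = genM true x a.
Proof. by move=> xS aB; rewrite -phi_gen. Qed.

Let phi_pull x y : phi (pull_bracket x y) = brM (phi x) (phi y).
Proof. exact: psiK. Qed.

Let phiD := linD lphi.
Let phiZ := linZ lphi.
Let phiN := linN lphi.
Let inj : injective phi := can_inj phiK.

Lemma pull_lie : lie_bracket pull_bracket.
Proof.
have [bl brr alt jac] := pr_lie MP; split.
- by move=> y k x x'; apply: inj; rewrite phi_pull lphi bl lphi !phi_pull.
- by move=> x k y y'; apply: inj; rewrite phi_pull lphi brr lphi !phi_pull.
- by move=> x; apply: inj; rewrite phi_pull alt (lin0 lphi).
move=> x y z; apply: inj; rewrite 2!phiD !phi_pull jac; exact: esym (lin0 lphi).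
Qed.

(** As phi is injective, each formula is checked in M; membership of all matrices and coordinates is
    needed because [inGA] and [inSB] cast them. *)
Lemma pull_lieL : lieL_bracket I0 pull_bracket.
Proof.
have Hs : forall d (a : calg q), a \in std d -> 2%:R^-1 *: a \in @std F q d.
  by move=> d a; apply: half_std.
have be b1 b2 : bstar b1 b2 \in @star_skew F q := bstar_skew b1 b2.
split; first exact: pull_lie.
- move=> x y a a' xG yG aA aA'; apply: inj.
  rewrite phi_pull !phiG // (pr_gen MP (d := false) (d' := false)) // mul1r.
  rewrite 2!phiD phiZ phi_ang phiG ?phiS //.
  + exact: mcirc_spGG.
  + by apply: (Hs true); apply: comm_fixed.
  + exact: mcomm_spGG.
  + by apply: (Hs false); apply: acomm_fixed.
- move=> x s a b xG sS aA bB; apply: inj.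
  rewrite phi_pull phiG // phiS // (pr_gen MP (d := false) (d' := true)) // mul0r scale0r.
  rewrite addr0 addrC phiD phiG ?phiS //.
  + exact: mcomm_spGS.
  + by apply: (Hs true); apply: acomm_fixed_skew.
  + exact: mcirc_spGS.
  + by apply: (Hs false); apply: comm_fixed_skew.
- move=> s t b b' sS tS bB bB'; apply: inj.
  rewrite phi_pull !phiS // (pr_gen MP (d := true) (d' := true)) // mul1r.
  rewrite 2!phiD phiZ phi_ang phiG ?phiS //.
  + exact: mcirc_spSS.
  + by apply: (Hs true); apply: comm_skew.
  + exact: mcomm_spSS.
  + by apply: (Hs false); apply: acomm_skew.
- move=> x a u c xG aA; apply: inj.
  by rewrite phi_pull phiG // !phi_VC (pr_genVC MP (d := false)).
- move=> s b u c sS bB; apply: inj.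
  by rewrite phi_pull phiS // !phi_VC (pr_genVC MP (d := true)).
- move=> u w c c'; apply: inj.
  rewrite phi_pull !phi_VC (pr_VCVC MP) 2!phiD phiZ phi_ang phiG ?phiS.
  + rewrite QfF (_ : Qf I0 true u w = vcomm I0 u w); last by rewrite /Qf -lock.
    by rewrite /cpart /diamond /heart expr0 expr1 scale1r scaleN1r cform_skew opprK.
  + exact: vcomm_spS.
  + exact: heart_skew.
  + exact: vcirc_spG.
  + exact: diamond_fixed.
- move=> b1 b2 x a xG aA; apply: inj.
  rewrite phi_pull phi_ang phiG // (pr_ang_gen MP b1 b2 (d := false)) // mul0r scale0r addr0.
  rewrite phiN phiZ phiD phiG ?phiS //.
  + exact: mcomm_spG_idI0.
  + exact: acomm_fixed_skew.
  + exact: mcirc_spG_idI0.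
  + exact: comm_fixed_skew.
- move=> b1 b2 s b sS bB; apply: inj.
  rewrite phi_pull phi_ang phiS // (pr_ang_gen MP b1 b2 (d := true)) // mul1r.
  rewrite phiN phiZ 2!phiD phiZ phi_ang phiG ?phiS // 1?[genM true _ _ + _]addrC //.
  + exact: mcirc_spS_idI0.
  + exact: comm_skew.
  + exact: mcomm_spS_idI0.
  + exact: acomm_skew.
- move=> b1 b2 u c; apply: inj.
  rewrite phi_pull phi_ang phi_VC (pr_ang_VC MP) phiD phiZ phiN phiZ !phi_VC.
  by rewrite /delta (linN (pr_VCr MP u)) (linZ (pr_VCr MP u)).
move=> b1 b2 b1' b2'; apply: inj.
by rewrite phi_pull !phi_ang (pr_ang_ang MP) phiD !phi_ang.
Qed.
End Transport.

(** * Structure of 𝔰𝔭(I) *)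

Section Symplectic.
Variables (F : fieldType) (I : choiceType) (I0 : {fset I}).
Hypothesis F0 : [pchar F] =i pred0.
Hypothesis ell_gt0 : (0 < ell I0)%N.
Hypothesis Iinf : infinite_set [set: I].
Local Notation V := (vsp F I).
Local Notation J := (I + I)%type.
Local Notation Q := (@Qf F I I0).
Local Notation v := (bv F).
Local Notation half := (2%:R^-1 : F).
Implicit Types (d : bool) (u w : V) (j k : J).

Lemma linear_ext (W : lmodType F) (f g : V -> W) : linear f -> linear g ->
  (forall j, f (v j) = g (v j)) -> f =1 g.
Proof.
move=> lf lg e u; rewrite (vsumE u) (lin_sum lf) (lin_sum lg); apply: eq_bigr => j _.
by rewrite (linZ lf) (linZ lg) e.
Qed.

Lemma spd_ind d (X : (V -> V) -> Prop) :
  X 0 -> (forall (k : F) x y, x \in spd d -> y \in spd d -> X x -> X y -> X (k *: x + y)) ->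
  (forall j k, X (Q d (v j) (v k))) -> forall x, x \in spd d -> X x.
Proof.
move=> X0 Xlin XQ x xd; have [t ut tx] := spd_supp xd.
have [-> _] := spd_decomp I0 F0 xd ut tx.
pose X' y := y \in spd d /\ X y.
have X'lin (k : F) y z : X' y -> X' z -> X' (k *: y + z).
  by move=> [yd Xy] [zd Xz]; split; [apply: spd_lin|apply: Xlin].
have X'0 : X' 0 by split; rewrite ?spd0.
suff [] : X' (- half *: omega t (fun u w => Q d (x u) w) + 0) by rewrite addr0.
apply: (X'lin) => //; rewrite /omega.
have XB u k : X' (Q d u (v k)).
  rewrite (vsumE u); elim: (dom u) => [|j s IH]; rewrite ?big_nil ?big_cons.
    have ll : linear (fun u => Q d u (v k)) by move=> c z z'; rewrite (Qf_linl F0 ell_gt0).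
    by rewrite (lin0 ll).
  by rewrite (Qf_linl F0 ell_gt0); apply: (X'lin) => //; split; [exact: (Qf_spd F0 ell_gt0)|exact: XQ].
elim: t {ut tx} => [|i t IH]; rewrite ?big_nil ?big_cons //.
rewrite -[_ - _]scale1r -[X in X - _]scale1r; apply: (X'lin) => //.
by rewrite scale1r -scaleN1r addrC; apply: (X'lin).
Qed.

(** Without orthogonality the correction of [Qf] adds a commutator with [idI0], which vanishes for
    diagonal x. *)
Lemma mcomm_Qf_gen d x u w : x \in @spG F I -> mcomm x (Q d u w) =
  Q d (x u) w + Q d u (x w) + (d%:R * vform u w / (2 * ell I0)%:R) *: mcomm x (idI0 I0).
Proof.
move=> xG; have lx := @spd_linear _ _ false x xG.
have ax a b : vform (x a) b = - vform a (x b).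
  by rewrite (@spd_adj _ _ false x a b xG) mul1r.
apply/funext => z; apply: vspP => j.
rewrite -[mcomm _ _ z]/(x (Q d u w z) - Q d u w (x z)).
rewrite -[(_ + _) z]/(Q d (x u) w z + Q d u (x w) z + (d%:R * vform u w / (2 * ell I0)%:R)
   *: (x (idI0 I0 z) - idI0 I0 (x z))) !QfD.
rewrite ax !(linZ lx, linD lx) !(coeffN, coeffD, coeffZ) !ax.
by field; rewrite ?F2 ?ellF0.
Qed.

Lemma vform_vbar j : vform (v (bar j)) (v j) = - sgnj F j.
Proof. by rewrite vform_bvl coeff_bv eqxx mulr1. Qed.

Lemma sgnj0 j : sgnj F j != 0.
Proof. by case: j => i /=; rewrite ?oppr_eq0 F2. Qed.

Lemma vform_nbar j k : k != bar j -> vform (v j) (v k) = 0.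
Proof. by rewrite vform_bv form_basisE => /negbTE->; rewrite mulr0. Qed.

Lemma idx_eq j k : idx k = idx j -> k = j \/ k = bar j.
Proof. by case: j k => a [] b /= ->; [left|right|right|left]. Qed.

Lemma bar_neq j : (bar j == j) = false. Proof. by case: j. Qed.

Lemma vcirc_neq0 j k : vcirc (v j) (v k) != 0.
Proof.
apply/eqP => /(congr1 (fun x : V -> V => coeff j (x (v (bar k))))).
rewrite -[(0 : V -> V) _]/(0 : V) coeff0 /vcirc !(coeffZ, coeffD) !vform_bvr !coeff_bv !eqxx.
rewrite !mulr1; case: (eqVneq j k) => [_|jk]; last first.
  rewrite mulr0 addr0 => /eqP; rewrite mulf_eq0 invr_eq0 (negbTE (F2 F0)).
  by rewrite (negbTE (sgnj0 _)).
have -> : half * (sgnj F k + sgnj F k * 1 * 1) = sgnj F k by field; rewrite F2.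
move/eqP.
by rewrite (negbTE (sgnj0 _)).
Qed.

Section Ideal.
Variable X : (V -> V) -> Prop.
Hypothesis Xlin : forall (k : F) x y, X x -> X y -> X (k *: x + y).
Hypothesis XG : forall x, X x -> x \in @spG F I.
Hypothesis Xid : forall g x, g \in @spG F I -> X x -> X (mcomm g x).

Let vcl w : linear (fun u => vcirc u w).
Proof. by move=> k u u'; rewrite -!(QfF I0) (Qf_linl F0 ell_gt0). Qed.
Let vcr u : linear (fun w => vcirc u w).
Proof. by move=> k w w'; rewrite -!(QfF I0) (Qf_linr F0 ell_gt0). Qed.

Let Xscale (k : F) x : k != 0 -> X (k *: x) -> X x.
Proof.
move=> k0 Xx; have X0 : X 0.
  by have := Xlin (-1) Xx Xx; rewrite scaleN1r addNr.
by have := Xlin k^-1 Xx X0; rewrite addr0 scalerA mulVf // scale1r.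
Qed.

Let Xmc g u w : g \in @spG F I -> vform u w = 0 -> X (vcirc u w) ->
  X (vcirc (g u) w + vcirc u (g w)).
Proof.
move=> gG uw Xuw; have := Xid gG Xuw.
by rewrite -(QfF I0 u w) (mcomm_Qf F0 ell_gt0) // !QfF.
Qed.

Let vcE u w z : vform u z = 0 -> vcirc u w z = (half * vform w z) *: u.
Proof. by move=> uz; rewrite /vcirc uz scale0r addr0 scalerA. Qed.

(** A nonzero column u of y gives u ∘ v_k for k outside the support ([S1]), a nonzero coefficient of
    u then gives v_k ∘ v_p ([S2]). Two more operators move k and p to arbitrary a and b ([S4]). *)
Lemma ideal_all y : X y -> y != 0 -> forall x, x \in @spG F I -> X x.
Proof.
move=> Xy y0; have yG := XG Xy; have ly := @spd_linear _ _ false y yG.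
have [t ut ty] := @spd_supp _ _ false y yG.
have [j yj0] : exists j, y (v j) != 0.
  apply: contrapT => /forallNP h; case/eqP: y0; apply/funext => u.
  apply: (linear_ext ly (g := 0)) => [k a b|i]; first by rewrite scaler0 addr0.
  by have /negP/negPn/eqP := h i.
set u := y (v j) in yj0.
have [m um0] : exists m, coeff m u != 0.
  apply: contrapT => /forallNP h; case/eqP: yj0; apply: vspP => i.
  by have /negP/negPn/eqP-> := h i; rewrite coeff0.
have jt : idx j \in t by apply: contraNT yj0 => jt; rewrite /u ty.1.
have mt : idx m \in t by apply: contraNT um0 => mt; rewrite (ty.2 (v j) m mt).
have out (k : I) (s : seq I) (i : I) : i \in s -> k \notin s -> i != k.
  by move=> is_; apply: contraNneq => <-.
have S1 k : idx k \notin t -> X (vcirc u (v k)).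
  move=> kt; have jk := out _ _ _ jt kt; have := Xid (vcirc_spG (v j) (v k)) Xy.
  rewrite mcomm_anti -(QfF I0 (v j)) (mcomm_Qf F0 ell_gt0) // ?(vform_bv0 _ jk) // !QfF (ty.1 _ kt).
  rewrite (lin0 (vcr _)) addr0 -scaleN1r; apply: Xscale.
  by rewrite oppr_eq0 oner_eq0.
have tu : vsupp t u := ty.2 (v j).
have S2 k p : idx k \notin t -> idx p \notin t -> idx k != idx p -> X (vcirc (v k) (v p)).
  move=> kt pt kp; have mp := out _ _ _ mt pt; have mk := out _ _ _ mt kt.
  have := Xmc (vcirc_spG (v p) (v (bar m))) (vsupp_vform tu kt) (S1 k kt).
  rewrite !vcE ?(vsupp_vforml tu pt) ?[vform (v p) (v k)]vform_bv0 1?eq_sym //.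
  rewrite (@vform_bv0 _ _ (bar m) k) ?idx_bar // mulr0 scale0r (lin0 (vcr _)) addr0.
  rewrite (linZ (vcl _)) -(QfF I0) (Qf_swap F0 ell_gt0) QfF scale1r; apply: Xscale.
  by rewrite mulf_neq0 ?invr_eq0 ?F2 // vform_bvl oppr_eq0 mulf_neq0 ?sgnj0.
have S4 a b : b != bar a -> X (vcirc (v a) (v b)).
  move=> ba; have [p] := fresh_seq F I0 Iinf [:: idx a, idx b & t].
  rewrite !inE !negb_or => /and3P[pa pb pt].
  have [k] := fresh_seq F I0 Iinf [:: p, idx a, idx b & t].
  rewrite !inE !negb_or => /and4P[kp ka kb kt].
  have kp0 : vform (v (inl k)) (v (inl p)) = 0 by apply: vform_bv0.
  have ap0 : vform (v a) (v (inl p)) = 0 by apply: vform_bv0; rewrite eq_sym.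
  have S3 : X (vcirc (v a) (v (inl p))).
    have := Xmc (vcirc_spG (v a) (v (bar (inl k)))) kp0 (S2 (inl k) (inl p) kt pt kp).
    rewrite !vcE //; last by apply: vform_bv0; rewrite eq_sym.
    rewrite [vform _ (v (inl p))]vform_bv0 // mulr0 scale0r (lin0 (vcr _)) addr0.
    rewrite (linZ (vcl _)) vform_vbar; apply: Xscale.
    by rewrite mulf_neq0 ?invr_eq0 ?F2 // oppr_eq0 sgnj0.
  have := Xmc (vcirc_spG (v b) (v (bar (inl p)))) ap0 S3.
  rewrite !vcE; first last.
  - by apply: vform_nbar; apply: contraNneq ba => ->; rewrite barK.
  - by apply: vform_bv0; rewrite eq_sym.
  rewrite [vform _ (v a)]vform_bv0 // mulr0 scale0r (lin0 (vcl _)) add0r.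
  rewrite (linZ (vcr _)) vform_vbar; apply: Xscale.
  by rewrite mulf_neq0 ?invr_eq0 ?F2 // oppr_eq0 sgnj0.
(* The excluded pair a, ā is reached from v_a ∘ v_a through v_ā ∘ v_ā, which maps v_a to a nonzero
   multiple of v_ā. *)
have S5 a : X (vcirc (v a) (v (bar a))).
  have aa : vform (v a) (v a) = 0 by apply: vform_nbar; rewrite eq_sym bar_neq.
  have := Xmc (vcirc_spG (v (bar a)) (v (bar a))) aa (S4 a a _).
  have -> : vcirc (v (bar a)) (v (bar a)) (v a) = (- sgnj F a) *: v (bar a).
    rewrite /vcirc vform_vbar -mulr2n -scaler_nat !scalerA mulVf ?F2 //.
    by rewrite mul1r.
  rewrite (linZ (vcl _)) (linZ (vcr _)) -(QfF I0 (v (bar a))) (Qf_swap F0 ell_gt0) QfF scale1r.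
  rewrite -mulr2n -scaler_nat scalerA => h; apply: Xscale (h _).
    by rewrite mulf_neq0 ?F2 // oppr_eq0 sgnj0.
  by rewrite eq_sym bar_neq.
have X0 : X 0 by have := Xlin (-1) Xy Xy; rewrite scaleN1r addNr.
apply: (@spd_ind false) => [//|k x z _ _|a b]; first exact: Xlin.
by rewrite QfF; have [->|ba] := eqVneq b (bar a); [exact: S5|exact: S4].
Qed.
End Ideal.

(** The Cartan subalgebra ℋ, as the matrices of 𝒢 having every basis vector as an eigenvector. *)
Definition diag_sp (x : V -> V) : Prop :=
  x \in @spG F I /\ forall j, x (v j) = coeff j (x (v j)) *: v j.

Definition sgb j : F := if j is inl _ then 1 else -1.

Lemma sgnjE j : sgnj F j = 2%:R * sgb j.
Proof. by case: j => i /=; rewrite ?mulr1 ?mulrN1. Qed.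

Lemma sgb0 j : sgb j != 0.
Proof. by case: j => i /=; rewrite ?oppr_eq0 oner_eq0. Qed.

Lemma sgb_bar j : sgb (bar j) = - sgb j.
Proof. by case: j => i /=; rewrite ?opprK. Qed.

Lemma diag_sp_bar x j : diag_sp x ->
  coeff (bar j) (x (v (bar j))) = - coeff j (x (v j)).
Proof.
move=> [xG xd]; have := @spd_adj _ _ false x (v j) (v (bar j)) xG.
rewrite mul1r vform_bvr vform_skew -[in vform _ (v j)](barK j) vform_bvr opprK.
rewrite !sgnjE sgb_bar mulrN mulNr => e; apply: (mulfI (sgnj0 j)).
by rewrite mulrN sgnjE e !barK opprK.
Qed.

(** This is -(e_ii - e_īī); the sign recurs in the weights below. *)
Definition cartan_elt (i : I) : V -> V := vcirc (v (inl i)) (v (inr i)).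

Lemma coeff_cartan_elt i j w : coeff j (cartan_elt i w) = - ((idx j == i)%:R * sgb j * coeff j w).
Proof.
rewrite /cartan_elt /vcirc !(coeffZ, coeffD) !coeff_bv (vform_bvl (inl i)) (vform_bvl (inr i)) /=.
have [e|e] := eqVneq (idx j) i.
  by case: j e => j /= ->; rewrite eqxx /=; field; rewrite F2.
have n k : idx k = i -> (k == j) = false.
  by move=> ki; apply: contraNF e => /eqP<-; rewrite ki.
by rewrite !n // !mulr0 addr0 mulr0 !mul0r oppr0.
Qed.

Lemma cartan_elt_diag i : diag_sp (cartan_elt i).
Proof.
split; first exact: vcirc_spG.
move=> j; apply: vspP => k; rewrite [RHS]coeffZ !coeff_cartan_elt !coeff_bv eqxx.
by case: (eqVneq j k) => [->|_]; rewrite ?mulr1 ?mulr0 ?oppr0.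
Qed.

(** The element at the index of v_j suffices for the entry at (k, j): its eigenvalues on v_j and v_k
    differ for k ≠ j, by a factor 2 when k is the bar of j. *)
Lemma diag_commute x : x \in @spG F I -> (forall i, mcomm (cartan_elt i) x = 0) -> diag_sp x.
Proof.
move=> xG xh; split=> // j; apply: vspP => k; rewrite coeffZ coeff_bv.
have lx := @spd_linear _ _ false x xG.
have [->|jk] := eqVneq j k; first by rewrite mulr1.
rewrite mulr0; have := congr1 (fun y : V -> V => coeff k (y (v j))) (xh (idx j)).
rewrite -[(0 : V -> V) _]/(0 : V) coeff0
  -[mcomm _ _ _]/(cartan_elt (idx j) (x (v j)) - x (cartan_elt (idx j) (v j))).
rewrite coeffB coeff_cartan_elt (cartan_elt_diag (idx j)).2 (linZ lx) [coeff k (_ *: _)]coeffZ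
  coeff_cartan_elt coeff_bv !eqxx mulr1 mul1r.
rewrite mulNr opprK => e; have [ki|ki] := eqVneq (idx k) (idx j); last first.
  move/eqP: e; rewrite (negbTE ki) !mul0r oppr0 add0r mulf_eq0 (negbTE (sgb0 _)) /=.
  by move/eqP.
have [kj|kb] := idx_eq ki; first by rewrite kj eqxx in jk.
move/eqP: e; rewrite ki eqxx mul1r kb sgb_bar mulNr opprK -mulr2n -mulr_natl.
by rewrite mulf_eq0 (negbTE (F2 F0)) mulf_eq0 (negbTE (sgb0 _)) => /eqP.
Qed.

Lemma diag_mcomm_idI0 x : diag_sp x -> mcomm x (idI0 I0) = 0.
Proof.
move=> [xG xd]; have lx := @spd_linear _ _ false x xG.
have li := @idI0_linear F I I0.
apply/funext => w; rewrite -[LHS]/(x (idI0 I0 w) - idI0 I0 (x w)).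
have lc : linear (fun w => x (idI0 I0 w) - idI0 I0 (x w)).
  by move=> k a b; rewrite li !lx li; lmod F (vsp F I); ring.
apply: (linear_ext lc (g := 0)) => [k a b|j]; first by rewrite scaler0 addr0.
have e : idI0 I0 (v j) = if idx j \in I0 then v j else 0 := idI0E _ _ j.
rewrite [x (v j)]xd (linZ li) e; case: ifP => _; first by rewrite -xd subrr.
by rewrite (lin0 lx) scaler0 subrr.
Qed.

Lemma diag_mcomm_Q d x j k : diag_sp x ->
  mcomm x (Q d (v j) (v k)) = (coeff j (x (v j)) + coeff k (x (v k))) *: Q d (v j) (v k).
Proof.
move=> xD; have [xG xd] := xD; rewrite mcomm_Qf_gen // diag_mcomm_idI0 // scaler0 addr0.
have ll w : linear (fun u => Q d u w) by move=> c z z'; rewrite (Qf_linl F0 ell_gt0).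
have lr w : linear (Q d w) by move=> c z z'; rewrite (Qf_linr F0 ell_gt0).
by rewrite {1}[x (v j)]xd (linZ (ll _)) {1}[x (v k)]xd (linZ (lr _)) scalerDl.
Qed.

Definition epsj j : rootlat F I := sgb j *: eps F (idx j).

Lemma epsj_bar j : epsj (bar j) = - epsj j.
Proof. by rewrite /epsj sgb_bar idx_bar scaleNr. Qed.

(** The sum of the coefficients separates the short roots, of odd height, from sums of two of
    them. *)
Definition ht : rootlat F I -> F^o := fglift (fun _ : I => (1 : F^o)).

Lemma ht_lin : linear ht. Proof. exact: fglift_lin. Qed.

Lemma ht_epsj j : ht (epsj j) = sgb j.
Proof. by rewrite /epsj (linZ ht_lin) /ht /eps fglift1 -[_ *: _]/(_ * _) mulr1. Qed.

Lemma sgb_sgn j : exists s : bool, sgb j = (-1) ^+ s.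
Proof. by case: j => i; [exists false; rewrite expr0|exists true; rewrite expr1]. Qed.

Lemma sgn_sgb (s : bool) i : exists j, (-1) ^+ s = sgb j /\ idx j = i.
Proof. by case: s; [exists (inr i); rewrite expr1|exists (inl i); rewrite expr0]. Qed.

Lemma short_epsj a : short_roots a <-> exists j, a = epsj j.
Proof.
split=> [[s [i ->]]|[j ->]].
  by have [j [e <-]] := sgn_sgb s i; exists j; rewrite e.
by have [s e] := sgb_sgn j; exists s, (idx j); rewrite /epsj e.
Qed.

Lemma BCsdivP a : BCsdiv a <-> exists j k, a = epsj j + epsj k.
Proof.
split.
  move=> [BCa ns]; case: BCa => [->|/ns//|[s [i ->]]|[s [t [i [k [_ ->]]]]]].
  - have [i _] := fresh_seq F I0 Iinf [::]; exists (inl i), (bar (inl i)).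
    by rewrite epsj_bar subrr.
  - have [j [e <-]] := sgn_sgb s i; exists j, j; rewrite e -scalerDl -mulr2n scalerA.
    by rewrite mulr_natr.
  - have [j [e <-]] := sgn_sgb s i; have [m [e' <-]] := sgn_sgb t k.
    by exists j, m; rewrite e e'.
move=> [j [k ->]]; split; last first.
  move=> /short_epsj[m /(congr1 ht)]; rewrite (linD ht_lin) !ht_epsj.
  have nz n : (n.+1)%:R = 0 :> F -> False by move/eqP; rewrite natF.
  move/eqP; rewrite -subr_eq0 => /eqP e.
  (* The difference of heights is ±1 or ±3, hence nonzero in characteristic zero; squaring removes
     the sign. *)
  have [e'|e'] : (sgb j + sgb k - sgb m) ^+ 2 = 1%:R \/
                 (sgb j + sgb k - sgb m) ^+ 2 = 9%:R.
  - by case: j k m {e} => j [] k [] m /=; first [by left; ring|by right; ring].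
  - by apply: (nz 0%N); rewrite -e' e expr0n.
  - by apply: (nz 8%N); rewrite -e' e expr0n.
have [jk|jk] := eqVneq (idx j) (idx k); last first.
  have [s e] := sgb_sgn j; have [t e'] := sgb_sgn k.
  apply: Or44; exists s, t, (idx j), (idx k); split; first exact/eqP.
  by rewrite /epsj e e'.
have [<-|jk'] := eqVneq j k.
  have [s e] := sgb_sgn j; apply: Or43; exists s, (idx j).
  by rewrite /epsj e -scalerDl -mulr2n scalerA mulr_natr.
apply: Or41; have [kj|->] := idx_eq (esym jk); first by rewrite kj eqxx in jk'.
by rewrite epsj_bar subrr.
Qed.

Lemma BCP a : BC a <-> (exists j, a = epsj j) \/ (exists j k, a = epsj j + epsj k).
Proof.
split=> [BCa|[/short_epsj sa|/BCsdivP[]//]]; last exact: Or42.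
by have [/short_epsj|] := pselect (short_roots a); [left|right; apply/BCsdivP].
Qed.
End Symplectic.

(** * The grading *)

Section SpanFacts.
Variable F : fieldType.

Lemma lspan_ind (M : lmodType F) (X : set M) (P : M -> Prop) :
  P 0 -> (forall k x y, P x -> P y -> P (k *: x + y)) -> (forall x, X x -> P x) ->
  forall x, x \in lspan X -> P x.
Proof.
move=> P0 Plin PX x /asboolP[s [sX ->]].
elim: s sX => [|p s IH] sX; rewrite ?big_nil ?big_cons //.
apply: (Plin); first by apply: PX; apply: sX; rewrite mem_head.
by apply: IH => r rs; apply: sX; rewrite inE rs orbT.
Qed.

Lemma fgliftE (T : choiceType) (M : lmodType F) (f : T -> M) (a : {freeg T / F}) :
  fglift f a = \sum_(i <- dom a) coeff i a *: f i.
Proof.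
rewrite -{1}(freeg_sumE a) (lin_sum (fglift_lin f)).
by apply: eq_bigr => i _; rewrite liftU.
Qed.

Lemma big_widen_seq (T : eqType) (M : lmodType F) (s t : seq T) (v : T -> M) :
  uniq s -> uniq t -> {subset s <= t} -> (forall a, a \notin s -> v a = 0) ->
  \sum_(a <- t) v a = \sum_(a <- s) v a.
Proof.
move=> us ut st v0; rewrite (bigID (mem s)) /= [X in _ + X]big1 ?addr0 => [|a]; last exact: v0.
rewrite -big_filter; apply: perm_big; apply: uniq_perm; rewrite ?filter_uniq // => a.
by rewrite mem_filter; case: (boolP (a \in s)) => // /st.
Qed.
End SpanFacts.

Section Grading.
Variables (F : fieldType) (I : choiceType) (I0 : {fset I}) (q : BCquadruple F).
Hypothesis F0 : [pchar F] =i pred0.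
Hypothesis ell_gt0 : (0 < ell I0)%N.
Hypothesis Iinf : infinite_set [set: I].
Local Notation alg := (calg q).
Local Notation star := (@cstar F q).
Local Notation f := (@cform F q).
Local Notation V := (vsp F I).
Local Notation J := (I + I)%type.
Local Notation v := (bv F).
Local Notation half := (2%:R^-1 : F).
Local Notation Q := (@Qf F I I0).
Local Notation vk := (@vk F I).
Local Notation vk' := (@vk' F I).
Local Notation rl := (rootlat F I).
Variables (L : lmodType F) (br : L -> L -> L) (gen : bool -> (V -> V) -> alg -> L)
  (VC : V -> cmod q -> L) (ang : bb q -> bb q -> L).
Hypothesis brP : presented I0 br gen VC ang.
Hypothesis gen1_inj : forall x, x \in @spG F I -> gen false x 1 = 0 -> x = 0.
Local Notation Y := (@genQ F I I0 q L gen).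
Local Notation G x := (gen false x 1).
Let brl y : linear (br^~ y). Proof. by have [h _ _ _] := pr_lie brP. Qed.
Let brr x : linear (br x). Proof. by have [_ h _ _] := pr_lie brP. Qed.
Let aP := pr_ang brP.
Let QG d u w : Q d u w \in spd d := Qf_spd F0 ell_gt0 d u w.

(** The image of 𝒢 ⊗ 1. A span is used so that the submodule structure is inherited; [spLP] shows
    that nothing is added. *)
Definition spL : {pred L} := lspan [set y | exists2 x, x \in @spG F I & y = G x].
Definition carL : {pred L} := lspan [set y | exists2 x, @diag_sp F I x & y = G x].

Let Glin k x y : x \in @spG F I -> y \in @spG F I -> G (k *: x + y) = k *: G x + G y.
Proof. exact: (pr_genl brP (d := false)). Qed.

Let G_inj x y : x \in @spG F I -> y \in @spG F I -> G x = G y -> x = y.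
Proof.
move=> xG yG e; apply/eqP; rewrite -subr_eq0; apply/eqP.
have e' : x - y = -1 *: y + x by rewrite scaleN1r addrC.
rewrite e'; apply: gen1_inj; first exact: (@spd_lin _ _ false).
by rewrite Glin // e scaleN1r addNr.
Qed.

Let G0 : G 0 = 0. Proof. exact: gen0l brP false 1. Qed.

Lemma spLP y : y \in spL <-> exists2 x, x \in @spG F I & y = G x.
Proof.
split=> [|yG]; last exact: mem_lspan.
apply: (lspan_ind (P := fun y => exists2 x, x \in @spG F I & y = G x)) => //.
  by exists 0; rewrite ?G0 //; apply: rpred0.
move=> k _ _ [x xG ->] [x' x'G ->]; exists (k *: x + x'); last by rewrite Glin.
exact: (@spd_lin _ _ false).
Qed.

Lemma carLP y : y \in carL <-> exists2 x, @diag_sp F I x & y = G x.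
Proof.
split=> [|yG]; last exact: mem_lspan.
apply: (lspan_ind (P := fun y => exists2 x, @diag_sp F I x & y = G x)) => //.
  exists 0; last by rewrite G0.
  by split=> [|j]; [apply: rpred0|rewrite -[(0 : V -> V) _]/(0 : V) coeff0 scale0r].
move=> k _ _ [x [xG xd] ->] [x' [x'G x'd] ->]; exists (k *: x + x'); last by rewrite Glin.
split=> [|j]; first exact: (@spd_lin _ _ false).
rewrite -[(_ + _) (v j)]/(k *: x (v j) + x' (v j)) coeffD coeffZ scalerDl -scalerA.
by rewrite -xd -x'd.
Qed.

Lemma carL_sub : {subset carL <= spL}.
Proof. by move=> y /carLP[x [xG _] ->]; apply/spLP; exists x. Qed.

Let GG x y : x \in @spG F I -> y \in @spG F I -> br (G x) (G y) = G (mcomm x y).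
Proof. by move=> xG yG; rewrite (br_Ggen F0 brP) ?std1. Qed.

Lemma spL_subalgebra : subalgebra br spL.
Proof.
move=> _ _ /spLP[x xG ->] /spLP[y yG ->]; apply/spLP; exists (mcomm x y); last exact: GG.
exact: mcomm_spGG.
Qed.

Definition mat (y : L) : V -> V := xget 0 [set x | x \in @spG F I /\ y = G x].

Lemma matK x : x \in @spG F I -> mat (G x) = x.
Proof.
move=> xG; rewrite /mat; case: xgetP => [z _ [zG e]|/(_ x)[]//].
by apply: G_inj.
Qed.

Lemma spL_mat y : y \in spL -> mat y \in @spG F I /\ y = G (mat y).
Proof. by case/spLP => x xG ->; rewrite matK. Qed.

Lemma mat_lin k y z : y \in spL -> z \in spL -> mat (k *: y + z) = k *: mat y + mat z.
Proof.
case/spLP=> x xG -> /spLP[x' x'G ->]; rewrite -Glin // !matK //.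
exact: (@spd_lin _ _ false).
Qed.

(** All matrices supported over a finite t0 form a subalgebra spanned by the finitely many v_j ∘ v_k
    over t0, and it contains the given elements once t0 is large enough. *)
Lemma spL_lfin : locally_finite br spL.
Proof.
move=> s sG.
have [t0 ut t0s] : exists2 t, uniq t & {in s, forall y, msupp t (mat y)}.
  elim: s sG => [|y s IH] sG; first by exists [::].
  have [t ut ts] := IH (fun z zs => sG z (mem_behead (s := y :: s) zs)).
  have [yG _] := spL_mat (sG y (mem_head _ _)).
  have [t' _ t'y] := @spd_supp _ _ false _ yG.
  exists (undup (t ++ t')); first exact: undup_uniq.
  move=> z; rewrite inE => /orP[/eqP->|/ts tz]; [apply: msuppW t'y|apply: msuppW tz] => i;
    by rewrite mem_undup mem_cat => ->; rewrite ?orbT.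
pose js : seq J := [seq inl i | i <- t0] ++ [seq inr i | i <- t0].
have jsP j : (j \in js) = (idx j \in t0).
  rewrite mem_cat; apply/orP/idP => [[] /mapP[i it ->]//|].
  by case: j => i it; [left|right]; apply: map_f.
pose t := [seq G (vcirc (v j) (v k)) | j <- js, k <- js]; 
have msupp_vcirc j k : idx j \in t0 -> idx k \in t0 -> msupp t0 (vcirc (v j) (v k)).
  move=> jt kt; have tj := vsupp_bv F jt; have tk := vsupp_bv F kt; split=> [m mt|u].
    by rewrite /vcirc (vsupp_vform tj mt) (vsupp_vform tk mt) !scale0r addr0 scaler0.
  have t00 := @vsupp0 F I t0.
  by rewrite /vcirc -[half *: _]addr0; do 2?apply: vsupp_lin => //; rewrite -[_ *: _]addr0; apply: vsupp_lin.
have tQ j k : idx j \in t0 -> idx k \in t0 -> G (Q false (v j) (v k)) \in lspan [set` t].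
  by move=> jt kt; apply: mem_lspan; apply/allpairsP; exists (j, k); rewrite !jsP QfF.
have fin y : y \in @spG F I -> msupp t0 y -> G y \in lspan [set` t].
  move=> yG ty; have [e _] := @spd_decomp _ _ I0 F0 false _ _ yG ut ty.
  have Qt u k : idx k \in t0 -> vsupp t0 u -> G (Q false u (v k)) \in lspan [set` t].
    move=> kt tu; rewrite (vsumE u); have : {subset dom u <= js}.
      move=> j; apply: contraTT; rewrite jsP => /tu uj; rewrite mem_dom.
      by rewrite uj eqxx.
    elim: (dom u) => [|j ds IH] dj; first by rewrite big_nil
      (lin0 (fun k x y => Qf_linl F0 ell_gt0 false (v _) k x y)) G0 rpred0.
    rewrite big_cons Qf_linl // Glin //; apply: rpredD; last first.
      by apply: IH => m mds; apply: dj; rewrite inE mds orbT.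
    by apply: rpredZ; apply: tQ => //; rewrite -jsP; apply: dj; rewrite mem_head.
  rewrite e (genZl brP) ?(gen_omega brP) //; first last.
    set W := omega _ _ in e *; have -> : W = (- 2%:R) *: y.
      by rewrite e scalerA mulrNN mulfV ?F2 // scale1r.
    exact: (@spdZ _ _ false).
  apply: rpredZ.
  rewrite /omega big_seq; apply: rpred_sum => i it; apply: rpredB; apply: Qt => //; exact: ty.2.
exists t => x0; apply.
- have tm y : y \in t -> exists x, [/\ x \in @spG F I, msupp t0 x & y = G x].
    move=> /allpairsP[[j k] /= [+ + ->]]; rewrite !jsP => jt kt.
    by exists (vcirc (v j) (v k)); split=> //; [exact: vcirc_spG|exact: msupp_vcirc].
  move=> y z yt zt; move: y yt z zt.
  apply: (lspan_ind (P := fun y => forall z, z \in lspan [set` t] -> br y z \in lspan [set` t])).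
  + by move=> z _; rewrite (lin0 (brl z)) rpred0.
  + by move=> k x y tx ty z zt; rewrite (brl z); apply: rpredD; [apply/rpredZ/tx|apply: ty].
  move=> y /tm[x [xG tx ->]] z.
  apply: (lspan_ind (P := fun z => br (G x) z \in lspan [set` t])).
  + by rewrite (lin0 (brr _)) rpred0.
  + by move=> k a b ta tb; rewrite (brr (G x)); apply: rpredD => //; apply: rpredZ.
  move=> a /tm[w [wG tw ->]]; rewrite GG //; apply: fin; first exact: mcomm_spGG.
  have lx := @spd_linear _ _ false x xG; have lw := @spd_linear _ _ false w wG.
  split=> [j jt|u].
    rewrite -[mcomm _ _ _]/(x (w (v j)) - w (x (v j))) tw.1 // tx.1 //.
    by rewrite (lin0 lx) (lin0 lw) subrr.
  rewrite -[mcomm _ _ _]/(x (w u) - w (x u)) -scaleN1r addrC.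
  by apply: vsupp_lin; [exact: tw.2|exact: tx.2].
- move=> y ys; have [yG ->] := spL_mat (sG y ys).
  by apply: fin => //; apply: t0s.
Qed.

Lemma spL_simple : simple br spL.
Proof.
have [i _] := fresh_seq F I0 Iinf [::]; split.
  (* The second element is an eigenvector of the first with eigenvalue -2. *)
  exists (G (@cartan_elt F I i)), (G (Q false (v (inl i)) (v (inl i)))).
  have [hG hd] := cartan_elt_diag F0 i; have QG' := QG false (v (inl i)) (v (inl i)).
  split; try by apply/spLP; eexists; last reflexivity.
  rewrite GG // (diag_mcomm_Q F0 ell_gt0) // (genZl brP) //; apply/eqP.
  move/(congr1 (fun z => (- 2%:R^-1 : F) *: z)); rewrite scaler0 scalerA (coeff_cartan_elt F0).
  rewrite coeff_bv !eqxx mulr1 mul1r /= => e.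
  have := vcirc_neq0 F0 (inl i) (inl i); rewrite -(QfF I0) => /eqP; apply.
  apply: gen1_inj => //; rewrite -e -[LHS]scale1r; congr (_ *: _).
  by field; rewrite F2.
move=> N NG Nid; have [N0|] := pselect (forall x, x \in N -> x = 0); first by left.
move=> /existsNP[y /not_implyP[yN /eqP y0]]; right.
have [y1 y1G yE] := (spLP y).1 (NG y yN).
pose X x := x \in @spG F I /\ G x \in N.
have XG x : x \in @spG F I -> X x.
  apply: (@ideal_all _ _ I0 F0 ell_gt0 Iinf X _ _ _ y1).
  - move=> k a b [aG aN] [bG bN]; split; first exact: (@spd_lin _ _ false).
    by rewrite Glin //; apply: rpredD => //; apply: rpredZ.
  - by move=> ? [].
  - move=> g a gG [aG aN]; split; first exact: mcomm_spGG.
    by rewrite -GG //; apply: Nid => //; apply/spLP; exists g.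
  - by split; rewrite -?yE.
  - by apply: contraNneq y0 => y10; rewrite yE y10 G0.
by move=> _ /spLP[x xG ->]; have [] := XG x xG.
Qed.

Let tval (y : submod carL) : exists2 x, @diag_sp F I x & val y = G x.
Proof. by apply/carLP; exact: valP. Qed.

Let tvalK x : @diag_sp F I x -> exists y : submod carL, val y = G x.
Proof.
move=> xd; exists (tosub carL (G x)); apply: tosubK.
by apply/carLP; exists x.
Qed.

(** The linear extension of the map sending ε_i to the functional that reads the diagonal entry at
    i. *)
Definition wt (a : rl) (y : submod carL) : F^o :=
  fglift (fun i : I => coeff (inl i) (mat (val y) (v (inl i))) : F^o) a.

Lemma wt_lin : linear wt.
Proof. by move=> k a b; apply/funext => y; rewrite /wt fglift_lin. Qed.

Lemma wt_linear a : linear (wt a).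
Proof.
move=> k y z; rewrite /wt !fgliftE scaler_sumr -big_split; apply: eq_bigr => i _ /=.
rewrite (mat_lin k (carL_sub (valP y)) (carL_sub (valP z))).
rewrite -[(_ + _ : V -> V) _]/(k *: mat (val y) (v (inl i)) + mat (val z) (v (inl i))).
by rewrite coeffD coeffZ -[LHS]/(_ * (_ * _ + _)) -[RHS]/(_ * (_ * _) + _ * _); ring.
Qed.

Lemma wt_epsj j y x : @diag_sp F I x -> val y = G x -> wt (epsj F j) y = coeff j (x (v j)).
Proof.
move=> xd yE; have [xG _] := xd; rewrite /wt /epsj (linZ (fglift_lin _)) fglift1 yE matK //.
case: j => i; rewrite /= ?scale1r // scaleN1r.
by rewrite (diag_sp_bar F0 (inl i) xd).
Qed.

(** Evaluation at [cartan_elt i] reads off minus the coefficient at i. *)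
Lemma wt_inj : injective wt.
Proof.
move=> a b /(congr1 (fun w => w - wt b)); rewrite subrr -(linB wt_lin) => e.
apply/eqP; rewrite -subr_eq0; apply/eqP; move: (a - b) e => c e.
apply/eqP/freeg_eqP => i; have [y yE] := tvalK (cartan_elt_diag F0 i).

have := congr1 (fun w => w y) e; rewrite /wt fgliftE yE matK; last by have [] := cartan_elt_diag F0 i.
have -> : (0 : submod carL -> F^o) y = 0 by [].
rewrite coeff0 => e0; apply/eqP; rewrite -oppr_eq0 -e0; apply/eqP.
under eq_bigr => k _.
  rewrite coeff_cartan_elt // coeff_bv eqxx !mulr1 /= -[_ *: _]/(_ * _) mulrN; over.
rewrite sumrN; congr (- _); have [ic|ic] := boolP (i \in dom c).
  rewrite (bigD1_seq i) ?uniq_dom //= eqxx mulr1 big1 ?addr0 // => k /negbTE->.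
  by rewrite mulr0.
rewrite coeff_outdom // big_seq big1 // => k kc.
by case: eqP kc => [->|_ _]; rewrite ?(negbTE ic) // mulr0.
Qed.

Lemma diag_coeff x m w : @diag_sp F I x -> coeff m (x w) = coeff m (x (v m)) * coeff m w.
Proof.
move=> [xG xd]; have lx := @spd_linear _ _ false x xG.
apply: (@linear_ext F I F^o (fun w => coeff m (x w)) (fun w => coeff m (x (v m)) * coeff m w)).
- by move=> k a b; rewrite lx coeffD coeffZ.
- by move=> k a b; rewrite coeffD coeffZ -[RHS]/(_ * (_ * _) + _ * _); ring.
move=> j; rewrite xd coeffZ coeff_bv; case: eqP => [->|_]; first by [].
by rewrite !mulr0.
Qed.

Lemma cartan_max (h' : submodClosed L) : {subset carL <= h'} -> {subset h' <= spL} ->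
  abelian br h' -> {subset h' <= carL}.
Proof.
move=> hh' h'g ab y yh'; have [x xG yE] := (spLP y).1 (h'g y yh').
apply/carLP; exists x => //; apply: (diag_commute F0 xG) => i.
have [hG hd] := cartan_elt_diag F0 i; apply: gen1_inj; first exact: mcomm_spGG.
by rewrite -GG // -yE; apply: ab => //; apply: hh'; apply/carLP; exists (@cartan_elt F I i).
Qed.

Local Notation wsp a := (weight_space br (wt a)).

Let wtD a b y : wt (a + b) y = wt a y + wt b y.
Proof. by rewrite (linD wt_lin). Qed.

Let wt0 y : wt 0 y = 0. Proof. by rewrite (lin0 wt_lin). Qed.

Lemma wsp_lin a k x y : wsp a x -> wsp a y -> wsp a (k *: x + y).
Proof.
move=> xa ya h; rewrite (brr _) xa ya scalerDr !scalerA.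
by congr (_ + _); rewrite mulrC.
Qed.

Lemma wsp0 a : wsp a 0.
Proof. by move=> h; rewrite (lin0 (brr _)) scaler0. Qed.

Lemma wsp_gen d j k a : a \in std d -> wsp (epsj F j + epsj F k) (gen d (Q d (v j) (v k)) a).
Proof.
move=> ad h; have [x xd hE] := tval h; rewrite hE (br_Ggen F0 brP) ?QG //; last by case: xd.
rewrite (diag_mcomm_Q F0 ell_gt0) // (genZl brP) ?QG // wtD.
by rewrite !(wt_epsj _ xd hE).
Qed.

Lemma wsp_VC j c : wsp (epsj F j) (VC (v j) c).
Proof.
move=> h; have [x xd hE] := tval h; rewrite hE (br_GVC brP); last by case: xd.
by rewrite (xd.2 j) (linZ (pr_VCl brP c)) (wt_epsj _ xd hE).
Qed.

Lemma wsp_ang b b' : wsp 0 (ang b b').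
Proof.
move=> h; have [x xd hE] := tval h; have [xG _] := xd.
rewrite hE wt0 scale0r (br_anti brP) (pr_ang_gen brP b b' (d := false)) ?std1 //.
rewrite /comm mul1r mulr1 subrr (gen0r brP) diag_mcomm_idI0 // (gen0l brP) !addr0.
by rewrite mul0r scale0r addr0 scaler0 !oppr0.
Qed.

Lemma wsp_br a b x y : wsp a x -> wsp b y -> wsp (a + b) (br x y).
Proof.
move=> xa yb h; rewrite (br_jac brP) xa yb (linZ (brl _)) (linZ (brr _)) wtD.
by rewrite scalerDl.
Qed.

Lemma wsp_ind (P : L -> Prop) : P 0 -> (forall k x y, P x -> P y -> P (k *: x + y)) ->
  (forall d j k a, a \in std d -> P (gen d (Q d (v j) (v k)) a)) ->
  (forall j c, P (VC (v j) c)) -> (forall b b', P (ang b b')) -> forall z, P z.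
Proof.
move=> P0 Plin Pg PV Pa; apply: (pr_ind brP) => // [d x a xd ad|u c].
  move: x xd; apply: (spd_ind F0 ell_gt0 (I0 := I0)) => [||j k]; last exact: Pg.
    by rewrite (gen0l brP).
  by move=> k x y xd yd Px Py; rewrite (pr_genl brP) //; apply: Plin.
rewrite (vsumE u) (lin_sum (pr_VCl brP c)); elim: (dom u) => [|j s IH].
  by rewrite big_nil.
by rewrite big_cons (linZ (pr_VCl brP c)); apply: (Plin) => //; exact: PV.
Qed.

(** Acting by h and subtracting [wt a h] times the relation removes the term at a; by induction each
    ([wt b h] - [wt a h]) [x b] is 0, and [wt_inj] provides an h with nonzero factor. *)
Lemma wsp_free (s : seq rl) (x : rl -> L) : uniq s -> {in s, forall a, wsp a (x a)} ->
  \sum_(a <- s) x a = 0 -> {in s, forall a, x a = 0}.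
Proof.
elim: s x => [|a s IH] x //= /andP[as_ us] xw; rewrite big_cons => x0.
have xa : wsp a (x a) by apply: xw; rewrite mem_head.
have xs b : b \in s -> wsp b (x b) by move=> bs; apply: xw; rewrite inE bs orbT.
pose w h b : F := wt b h.
have diff h b : b \in s -> (w h b - w h a) *: x b = 0.
  apply: (IH (fun b => (w h b - w h a) *: x b)) => // [c cs|].
    by rewrite -[_ *: _]addr0; apply: wsp_lin; [exact: xs|exact: wsp0].
  have := congr1 (br (val h)) x0; rewrite (linD (brr _)) (lin_sum (brr _)) xa (lin0 (brr _)).
  under [X in _ -> X = _]eq_bigr do rewrite scalerBl.
  rewrite sumrB -scaler_sumr => e.
  have e' : \sum_(b <- s) x b = - x a by apply/eqP; rewrite -addr_eq0 addrC x0.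
  rewrite e' scalerN opprK addrC -[RHS]e; congr (_ + _).
  by rewrite big_seq [RHS]big_seq; apply: eq_bigr => c cs; rewrite xs.
have xs0 b : b \in s -> x b = 0.
  move=> bs; have ba : b <> a by move=> e; rewrite -e bs in as_.
  apply: contrapT => /eqP xb0; apply: ba; apply: wt_inj; apply/funext => h.
  apply/eqP; rewrite -subr_eq0; apply: contraNT xb0 => nz.
  by apply/eqP; apply: (scaler_cancel nz); rewrite scaler0 diff.
move=> b; rewrite inE => /orP[/eqP->|]; last exact: xs0.
by move: x0; rewrite big_seq big1 ?addr0.
Qed.

Lemma spL_splitting : splitting_cartan br spL carL.
Proof.
split; [exact: carL_sub| |exact: cartan_max|].
  move=> _ _ /carLP[x xd ->] /carLP[y yd ->].
  have [[xG _] [yG _]] := (xd, yd); rewrite GG //.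
  suff -> : mcomm x y = 0 by rewrite G0.
  apply/funext => u; apply: vspP => j; rewrite -[mcomm _ _ _]/(x (y u) - y (x u)).
  rewrite coeffB (diag_coeff j (y u) xd) (diag_coeff j (x u) yd) (diag_coeff j u xd) (diag_coeff j u yd).
  by rewrite -[(0 : V -> V) _]/(0 : V) coeff0; ring.
move=> _ /spLP[x xG ->]; move: x xG; apply: (spd_ind F0 ell_gt0 (I0 := I0) (d := false)).
- by rewrite G0 rpred0.
- by move=> k x y xG yG xs ys; rewrite Glin //; apply: rpredD => //; apply: rpredZ.
move=> j k; apply: mem_lspan; exists (wt (epsj F j + epsj F k)).
split; first exact: wt_linear.
split; last exact: (wsp_gen (d := false) _ _ (std1 q)).
by apply/spLP; exists (Q false (v j) (v k)).
Qed.

Lemma spL_roots : Defs.roots br spL carL = wt @` @BCsdiv F I.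
Proof.
apply/seteqP; split=> [lam [llam [y [y0 [/spLP[x xG yE] yw]]]]|_ [a /(BCsdivP I0 F0 Iinf)[j [k ->]] <-]].
  have lx := @spd_linear _ _ false x xG.
  have [j xj0] : exists j, x (v j) != 0.
    apply: contrapT => /forallNP h; case/eqP: y0; rewrite yE -G0; congr (gen _ _ _).
    apply/funext => u; apply: (linear_ext lx (g := 0)) => [k a b|i]; first by rewrite scaler0 addr0.
    by have /negP/negPn/eqP := h i.
  have [m xm0] : exists m, coeff m (x (v j)) != 0.
    apply: contrapT => /forallNP h; case/eqP: xj0; apply: vspP => i.
    by have /negP/negPn/eqP-> := h i; rewrite coeff0.
  (* A single nonzero entry at (m, j) determines the weight: h multiplies it by the difference of
     the diagonal entries at m and j. *)
  exists (epsj F m + epsj F (bar j)); first by apply/(BCsdivP I0 F0 Iinf); exists m, (bar j).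
  apply/funext => h; have [z zd hE] := tval h; have [zG _] := zd.
  rewrite wtD !(wt_epsj _ zd hE) (diag_sp_bar F0 j zd).
  have := yw h; rewrite hE yE GG // -(genZl brP) // => /G_inj e.
  have {}e : mcomm z x = lam h *: x.
    by apply: e; [exact: mcomm_spGG|exact: (@spdZ _ _ false)].
  apply: (mulIf xm0); have := congr1 (fun w : V -> V => coeff m (w (v j))) e.
  rewrite -[mcomm _ _ _]/(z (x (v j)) - x (z (v j))) -[(_ *: x) _]/(_ *: x (v j)).
  rewrite coeffB coeffZ (diag_coeff m (x (v j)) zd) (zd.2 j) (linZ lx) coeffZ -zd.2 => <-.
  by ring.
split; first exact: wt_linear.
exists (G (Q false (v j) (v k))); split; last first.
  split; last exact: (wsp_gen (d := false) _ _ (std1 q)).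
  by apply/spLP; exists (Q false (v j) (v k)).
apply: contraNneq (vcirc_neq0 F0 j k) => e; rewrite -(QfF I0).
by apply/eqP; apply: gen1_inj.
Qed.

Lemma spL_direct_sum : direct_sum (@BC F I) (fun a => weight_space br (wt a)).
Proof.
split=> [|s x us xs x0]; last by apply: wsp_free x0 => // a /xs[].
apply: wsp_ind => [|k x y|d j k a ad|j c|b b'].
- exact: rpred0.
- by move=> xs ys; apply: rpredD => //; apply: rpredZ.
- apply: mem_lspan; exists (epsj F j + epsj F k); split; last exact: wsp_gen.
  by apply/(BCP I0 F0 Iinf); right; exists j, k.
- apply: mem_lspan; exists (epsj F j); split; last exact: wsp_VC.
  by apply/(BCP I0 F0 Iinf); left; exists j.
apply: mem_lspan; exists 0; split; last exact: wsp_ang.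
exact: Or41.
Qed.

(** * The weight space of 0 *)

Local Notation Z := (lspan [set z | exists a y y',
  [/\ @BC F I a /\ a <> 0, wsp a y, wsp (- a) y' & z = br y y']]).

Lemma coeff_epsj (i : I) (j : J) : coeff i (epsj F j) = sgb F j * (idx j == i)%:R.
Proof. by rewrite /epsj coeffZ coeffU mul1r. Qed.

Lemma epsj_neq0 (j : J) : epsj F j <> 0.
Proof.
move/(congr1 (coeff (idx j))); rewrite coeff_epsj coeff0 eqxx mulr1 => /eqP.
by rewrite (negbTE (sgb0 F j)).
Qed.

Lemma epsj_add0 (j k : J) : epsj F j + epsj F k = 0 -> k = bar j.
Proof.
move/(congr1 (coeff (idx j))); rewrite coeffD !coeff_epsj coeff0 eqxx mulr1.
have [kj|_ /eqP] := eqVneq (idx k) (idx j); last by rewrite mulr0 addr0 (negbTE (sgb0 F j)).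
have [->|//] := idx_eq kj; rewrite mulr1 -mulr2n -mulr_natl => /eqP.
by rewrite mulf_eq0 (negbTE (F2 F0)) (negbTE (sgb0 F j)).
Qed.

Let inZ a b x y : @BC F I a -> a <> 0 -> a + b = 0 -> wsp a x -> wsp b y -> br x y \in Z.
Proof.
move=> Ba a0 /eqP; rewrite addrC addr_eq0 => /eqP-> xa yb.
by apply: mem_lspan; exists a, x, y.
Qed.

Lemma wsp_Y j k x : wsp (epsj F j + epsj F k) (Y (v j) (v k) x).
Proof.
rewrite -[Y _ _ _]scale1r -[1 *: _]addr0; apply: wsp_lin; last exact: wsp0.
rewrite -[Y _ _ _]/(gen false _ (cpart false x) + gen true _ (cpart true x)).
by rewrite -[gen false _ _]scale1r; apply: wsp_lin; apply: wsp_gen; apply: cpart_std.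
Qed.

Let ZYY j k x y : epsj F j + epsj F k <> 0 ->
  br (Y (v j) (v k) x) (Y (v (bar k)) (v (bar j)) y) \in Z.
Proof.
move=> n0; apply: inZ n0 _ (wsp_Y _ _ _) (wsp_Y _ _ _).
  by apply/(BCP I0 F0 Iinf); right; exists j, k.
by rewrite !epsj_bar; apply/eqP; rewrite addr_eq0 opprD !opprK addrC.
Qed.

(** Each summand is [idI0]/ℓ minus the projection onto the span of v_m and v_m̄, and these
    projections over I0 add up to [idI0]. *)
Lemma Q_sum : \sum_(m <- I0) Q true (vk m) (vk' m) = 0.
Proof.
apply/funext => z; rewrite fct_sumE.
have E m : Q true (vk m) (vk' m) z = (ell I0)%:R^-1 *: idI0 I0 z
    - (coeff (inl m) z *: vk m + coeff (inr m) z *: vk' m).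
  rewrite QfD expr1 vform_vk mul1r (@vform_bvl _ _ (inl m)) (@vform_bvl _ _ (inr m)) /=.
  by lmod F (Defs.vsp F I); field; rewrite ?F2 ?ellF0.
under eq_bigr do rewrite E.
rewrite sumrB big_const_seq count_predT iter_addr_0 -/(ell I0).
rewrite -scaler_nat scalerA mulfV ?ellF0 // scale1r.
by rewrite {1}/idI0 fct_sumE subrr.
Qed.

Let ne (m n : I) : m != n -> epsj F (inl m) + epsj F (inr n) <> 0.
Proof. by move=> mn /epsj_add0 /=; case=> nm; rewrite nm eqxx in mn. Qed.

Let ne2 (m n : I) : m != n -> epsj F (inl m) + epsj F (inl n) <> 0.
Proof. by move=> mn /epsj_add0. Qed.

(** The bracket of root vectors of weights ±(ε_k + ε_m). The contraction leaving m exchanges slots,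
    hence the starred coordinates there. *)
Let cross k m x y : m != k ->
  Y (vk k) (vk' k) (x * y) + Y (vk m) (vk' m) (star x * star y)
    - 2%:R *: ang (of_alg x) (of_alg y) \in Z.
Proof.
move=> mk; have km : k != m by rewrite eq_sym.
have h : br (Y (vk k) (vk m) x) (Y (vk' m) (vk' k) y) \in Z := ZYY x y (ne2 km).
have [e1 _ /(_ km)[e4 _]] := vform_vkk F k m; have [_ e2 /(_ mk)[e3 _]] := vform_vkk F m k.
move: h; rewrite (br_YY F0 ell_gt0 brP _ _ e1 e2) !vform_vk e3 e4.
rewrite !scale0r !addr0 (_ : half *: _ - _ = Y (vk k) (vk' k) (x * y) +
  Y (vk m) (vk' m) (star x * star y) - 2%:R *: ang (of_alg x) (of_alg y)) //.
by lmod F L; field; rewrite F2.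
Qed.

Let shift k m x : m != k -> Y (vk k) (vk' k) x - Y (vk m) (vk' m) x \in Z.
Proof.
move=> mk; have km : k != m by rewrite eq_sym.
have h : br (Y (vk k) (vk' m) x) (Y (vk m) (vk' k) 1) \in Z := ZYY x 1 (ne km).
have [e1 _ /(_ km)[e2 _]] := vform_vkk F k m; have [_ e3 /(_ mk)[e4 _]] := vform_vkk F m k.
move: h; rewrite (br_YY F0 ell_gt0 brP _ _ e2 e4) vform_vk vform_vk' e1 e3.
rewrite star1 (bl_1r aP) !scale0r !scaler0 !addr0 !mulr1 (genQ_swap F0 ell_gt0 brP (vk m)) cstarK.
rewrite scaler0 subr0 (_ : half *: _ = - (Y (vk k) (vk' k) x - Y (vk m) (vk' m) x)); last first.
  by lmod F L; field; rewrite F2.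
by rewrite rpredN.
Qed.

(* For x in ℬ only differences over two indices are visibly brackets; they suffice
   because of [Q_sum]. *)
Lemma YkZ k x : Y (vk k) (vk' k) x \in Z.
Proof.
rewrite -(cpart_sum F0 x) (linD (genQ_linr brP _ _)); apply: rpredD.
  (* For a coordinate in 𝒜, [cross] with y = 1 yields the sum over the indices k and m and [shift]
     the difference; half their sum isolates k. *)
  have [m] := fresh_seq F I0 Iinf [:: k]; rewrite inE => mk.
  have h1 := cross (cpart false x) 1 mk; have h2 := shift (cpart false x) mk.
  have /star_std sx := cpart_std false x.
  move: h1; rewrite star1 !mulr1 (bl_1r aP) scaler0 subr0 sx expr0 scale1r => h1.
  have := rpredZ half (rpredD h1 h2); rewrite (_ : half *: _ = Y (vk k) (vk' k) (cpart false x)) //.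
  by lmod F L; field; rewrite F2.
have bB := cpart_std true x; move: (cpart true x) bB => b bB.
have s0 : \sum_(m <- I0) Y (vk m) (vk' m) b = 0.
  have := gen0l brP true b; rewrite -Q_sum => {2}<-.
  elim: (enum_fset I0) => [|m s IH]; first by rewrite !big_nil (gen0l brP).
  rewrite !big_cons (genDl brP) ?QG -?IH ?(genQ_gen F0 brP (d := true)) //.
  elim: (s) => [|n t tS]; first by rewrite big_nil spd0.
  by rewrite big_cons; apply: (@spdD _ _ true) tS; apply: QG.
have : \sum_(m <- I0) (Y (vk k) (vk' k) b - Y (vk m) (vk' m) b) \in Z.
  apply: rpred_sum => m _; have [->|mk] := eqVneq m k; first by rewrite subrr rpred0.
  exact: shift.
rewrite sumrB s0 subr0 big_const_seq count_predT iter_addr_0 -/(ell I0) -scaler_nat => h.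
by have := rpredZ (ell I0)%:R^-1 h; rewrite scalerA mulVf ?ellF0 // scale1r.
Qed.

Lemma angZ b b' : ang b b' \in Z.
Proof.
have two x : 2%:R *: x \in Z -> x \in Z.
  by move=> h; rewrite -[x]scale1r -(mulVf (F2 F0)) -scalerA; apply: rpredZ.
have [k _] := fresh_seq F I0 Iinf [::]; rewrite (bl_split aP); apply: rpredD; apply: two.
  have [m] := fresh_seq F I0 Iinf [:: k]; rewrite inE => mk.
  have := cross b.1 b'.1 mk; rewrite -opprB rpredN => h.
  by rewrite -[X in X \in _](subrK (Y (vk k) (vk' k) (b.1 * b'.1) +
    Y (vk m) (vk' m) (star b.1 * star b'.1))); apply: rpredD => //; apply: rpredD; apply: YkZ.
have : br (VC (vk k) b.2) (VC (vk' k) b'.2) \in Z.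
  apply: inZ (@epsj_neq0 (inl k)) _ (wsp_VC _ _) (wsp_VC (inr k) _).
    by apply/(BCP I0 F0 Iinf); left; exists (inl k).
  by rewrite -[inr k]/(bar (inl k)) epsj_bar subrr.
rewrite (br_VCVC brP) vform_vk => h.
rewrite -[X in X \in _](addKr (Y (vk k) (vk' k) (f b.2 b'.2))).
by apply: rpredD => //; rewrite rpredN; apply: YkZ.
Qed.

(** Every element is the sum of an element of Z and vectors of nonzero weights; for an element of
    weight 0 the latter vanish by [wsp_free]. *)
Lemma wsp0_Z : weight_space br (wt 0) = [set` Z].
Proof.
have Zw z : z \in Z -> wsp 0 z.
  apply: (lspan_ind (P := fun z => wsp 0 z)); [exact: wsp0|exact: wsp_lin|].
  by move=> _ [a [y [y' [_ ya y'a ->]]]]; rewrite -(subrr a); apply: wsp_br.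
apply/seteqP; split=> z; last exact: Zw.
pose P z := exists z0 (s : seq rl) (x : rl -> L), [/\ z0 \in Z, uniq s /\ 0 \notin s,
  forall a, wsp a (x a), forall a, a \notin s -> x a = 0 & z = z0 + \sum_(a <- s) x a].
have PZ y : y \in Z -> P y.
  move=> yZ; exists y, [::], (fun=> 0); split=> //; first by move=> a; apply: wsp0.
  by rewrite big_nil addr0.
have Pw a y : a <> 0 -> wsp a y -> P y.
  move=> /eqP a0 ya; exists 0, [:: a], (fun b => if b == a then y else 0); split.
  - exact: rpred0.
  - by rewrite inE eq_sym.
  - by move=> b; case: eqP => [->|_]; [|apply: wsp0].
  - by move=> b; rewrite inE => /negbTE->.
  by rewrite big_seq1 eqxx add0r.
suff Pall : forall z, P z.
  move=> w0; have [z0 [s [x [z0Z [us s0] xw xs zE]]]] := Pall z.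
  pose x' a := if a == 0 then z0 - z else x a.
  have e : \sum_(a <- 0 :: s) x' a = 0.
    rewrite big_cons {1}/x' eqxx zE opprD addrA subrr add0r addrC.
    rewrite [X in X - _]big_seq (eq_bigr x) -?big_seq ?subrr // => a as_.
    by rewrite /x'; case: eqP as_ s0 => // -> ->.
  have : x' 0 = 0.
    apply: (wsp_free (s := 0 :: s)) e _ _; rewrite /= ?s0 ?mem_head // => a _.
    rewrite /x'; case: eqP => [->|_]; last exact: xw.
    by rewrite -scaleN1r addrC; apply: wsp_lin => //; apply: Zw.
  by rewrite /x' eqxx => /eqP; rewrite subr_eq0 => /eqP <-.
apply: wsp_ind => [|k x y|d j m a ad|j c|b b'].
- exact: PZ (rpred0 _).
- move=> [z1 [s1 [x1 [z1Z [us1 s10] xw1 xs1 ->]]]] [z2 [s2 [x2 [z2Z [us2 s20] xw2 xs2 ->]]]].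
  exists (k *: z1 + z2), (undup (s1 ++ s2)), (fun a => k *: x1 a + x2 a); split.
  + by apply: rpredD => //; apply: rpredZ.
  + by rewrite undup_uniq mem_undup mem_cat negb_or s10.
  + by move=> a; apply: wsp_lin.
  + move=> a; rewrite mem_undup mem_cat negb_or => /andP[a1 a2].
    by rewrite xs1 // xs2 // scaler0 addr0.
  rewrite big_split /= -scaler_sumr.
  rewrite (big_widen_seq us1 (undup_uniq _) _ xs1) => [|a as1]; last by rewrite mem_undup mem_cat as1.
  rewrite (big_widen_seq us2 (undup_uniq _) _ xs2) => [|a as2]; last by rewrite mem_undup mem_cat as2 orbT.
  by rewrite scalerDr addrACA.
- have [/epsj_add0->|jm] := pselect (epsj F j + epsj F m = 0); last by apply: Pw jm _; apply: wsp_gen.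
  apply: PZ; rewrite -(genQ_gen F0 brP) //.
  case: j => k; first exact: YkZ.
  by rewrite (genQ_swap F0 ell_gt0 brP); apply: YkZ.
- by apply: Pw (@epsj_neq0 j) _; apply: wsp_VC.
by apply: PZ; apply: angZ.
Qed.

Lemma presented_graded : BC_graded I br.
Proof.
split; first exact: pr_lie brP.
exists (spL : submodClosed L), (carL : submodClosed L); split.
- exact: spL_subalgebra.
- exact: spL_lfin.
- exact: spL_simple.
- exact: spL_splitting.
exists wt; split.
- by split; [exact: wt_linear|exact: wt_lin].
- exact: wt_inj.
- exact: spL_roots.
- exact: spL_direct_sum.
exact: wsp0_Z.
Qed.
End Grading.

(** * The kernel 𝒦₀ *)

Section Splitting.
Variables (F : fieldType) (U E : lmodType F) (K : submodClosed U) (g : U -> E).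
Hypothesis g_lin : linear g.

(* A span rather than a comprehension, to inherit its submodClosed structure. *)
Definition ker_in : {pred U} := lspan [set z | z \in K /\ g z = 0].

Lemma ker_inP z : z \in ker_in <-> z \in K /\ g z = 0.
Proof.
split=> [|zK]; last exact: mem_lspan.
apply: (lspan_ind (P := fun z => z \in K /\ g z = 0)) => //.
  by split; [apply: rpred0|apply: lin0].
move=> k x y [xK x0] [yK y0]; split; first by apply: rpredD => //; apply: rpredZ.
by rewrite g_lin x0 y0 scaler0 addr0.
Qed.

(** The map z ↦ (z modulo K, g z) has kernel exactly K ∩ ker g, hence is injective on the quotient
    by [ker_in]. Here low is the part shared by L0 and L, and p the projection to that quotient. *)
Lemma splitting (L0 L : lmodType F) (low : L0 -> L) (p : L0 -> quotm ker_in)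
    (i : quotm K -> L) (theta : L -> E) :
  linear low -> linear p -> linear i -> linear theta ->
  (forall x y, low x = low y -> p x = p y -> x = y) ->
  (forall x y t t', low x + i t = low y + i t' -> low x = low y /\ t = t') ->
  exists phi : L0 -> L * E, [/\ linear phi, injective phi &
    forall x z, p x = qproj ker_in z ->
      phi x = (low x + i (qproj K z), theta (low x) + g z)].
Proof.
move=> low_lin p_lin i_lin theta_lin lowp lowi.
have [|pr [pr_lin prE]] := quotm_lift (S := ker_in) (fun k x y => qproj_linear K k x y).
  by move=> x /ker_inP[xK _]; rewrite -(lin0 (qproj_linear K)); apply/qprojP; rewrite subr0.
have [|h [h_lin hE]] := quotm_lift (S := ker_in) g_lin; first by move=> x /ker_inP[].
exists (fun x => (low x + i (pr (p x)), theta (low x) + h (p x))); split.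
- move=> k x y; rewrite low_lin p_lin pr_lin h_lin i_lin theta_lin.
  rewrite -[RHS]/(k *: (_ + _) + (_ + _), k *: (_ + _) + (_ + _)).
  by congr (_, _); [lmod F L|lmod F E]; ring.
- move=> x y [/lowi[lxy]]; rewrite lxy => prp /addrI hp; apply: lowp lxy _.
  move: (p x) (p y) prp hp => t t'; elim/qprojW: t => t; elim/qprojW: t' => t'.
  rewrite !prE !hE => /qprojP tK gt; apply/qprojP/ker_inP; split=> //.
  by rewrite (linB g_lin) gt subrr.
by move=> x z ->; rewrite prE hE.
Qed.
End Splitting.

Lemma sum3_lin (F : fieldType) (L0 T1 T2 T3 L : lmodType F)
    (i1 : T1 -> L) (i2 : T2 -> L) (i3 : T3 -> L)
    (p1 : L0 -> T1) (p2 : L0 -> T2) (p3 : L0 -> T3) :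
  linear i1 -> linear i2 -> linear i3 -> linear p1 -> linear p2 -> linear p3 ->
  linear (fun z => i1 (p1 z) + (i2 (p2 z) + i3 (p3 z))).
Proof.
move=> li1 li2 li3 lp1 lp2 lp3 k x y.
by rewrite lp1 lp2 lp3 li1 li2 li3; lmod F L; ring.
Qed.

Lemma addrA3 (L : zmodType) (a b c d : L) : a + (b + c) + d = a + (b + (c + d)).
Proof. by rewrite -!addrA. Qed.

Lemma tuple4_inj (A B C D : Type) (x x' : A) (s s' : B) (w w' : C) (t t' : D) :
  (x, s, w, t) = (x', s', w', t') -> [/\ x = x', s = s', w = w' & t = t'].
Proof. by case. Qed.

Section LieSplitting.
Variables (F : fieldType) (I : choiceType) (q : BCquadruple F).
Variables (K : submodClosed (braces q)) (E : lmodType F).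
Variables (theta : lieL I K -> E) (g : braces q -> E).
Hypotheses (theta_lin : linear theta) (g_lin : linear g).
Local Notation K0 := (ker_in K g).

Let low (z : lieL I K0) : lieL I K := in1 K z.1.1.1 + (in2 K z.1.1.2 + in3 K z.1.2).
Let p (z : lieL I K0) : quotm K0 := z.2.

Let low_lin : linear low.
Proof. by apply: sum3_lin; [exact: in1_lin|exact: in2_lin|exact: in3_lin| | |]; move=> k x y. Qed.

Let p_lin : linear p.
Proof. by move=> k x y. Qed.

Let lowE x s w t : low (x, s, w, t) = (x, s, w, 0).
Proof. by rewrite [RHS]in_sum (lin0 (in4_lin I (K := K))) addr0. Qed.

Let low_in4 x s w r t : low (x, s, w, r) + in4 I t = (x, s, w, t).
Proof. by rewrite [RHS]in_sum; apply: addrA3. Qed.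

Let lowp x y : low x = low y -> p x = p y -> x = y.
Proof.
case: x y => [[[x s] w] t] [[[x' s'] w'] t'] e.
have [-> -> -> _] := tuple4_inj (etrans (esym (lowE x s w t)) (etrans e (lowE x' s' w' t'))).
by rewrite /p /= => ->.
Qed.

Let low4 x y t t' : low x + in4 I t = low y + in4 I t' -> low x = low y /\ t = t'.
Proof.
case: x y => [[[x s] w] r] [[[x' s'] w'] r'] e.
have {e} e := etrans (esym (low_in4 x s w r t)) (etrans e (low_in4 x' s' w' r' t')).
have [ex es ew et] := tuple4_inj e; split; last exact: et.
by rewrite !lowE ex es ew.
Qed.

(** The images are chosen to be the lifted generators of the central extension: the graph of θ on
    the first three summands, and g on {𝔟, 𝔟}. *)
Lemma lieL_splitting : exists phi : lieL I K0 -> (lieL I K * E)%type,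
  [/\ linear phi /\ injective phi,
      forall d x a, phi (gen K0 d x a) = (gen K d x a, theta (gen K d x a)),
      forall u c, phi (inVC K0 u c) = (inVC K u c, theta (inVC K u c)),
      forall b b', phi (angle I K0 b b') = (angle I K b b', g (brace b b')) &
      forall x s w, (phi (x, s, w, 0)).1 = (x, s, w, 0)].
Proof.
have [phi [phi_lin phi_inj phiE]] := @splitting F _ E K g g_lin _ _ _ _ _ _
  low_lin p_lin (in4_lin I (K := K)) theta_lin lowp low4.
have g0 := lin0 g_lin; have q0 := lin0 (qproj_linear K); have q00 := lin0 (qproj_linear K0).
have i0 := lin0 (in4_lin I (K := K)).
have phi0 x s w : phi (x, s, w, 0) = ((x, s, w, 0), theta (x, s, w, 0)).
  by rewrite (phiE _ 0) ?q00 // q0 i0 g0 !addr0 lowE.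
exists phi; split.
- exact: conj phi_lin phi_inj.
- by move=> d x a; case: d; exact: phi0.
- by move=> u c; exact: phi0.
- move=> b b'; rewrite (phiE _ (brace b b')) // lowE.
  by rewrite -[(0, 0, 0, 0)]/(0 : lieL I K) (lin0 theta_lin) !add0r.
by move=> x s w; rewrite phi0.
Qed.
End LieSplitting.

(** The functional x ⊗ a ↦ (entry of x at (j, k)) a, extended by 0, recovers every matrix entry of x
    from x ⊗ 1. *)
Lemma gen1_eq0 (F : fieldType) (I : choiceType) (q : BCquadruple F)
    (K : submodClosed (braces q)) (x : vsp F I -> vsp F I) :
  x \in spG -> gen K false x 1 = 0 -> x = 0.
Proof.
move=> xG x0; have lx := @spd_linear _ _ false x xG.
apply/funext => u; apply: (linear_ext lx (g := 0)) => [k a b|k].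
  by rewrite scaler0 addr0.
apply: vspP => j; rewrite -[(0 : vsp F I -> vsp F I) _]/(0 : vsp F I) coeff0.
pose T (d : bool) (y : vsp F I -> vsp F I) (a : calg q) : calg q :=
  if d then 0 else coeff j (y (bv F k)) *: a.
have [||||th [th_lin thE _ _]] := @lieL_lift F I q K (calg q) T (fun _ _ => 0).
- move=> d a c y z _ _ _; rewrite /T; case: d; first by rewrite scaler0 addr0.
  rewrite -[(_ + _ : vsp F I -> vsp F I) _]/(c *: y (bv F k) + z (bv F k)).
  by rewrite coeffD coeffZ scalerDl scalerA.
- move=> d y c a b _ _ _; rewrite /T; case: d; first by rewrite scaler0 addr0.
  by rewrite scalerDr !scalerA mulrC.
- by move=> c k' y z; rewrite scaler0 addr0.
- by move=> w k' y z; rewrite scaler0 addr0.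
have := thE false x 1 xG (std1 q); rewrite x0 (lin0 th_lin) => /esym/eqP.
by rewrite /T scaler_eq0 oner_eq0 orbF => /eqP.
Qed.

Lemma uniform_property_sub (F : fieldType) (q : BCquadruple F) l
    (K K' : submodClosed (braces q)) :
  {subset K' <= K} -> uniform_property l K -> uniform_property l K'.
Proof. by move=> K'K [HK sK]; split=> [z /K'K/HK|s /K'K/sK]. Qed.

Theorem theorem1p48
  (F : fieldType) (F_char0 : [pchar F] =i pred0)
  (I : choiceType) (I_infinite : infinite_set [set: I])
  (l : nat) (l_gt3 : (3 < l)%N) (I0 : {fset I}) (card_I0 : #|` I0| = l)
  (q : BCquadruple F)
  (K : submodClosed (braces q)) (K_uniform : uniform_property l K)
  (br : lieL I K -> lieL I K -> lieL I K) (br_lieL : lieL_bracket I0 br)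
  (E : lmodType F) (tau : lieL I K -> lieL I K -> E)
  (tau_cocycle : cocycle2 br tau)
  (ext_perfect : perfect (ext_bracket br tau)) :
  has_coordinate_quadruple I0 q (ext_bracket br tau) /\
  exists (K0 : submodClosed (braces q))
         (brc : lieL I K0 -> lieL I K0 -> lieL I K0)
         (phi : lieL I K0 -> (lieL I K * E)%type),
    [/\ uniform_property l K0,
        lieL_bracket I0 brc,
        lie_iso brc (ext_bracket br tau) phi,
        forall x s w, (phi (x, s, w, 0)).1 = (x, s, w, 0) &
        forall b b', (phi (angle I K0 b b')).1 = angle I K b b'].
Proof.
have ell_gt0 : (0 < ell I0)%N by rewrite /ell card_I0; apply: ltn_trans l_gt3.
have brP := lieL_presented br_lieL.
have lift := @lieL_lift F I q K E.
have [theta [theta_lin theta_ang thetaG]] :=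
  theta_ex F_char0 ell_gt0 I_infinite brP tau_cocycle lift.
have twist0 g z : g \in spG -> twist br tau theta (gen K false g 1) z = 0.
  by move=> gG; rewrite /twist thetaG // subrr.
(* Two distinct reference indices, at which κ is normalized. *)
have [i [j [_ [ij _ _]]]] := three_indices F I0 I_infinite.
have extP := ext_presented F_char0 ell_gt0 I_infinite brP tau_cocycle theta_lin theta_ang
  twist0 ext_perfect ij.
have kapP := kap_brace_like F_char0 ell_gt0 I_infinite brP
  (twist_cocycle brP tau_cocycle theta_lin) twist0 ij.
have [g [g_lin gE]] := brace_lift kapP.
have [phi [[phi_lin phi_inj] phi_gen phi_VC phi_ang phi_fst]] :=
  lieL_splitting theta_lin g_lin.
have phi_eang b b' : phi (angle I (ker_in K g) b b') =
    eang I0 br (gen K) (inVC K) (angle I K) tau theta i j b b'.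
  by rewrite phi_ang gE.
(* Surjectivity comes from the induction principle of [extP], hence from perfectness. *)
have phi_surj : forall z, exists x, phi x = z.
  apply: (pr_ind extP) => [|k _ _ [x <-] [y <-]|d x a _ _|u c|b b'].
  - by exists 0; apply: lin0.
  - by exists (k *: x + y); apply: phi_lin.
  - by eexists; apply: phi_gen.
  - by eexists; apply: phi_VC.
  by eexists; apply: phi_eang.
have [psi psiK] := choice phi_surj.
have phiK : cancel phi psi by move=> x; apply: phi_inj; apply: psiK.
have brcP := pull_lieL F_char0 ell_gt0 extP phi_lin phiK psiK
  (fun d x a _ _ => phi_gen d x a) phi_VC phi_eang.
have K0_uniform : uniform_property l (ker_in K g).
  by apply: uniform_property_sub K_uniform => z /(ker_inP K g_lin)[].
have iso : lie_iso (pull_bracket (ext_bracket br tau) phi psi) (ext_bracket br tau) phi.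
  by split; [exact: phi_lin|exists psi|move=> x y; apply: psiK].
split; last first.
  exists (ker_in K g : submodClosed _), (pull_bracket (ext_bracket br tau) phi psi), phi.
  by split=> // b b'; rewrite phi_ang.
split; last first.
  exists (ker_in K g : submodClosed _), (pull_bracket (ext_bracket br tau) phi psi), phi.
  by split; rewrite // /ell card_I0.
(* 𝒢 ⊗ 1 embeds in the extension because the projection to ℒ is already injective on its lift. *)
apply: (presented_graded F_char0 ell_gt0 I_infinite extP) => x xG.
by move/(congr1 fst); apply: gen1_eq0.
Qed.
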